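(* Let $d\ge 1$, $\mu>0$, let $W_\mu^B(x)=(1-\|x\|^2)^{\mu-1/2}$ on the unit ball $B^d$, and let $T_\theta(W_\mu^B;f)$ be the associated generalized translation operator. Then for $f\in L^1(W_\mu^B)$, $0\le\theta\le\pi$ and almost every $x\in B^d$ (regarded as a row vector, $\|x\|<1$), $$T_\theta(W_\mu^B;f,x)=A_\mu\left(\sqrt{1-\|x\|^2}\right)^{d-1}\int_{uA(x)u^T\le 1} f\left(\cos\theta\, x+\sin\theta\sqrt{1-\|x\|^2}\,u\right)\left(1-uA(x)u^T\right)^{\mu-1}du,$$ where $u\in\mathbb{R}^d$ is a row vector, $A(x)=(1-\|x\|^2)I+x^Tx$ (with $I$ the $d\times d$ identity matrix and $x^T$ the transpose of $x$, a column vector), and $A_\mu=1/\int_{B^d}(1-\|x\|^2)^{\mu-1}dx$.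
   Context: $B^d=\{x\in\mathbb{R}^d:\|x\|\le 1\}$. $L^1(W_\mu^B)$ is the space of measurable functions $f$ on $B^d$ with $\int_{B^d}|f(x)|W_\mu^B(x)dx<\infty$. Set $a_\mu^{-1}=\int_{B^d}W_\mu^B(x)dx$, $c_\mu^{-1}=\int_{-1}^1(1-t^2)^{\mu-1}dt$, and $b_\alpha^{-1}=\int_{-1}^1(1-s^2)^{\alpha-1/2}ds$. Convolution on the ball (for this classical weight): for $f\in L^1(W_\mu^B)$ and $g\in C[-1,1]$, $$(f\star_\mu^B g)(x)=a_\mu\int_{B^d}f(y)\left[c_\mu\int_{-1}^1 g\left(\langle x,y\rangle+t\sqrt{1-\|x\|^2}\sqrt{1-\|y\|^2}\right)(1-t^2)^{\mu-1}dt\right]W_\mu^B(y)dy.$$ Generalized translation operator: $T_\theta(W_\mu^B;f)$, $0\le\theta\le\pi$, with values $T_\theta(W_\mu^B;f,x)$, is defined implicitly by $$b_{\mu+(d-1)/2}\int_0^\pi T_\theta(W_\mu^B;f,x)\,g(\cos\theta)(\sin\theta)^{2\mu+d-1}d\theta=(f\star_\mu^B g)(x)\quad\text{for every } g\in C[-1,1],$$ where $\theta\mapsto T_\theta(W_\mu^B;f)$ is taken to be the representative that is continuous from $[0,\pi]$ into $L^1(W_\mu^B)$. *)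

(* Defs.v *)
From HB Require Import structures.
From mathcomp Require Import all_boot all_order all_algebra.
From mathcomp Require Import all_classical all_reals all_analysis.

Set Implicit Arguments.
Unset Strict Implicit.
Unset Printing Implicit Defensive.

Import Order.TTheory GRing.Theory Num.Theory.
Import numFieldNormedType.Exports.

Local Open Scope classical_set_scope.
Local Open Scope ring_scope.

(* The measurable structure of 'rV[R]_n is the sigma-algebra generated by the
   coordinates, as for n.-tuple R; it is the Borel sigma-algebra of R^n. *)
Section measurable_rV.
Context {R : realType} {n : nat}.

Definition rV_coord (i : 'I_n) (v : 'rV[R]_n) : measurableTypeR R := v ord0 i.

Let rV_set0 : g_sigma_preimage rV_coord set0.
Proof. exact: sigma_algebra0. Qed.

Let rV_setC A : g_sigma_preimage rV_coord A -> g_sigma_preimage rV_coord (~` A).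
Proof. exact: sigma_algebraC. Qed.

Let rV_bigcup (F : (set 'rV[R]_n)^nat) :
  (forall i, g_sigma_preimage rV_coord (F i)) ->
  g_sigma_preimage rV_coord (\bigcup_i (F i)).
Proof. exact: sigma_algebra_bigcup. Qed.

HB.instance Definition _ := @isMeasurable.Build default_measure_display
  'rV[R]_n (g_sigma_preimage rV_coord) rV_set0 rV_setC rV_bigcup.

End measurable_rV.

Section rV_measurability.
Context {R : realType}.

Lemma measurable_rV_coord n (i : 'I_n) :
  measurable_fun [set: 'rV[R]_n] (rV_coord i).
Proof.
move=> _ Y mY; rewrite setTI; apply: sub_sigma_algebra => /=.
rewrite -bigcup_seq/=; exists i => /=; first by rewrite mem_index_enum.
by exists Y => //; rewrite setTI.
Qed.

Lemma measurable_fun_rV d (T : measurableType d) n (f : T -> 'rV[R]_n) :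
  (forall i, measurable_fun setT (rV_coord i \o f)) -> measurable_fun setT f.
Proof.
move=> mf _ Y; rewrite setTI.
suff sub : g_sigma_preimage (@rV_coord R n) `<=`
    [set A | measurable (f @^-1` A)] by exact: sub.
apply: smallest_sub.
  split => /=.
  - by rewrite preimage_set0.
  - by move=> A mA; rewrite setTD preimage_setC; exact: measurableC.
  - by move=> F mF; rewrite preimage_bigcup; exact: bigcup_measurable.
move=> A; rewrite -bigcup_seq => -[i _ [B mB <-]] /=.
by rewrite setTI -comp_preimage -[_ @^-1` _]setTI; exact: mf.
Qed.

Definition rV_cons n (p : measurableTypeR R * 'rV[R]_n) : 'rV[R]_n.+1 :=
  row_mx (p.1 : R)%:M p.2.

Lemma measurable_rV_cons n : measurable_fun setT (@rV_cons n).
Proof.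
apply: measurable_fun_rV => i.
have [j ->|j ->] := split_ordP (i : 'I_(1 + n)).
  rewrite (_ : _ \o _ = fst); first exact: measurable_fst.
  apply/funext => -[a v]; rewrite /= /rV_coord /rV_cons.
  by rewrite (row_mxEl (a%:M : 'M[R]_1)) mxE (ord1 j).
rewrite (_ : _ \o _ = rV_coord j \o snd).
  by apply: measurableT_comp; [exact: measurable_rV_coord|exact: measurable_snd].
apply/funext => -[a v]; rewrite /= /rV_coord /rV_cons.
by rewrite (row_mxEr (a%:M : 'M[R]_1)).
Qed.

Lemma rV_consE0 n (p : measurableTypeR R * 'rV[R]_n) :
  rV_cons p ord0 ord0 = p.1.
Proof.
rewrite /rV_cons (_ : ord0 = lshift n (ord0 : 'I_1)); last exact: val_inj.
by rewrite (row_mxEl (p.1%:M : 'M[R]_1)) mxE eqxx.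
Qed.

Lemma rV_consES n (p : measurableTypeR R * 'rV[R]_n) (i : 'I_n) :
  rV_cons p ord0 (lift ord0 i) = p.2 ord0 i.
Proof.
rewrite /rV_cons (_ : lift ord0 i = rshift 1 i); last exact: val_inj.
by rewrite (row_mxEr (p.1%:M : 'M[R]_1)).
Qed.

Definition rV_uncons n (v : 'rV[R]_n.+1) : measurableTypeR R * 'rV[R]_n :=
  (v ord0 ord0, \row_i v ord0 (lift ord0 i)).

Lemma rV_consK n : cancel (@rV_cons n) (@rV_uncons n).
Proof.
move=> p; rewrite /rV_uncons rV_consE0 [RHS]surjective_pairing; congr pair.
by apply/rowP => i; rewrite mxE rV_consES.
Qed.

Lemma measurable_rV_uncons n : measurable_fun setT (@rV_uncons n).
Proof.
apply/measurable_fun_pairP; split; first exact: (measurable_rV_coord ord0).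
apply: measurable_fun_rV => i.
rewrite (_ : _ \o _ = rV_coord (lift ord0 i)); first exact: measurable_rV_coord.
by apply/funext => v; rewrite /= /rV_coord mxE.
Qed.

End rV_measurability.

Section rV_cons_measure.
Context {R : realType} {n : nat}.
Variable m : {sigma_finite_measure set 'rV[R]_n -> \bar R}.

HB.instance Definition _ := @isMeasurableFun.Build _ _ _ _
  (@rV_cons R n) (@measurable_rV_cons R n).

Definition rV_cons_measure : set 'rV[R]_n.+1 -> \bar R :=
  pushforward (@lebesgue_measure R \x m)%E (@rV_cons R n).

Let rV_cons_measure0 : rV_cons_measure set0 = 0%E.
Proof. exact: measure0. Qed.

Let rV_cons_measure_ge0 A : (0 <= rV_cons_measure A)%E.
Proof. exact: measure_ge0. Qed.

Let rV_cons_measure_sigma_additive : semi_sigma_additive rV_cons_measure.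
Proof. exact: measure_semi_sigma_additive. Qed.

HB.instance Definition _ := isMeasure.Build _ _ _ rV_cons_measure
  rV_cons_measure0 rV_cons_measure_ge0 rV_cons_measure_sigma_additive.

Let rV_cons_measure_sigma_finite : sigma_finite setT rV_cons_measure.
Proof.
have /sigma_finiteP[F [FT ndF Foo]] := sigma_finiteT (@lebesgue_measure R).
have /sigma_finiteP[G [GT ndG Goo]] := sigma_finiteT m.
exists (fun k => @rV_uncons R n @^-1` (F k `*` G k)).
  rewrite -preimage_bigcup -[LHS](preimage_setT (@rV_uncons R n)).
  congr (_ @^-1` _); rewrite -setXTT FT GT predeqE => -[x y]; split.
    move=> [/= [i _ Fix] [k _ Gky]]; exists (maxn i k) => //; split.
    - by move: x Fix; exact/subsetPset/ndF/leq_maxl.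
    - by move: y Gky; exact/subsetPset/ndG/leq_maxr.
  by move=> [i _ []/= ? ?]; split; exists i.
move=> k; have [mFk Fkoo] := Foo k; have [mGk Gkoo] := Goo k; split.
  rewrite -[X in measurable X]setTI; apply: measurable_rV_uncons => //.
  exact: measurableX.
rewrite /rV_cons_measure /pushforward -comp_preimage.
rewrite (_ : _ \o _ = id) ?preimage_id; last exact/funext/rV_consK.
by rewrite product_measure1E// lte_mul_pinfty// ge0_fin_numE.
Qed.

HB.instance Definition _ := Measure_isSigmaFinite.Build _ _ _ rV_cons_measure
  rV_cons_measure_sigma_finite.

End rV_cons_measure.

Fixpoint lebesgue_rV (R : realType) (n : nat) :
    {sigma_finite_measure set 'rV[R]_n -> \bar R} :=
  if n is k.+1 then rV_cons_measure (lebesgue_rV R k)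
  else dirac (0 : 'rV[R]_0).

Lemma lebesgue_rV_box (R : realType) (n : nat)
    (A : 'I_n -> set (measurableTypeR R)) :
  (forall i, measurable (A i)) ->
  lebesgue_rV R n [set v | forall i, A i (v ord0 i)] =
  (\prod_(i < n) lebesgue_measure (A i))%E.
Proof.
elim: n A => [|n IHn] A mA /=.
  rewrite big_ord0 diracE mem_set//= => -[]//.
rewrite big_ord_recl -(IHn (A \o lift ord0)) => [|i]; last exact: mA.
pose B := [set v : 'rV[R]_n | forall i, A (lift ord0 i) (v ord0 i)].
have mB : measurable B.
  rewrite (_ : B = \bigcap_(i in [set: 'I_n])
      (rV_coord i @^-1` A (lift ord0 i))).
    apply: fin_bigcap_measurable => // i _.
    by rewrite -[X in measurable X]setTI; exact: measurable_rV_coord.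
  by apply/seteqP; split => v /= Av i //=; exact: Av.
rewrite -(product_measure1E _ _ (mA ord0) mB).
congr product_measure1.
apply/seteqP; split => -[a v] /=.
  move=> Av; split; first by move: (Av ord0); rewrite rV_consE0.
  by move=> i; move: (Av (lift ord0 i)); rewrite rV_consES.
move=> [Aa Av] i; have [j ->|->] := unliftP ord0 i.
  by rewrite rV_consES; exact: Av.
by rewrite rV_consE0.
Qed.

Section ball_translation.
Context {R : realType} {d : nat}.
Implicit Types (x y u : 'rV[R]_d) (f : 'rV[R]_d -> R) (g : R -> R).
Implicit Types (mu alpha theta : R).

Definition dotrV x y : R := (x *m y^T) ord0 ord0.

(* The norm `|x| that the library puts on 'rV[R]_d is the maximum norm. *)
Definition enorm x : R := Num.sqrt (dotrV x x).

Definition eball : set 'rV[R]_d := [set x | enorm x <= 1].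

(* On the unit sphere, a null set, 0 `^ r is 0 for r < 0 rather than +oo. *)
Definition ball_weight mu x : R := (1 - enorm x ^+ 2) `^ (mu - 1 / 2).

Definition L1_ball mu f : Prop :=
  measurable_fun eball f /\
  (\int[lebesgue_rV R d]_(x in eball) (`|f x| * ball_weight mu x)%:E < +oo)%E.

Definition L1_dist mu f1 f2 : R :=
  \int[lebesgue_rV R d]_(x in eball) (`|f1 x - f2 x| * ball_weight mu x).

Definition a_const mu : R :=
  (\int[lebesgue_rV R d]_(x in eball) ball_weight mu x)^-1.

Definition c_const mu : R :=
  (\int[lebesgue_measure]_(t in `[-1, 1]) (1 - t ^+ 2) `^ (mu - 1))^-1.

Definition b_const alpha : R :=
  (\int[lebesgue_measure]_(s in `[-1, 1]) (1 - s ^+ 2) `^ (alpha - 1 / 2))^-1.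

Definition A_const mu : R :=
  (\int[lebesgue_rV R d]_(x in eball) (1 - enorm x ^+ 2) `^ (mu - 1))^-1.

Definition ball_conv mu f g x : R :=
  a_const mu * \int[lebesgue_rV R d]_(y in eball)
    (f y *
     (c_const mu * \int[lebesgue_measure]_(t in `[-1, 1])
        (g (dotrV x y + t * Num.sqrt (1 - enorm x ^+ 2)
                          * Num.sqrt (1 - enorm y ^+ 2))
         * (1 - t ^+ 2) `^ (mu - 1))) *
     ball_weight mu y).

(* F theta is T_theta(W; f).  As F theta is only determined almost everywhere,
   the integral over theta at a fixed x makes sense for a jointly measurable
   choice of representatives, and the identity holds for almost every x. *)
Record translation_of mu f (F : R -> 'rV[R]_d -> R) : Prop := {
  translation_measurable :
    measurable_fun (`[0, pi] `*` eball)
      (fun p : measurableTypeR R * 'rV[R]_d => F p.1 p.2) ;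
  translation_L1 :
    forall theta, 0 <= theta <= pi -> L1_ball mu (F theta) ;
  translation_continuous :
    forall theta0, 0 <= theta0 <= pi ->
      L1_dist mu (F theta) (F theta0)
        @[theta --> within `[0, pi] (nbhs theta0)] --> (0 : R) ;
  translation_conv :
    forall g, {within `[-1, 1], continuous g} ->
      {ae lebesgue_rV R d, forall x, eball x ->
        b_const (mu + (d%:R - 1) / 2) *
          \int[lebesgue_measure]_(theta in `[0, pi])
            (F theta x * g (cos theta) * sin theta `^ (2 * mu + d%:R - 1))
        = ball_conv mu f g x} }.

Definition generalized_translation mu
    (T : R -> ('rV[R]_d -> R) -> 'rV[R]_d -> R) : Prop :=
  forall f, L1_ball mu f -> translation_of mu f (fun theta => T theta f).

Definition Amx x : 'M[R]_d := (1 - enorm x ^+ 2)%:M + x^T *m x.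

Definition Aform x u : R := (u *m Amx x *m u^T) ord0 ord0.

End ball_translation.

Arguments eball {R d}.
Arguments A_const {R} d mu.
Arguments a_const {R} d mu.

(* Main.v *)
From HB Require Import structures.
Require Import Defs.
From mathcomp Require Import all_boot all_order all_algebra.
From mathcomp Require Import all_classical all_reals all_analysis.
From mathcomp Require Import measurable_realfun ring lra.

(** Fix x in the open ball, write [height x] for
    sqrt(1 - |x|^2), [orbit_pt th x u] for the point
    cos th x + sin th (height x) u at which f is evaluated, and put
      discr x y r = (1 - |x|^2) (1 - |y|^2) - (r - <x, y>)^2.
    For y = [orbit_pt th x u] a direct computation gives
      discr x y (cos th) = (sin th height x)^2 (1 - u A(x) u^T)
    ([discr_orbit_pt]): when sin th is not 0, the ellipsoid u A(x) u^T <= 1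
    parametrizes the set of the y with discr x y (cos th) >= 0, and discr is symmetric in x and y.
    Let [orbit_mean phi th x] be the right-hand side of the theorem for a
    bounded function phi.  Two facts follow.

    - Changing variables from u to y, (1 - |x|^2)^(mu - 1/2) times the orbit
      mean is the integral of phi against the kernel [orbit_kernel th x y],
      which is symmetric ([integral_ell_w_orbit_kernel], [orbit_kernelC]): the
      orbit mean is a self-adjoint operator for the weight of the ball.
    - Integrate the orbit mean against g (cos th) (sin th)^(2 mu + d - 1), use
      r = cos th and exchange r with y.  For fixed y the substitution
      r = <x, y> + t height x height y turns discr into a multiple of 1 - t^2,
      and what comes out is the convolution of phi with g, at every x
      ([ellipsoid_int_average], [orbit_mean_average]).  The case g = phi = 1
      computes the integral over the ellipsoid.

    So orbit means solve the equation that defines the translation.  To compare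
    them with the given T_th f, which is known almost everywhere only, both are
    paired with a test function phi.  The functions of th
      N th = int T_th f . phi . W       and      D th = int f . orbit_mean phi th . W
    have the same integrals against all g (cos th) (sin th)^(2 mu + d - 1): for N
    this is the definition of the translation ([translation_average]), for D it
    is the second fact and the symmetry of the convolution
    ([average_symmetric]).  Both are continuous on [0, pi], N because T_th f is
    continuous in L1, D by dominated convergence, which needs only that phi is
    bounded and continuous along orbits.  Hence N = D at every th
    ([pairing_dual]).  With the orbit mean on the side of phi, no continuity of
    orbit means of f in L1 has to be shown.

    For 0 < th < pi the self-adjointness and Fubini put the orbit mean back on f,
    and since the phi determine integrable functions ([tests_separate]), T_th f
    is the orbit mean of f almost everywhere ([translation_interior]).  When
    sin th = 0 the orbit of x is the single point x or - x ([translation_axis]).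
    Finally the boundary of the ellipsoid is a null set
    ([ellipsoid_boundary_null]), so that its closed and its open version give
    the same integral ([integral_ell_wE]). *)

Set Implicit Arguments.
Unset Strict Implicit.
Unset Printing Implicit Defensive.

Import Order.TTheory GRing.Theory Num.Theory.
Import numFieldNormedType.Exports.

Local Open Scope classical_set_scope.
Local Open Scope ring_scope.

(** * Affine changes of variables *)

Section affine.
Context {R : realType}.
Local Notation leb := (@lebesgue_measure R).

(** Typed on the measurable line, so that pushforwards along it are measures. *)
Definition affine (a c : R) (t : measurableTypeR R) : measurableTypeR R := a + c * t.

Lemma measurable_affine a c : measurable_fun setT (affine a c).
Proof. by apply: measurable_funD => //; exact: measurable_funM. Qed.

HB.instance Definition _ a c :=
  @isMeasurableFun.Build _ _ _ _ (affine a c) (measurable_affine a c).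

(** The pushforward of Lebesgue measure by the affine map, multiplied by |c|,
    agrees with Lebesgue measure on bounded intervals, hence everywhere. *)
Lemma ge0_integral_affine (a c : R) (h : R -> \bar R) : c != 0 ->
  measurable_fun setT h -> (forall t, 0 <= h t)%E ->
  (\int[leb]_t h t = `|c|%:E * \int[leb]_t h (a + c * t)%R)%E.
Proof.
move=> c0 mh h0.
have cge0 : 0 <= `|c| by [].
transitivity (`|c|%:E * \int[pushforward leb (affine a c)]_t h t)%E; last first.
  by rewrite (ge0_integral_pushforward (measurable_affine a c)).
rewrite -(ge0_integral_mscale (pushforward leb (affine a c))
  measurableT (NngNum cge0))//.
apply: eq_measure_integral => A mA _.
apply: lebesgue_measure_unique => // _ [[p q] _ <-] /=.
have [pq|qp] := ltP p q; last first.
  rewrite set_itv_ge ?measure0 -?leNgt ?bnd_simp//.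
rewrite /mscale /pushforward /=.
have cN : 0 < `|c| by rewrite normr_gt0.
rewrite [X in (_ * leb X)%E](_ : _ = if 0 < c
    then `](p - a) / c, (q - a) / c]%classic
    else `[(q - a) / c, (p - a) / c[%classic); last first.
  case: (ltrgtP 0 c) c0 => // [cp _|cn _]; apply/seteqP; split => t /=; rewrite !in_itv/= /affine.
  - by rewrite ltr_pdivrMr// ler_pdivlMr// => /andP[? ?]; apply/andP; split; lra.
  - by rewrite ltr_pdivrMr// ler_pdivlMr// => /andP[? ?]; apply/andP; split; lra.
  - by rewrite ltr_ndivlMr// ler_ndivrMr// => /andP[? ?]; apply/andP; split; lra.
  - by rewrite ltr_ndivlMr// ler_ndivrMr// => /andP[? ?]; apply/andP; split; lra.
transitivity (`|c|%:E * (((q - p) / `|c|)%:E))%E.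
  rewrite lebesgue_measure_itv/= lte_fin pq -EFinM -EFinB; congr EFin.
  by rewrite mulrCA divff ?mulr1// gt_eqF.
congr (_ * _)%E.
case: (ltrgtP 0 c) c0 => // [cp _|cn _]; rewrite lebesgue_measure_itv/= lte_fin.
  by rewrite gtr0_norm// ltr_pM2r ?invr_gt0// ltrD2r pq -EFinB -mulrBl; congr ((_ / _)%:E); lra.
rewrite ltr0_norm// ltr_nM2r ?invr_lt0// ltrD2r pq -EFinB -mulrBl invrN mulrN -mulNr; congr ((_ / _)%:E); lra.
Qed.

End affine.

Section rV_integral.
Context {R : realType}.
Local Notation leb := (@lebesgue_measure R).
Local Notation "'lebV' d" := (lebesgue_rV R d) (at level 10).

Lemma ge0_integral_rV_cons d (h : 'rV[R]_d.+1 -> \bar R) :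
  measurable_fun setT h -> (forall v, 0 <= h v)%E ->
  (\int[lebV d.+1]_v h v = \int[leb \x lebV d]_p h (rV_cons p))%E.
Proof.
move=> mh h0.
by rewrite (ge0_integral_pushforward (@measurable_rV_cons R d)).
Qed.

Lemma ge0_integral_rVS d (h : 'rV[R]_d.+1 -> \bar R) :
  measurable_fun setT h -> (forall v, 0 <= h v)%E ->
  (\int[lebV d.+1]_v h v = \int[leb]_t \int[lebV d]_v h (rV_cons (t, v)))%E.
Proof.
move=> mh h0; rewrite ge0_integral_rV_cons//.
have mhc : measurable_fun setT (h \o @rV_cons R d).
  by apply: measurableT_comp => //; exact: measurable_rV_cons.
by rewrite (fubini_tonelli1 _ mhc)// => p; exact: h0.
Qed.

(** Having both orders of integration yields two different recursions for
    integrals over balls, and from their comparison the relation between the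
    normalizing constants. *)
Lemma ge0_integral_rVS_swap d (h : 'rV[R]_d.+1 -> \bar R) :
  measurable_fun setT h -> (forall v, 0 <= h v)%E ->
  (\int[lebV d.+1]_v h v = \int[lebV d]_v \int[leb]_t h (rV_cons (t, v)))%E.
Proof.
move=> mh h0; rewrite ge0_integral_rV_cons//.
have mhc : measurable_fun setT (h \o @rV_cons R d).
  by apply: measurableT_comp => //; exact: measurable_rV_cons.
by rewrite (fubini_tonelli2 _ mhc)// => p; exact: h0.
Qed.

Lemma measurable_rVD d d' (T : measurableType d') (f g : T -> 'rV[R]_d) :
  measurable_fun setT f -> measurable_fun setT g ->
  measurable_fun setT (fun t => f t + g t).
Proof.
move=> mf mg; apply: measurable_fun_rV => i.
rewrite (_ : _ \o _ = (rV_coord i \o f) \+ (rV_coord i \o g)); last first.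
  by apply/funext => t; rewrite /rV_coord/= mxE.
by apply: measurable_funD; apply: measurableT_comp => //; exact: measurable_rV_coord.
Qed.

Lemma measurable_rVZ d d' (T : measurableType d') (c : T -> R) (g : T -> 'rV[R]_d) :
  measurable_fun setT c -> measurable_fun setT g ->
  measurable_fun setT (fun t => c t *: g t).
Proof.
move=> mf mg; apply: measurable_fun_rV => i.
rewrite (_ : _ \o _ = c \* (rV_coord i \o g)); last first.
  by apply/funext => t; rewrite /rV_coord/= mxE.
by apply: measurable_funM => //; apply: measurableT_comp => //; exact: measurable_rV_coord.
Qed.

Lemma dotrVE d (x y : 'rV[R]_d) :
  dotrV x y = \sum_(i < d) (x ord0 i * y ord0 i).
Proof. by rewrite /dotrV mxE; apply: eq_bigr => i _; rewrite mxE. Qed.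

Lemma measurable_dotrV d d' (T : measurableType d') (f g : T -> 'rV[R]_d) :
  measurable_fun setT f -> measurable_fun setT g ->
  measurable_fun setT (fun t => dotrV (f t) (g t)).
Proof.
move=> mf mg.
rewrite (_ : (fun t => dotrV _ _) = fun t => \sum_(i < d) (f t ord0 i * g t ord0 i)); last first.
  by apply/funext => t; rewrite dotrVE.
apply: measurable_sum => i; apply: measurable_funM.
  exact: (measurableT_comp (measurable_rV_coord i) mf).
exact: (measurableT_comp (measurable_rV_coord i) mg).
Qed.

Lemma rV_consD d (p q : measurableTypeR R * 'rV[R]_d) :
  rV_cons p + rV_cons q = rV_cons ((p.1 : R) + q.1, p.2 + q.2).
Proof.
apply/rowP => i; rewrite mxE.
by have [j ->|->] := unliftP ord0 i; rewrite ?rV_consES ?rV_consE0// mxE.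
Qed.

Lemma rV_consZ d c (p : measurableTypeR R * 'rV[R]_d) :
  c *: rV_cons p = rV_cons (c * (p.1 : R), c *: p.2).
Proof.
apply/rowP => i; rewrite mxE.
by have [j ->|->] := unliftP ord0 i; rewrite ?rV_consES ?rV_consE0// mxE.
Qed.

Lemma dotrV_cons d (p q : measurableTypeR R * 'rV[R]_d) :
  dotrV (rV_cons p) (rV_cons q) = (p.1 : R) * q.1 + dotrV p.2 q.2.
Proof.
rewrite !dotrVE big_ord_recl !rV_consE0; congr (_ + _).
by apply: eq_bigr => i _; rewrite !rV_consES.
Qed.

Lemma rV_unconsK d : cancel (@rV_uncons R d) (@rV_cons R d).
Proof.
move=> v; apply/rowP => i.
by have [j ->|->] := unliftP ord0 i; rewrite ?rV_consES ?rV_consE0// mxE.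
Qed.

(** One coordinate at a time. *)
Lemma ge0_integral_affine_rV d (a : 'rV[R]_d) (c : R) (h : 'rV[R]_d -> \bar R) :
  c != 0 -> measurable_fun setT h -> (forall v, 0 <= h v)%E ->
  (\int[lebV d]_v h v = (`|c| ^+ d)%:E * \int[lebV d]_v h (a + c *: v)%R)%E.
Proof.
move=> c0; elim: d a h => [|d IH] a h mh h0.
  rewrite expr0 mul1e; apply: eq_integral => v _; congr h.
  by apply/rowP; case.
have mhc : measurable_fun setT (fun v : 'rV[R]_d.+1 => h (a + c *: v)).
  apply: measurableT_comp => //; apply: measurable_rVD => //.
  by apply: measurable_rVZ => //; exact: measurable_id.
rewrite !ge0_integral_rVS//.
have mhc2 : measurable_fun setT (fun p => h (@rV_cons R d p)).
  by apply: measurableT_comp => //; exact: measurable_rV_cons.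
rewrite (ge0_integral_affine ((rV_uncons a).1 : R) c0); last 2 first.
- exact: (measurable_fun_fubini_tonelli_F _ mhc2).
- by move=> t; exact: integral_ge0.
rewrite exprS EFinM -muleA; congr (_ * _)%E.
rewrite -ge0_integralZl//; last 2 first.
- have mhc3 : measurable_fun setT (fun p => h (a + c *: @rV_cons R d p)).
    by apply: (measurableT_comp mhc); exact: measurable_rV_cons.
  exact: (measurable_fun_fubini_tonelli_F _ mhc3).
- by move=> t _; exact: integral_ge0.
apply: eq_integral => t _.
rewrite (IH (rV_uncons a).2); last 2 first.
- exact: (measurableT_comp mhc2 (pair1_measurable _)).
- by move=> v.
congr (_ * _)%E; apply: eq_integral => v _; congr h.
by rewrite -{3}[a]rV_unconsK rV_consZ rV_consD.
Qed.

(** True for the conventional value -oo of +oo - (+oo) as well, since a positive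
    factor fixes it.  This is why positive constants and affine substitutions
    go through integrals of signed functions that may fail to be integrable. *)
Lemma EFinZBr (r : R) (x y : \bar R) : 0 < r ->
  (r%:E * (x - y) = r%:E * x - r%:E * y)%E.
Proof.
move=> r0; have r0e : (0 < r%:E)%E by rewrite lte_fin.
case: x y => [x| |] [y| |] /=; rewrite ?(gt0_muley r0e) ?(gt0_muleNy r0e)//.
all: try by rewrite -EFinB -!EFinM mulrBr.
all: try by rewrite -!EFinM.
Qed.

(** The positive and negative parts transform separately, and [EFinZBr] puts them
    together whether or not h is integrable. *)
Lemma integral_affine_rV d (a : 'rV[R]_d) (c : R) (h : 'rV[R]_d -> \bar R) :
  c != 0 -> measurable_fun setT h ->
  (\int[lebV d]_v h v = (`|c| ^+ d)%:E * \int[lebV d]_v h (a + c *: v)%R)%E.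
Proof.
move=> c0 mh.
rewrite integralE [in RHS]integralE EFinZBr ?exprn_gt0 ?normr_gt0//.
rewrite (ge0_integral_affine_rV a c0 (measurable_funepos mh))//.
rewrite (ge0_integral_affine_rV a c0 (measurable_funeneg mh))//.
by congr (_ * _ - _ * _)%E; apply: eq_integral => v _; rewrite ?funeposE ?funenegE.
Qed.

End rV_integral.

(** * Densities and the substitution r = cos t *)

Section density.
Context d (T : measurableType d) (R : realType).
Variables (mu : {measure set T -> \bar R}) (w : T -> R).
Hypotheses (mw : measurable_fun setT w) (w0 : forall x, 0 <= w x).

(** The two proofs are arguments so that the function of sets can carry its
    structure of measure. *)
Definition density of measurable_fun setT w & (forall x, 0 <= w x) :=
  fun A : set T => (\int[mu]_(x in A) (w x)%:E)%E.

Local Notation nu := (density mw w0).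

Let mwe : measurable_fun setT (EFin \o w).
Proof. exact/measurable_EFinP. Qed.

Let density0 : nu set0 = 0%E.
Proof. exact: integral_set0. Qed.

Let density_ge0 A : (0 <= nu A)%E.
Proof. by apply: integral_ge0 => x _; rewrite lee_fin. Qed.

Let density_sigma_additive : semi_sigma_additive nu.
Proof.
move=> F mF tF mUF; rewrite /density ge0_integral_bigcup//.
- by apply: is_cvg_nneseries => n _ _; exact: density_ge0.
- exact: measurable_funTS.
- by move=> x _; rewrite lee_fin.
Qed.

HB.instance Definition _ := isMeasure.Build _ _ _ nu
  density0 density_ge0 density_sigma_additive.

Import HBNNSimple.

(** By monotone convergence from simple functions, for which it is the definition
    of the measure. *)
Lemma ge0_integral_density (h : T -> \bar R) : measurable_fun setT h ->
  (forall x, 0 <= h x)%E -> (\int[nu]_x h x = \int[mu]_x ((w x)%:E * h x))%E.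
Proof.
move=> mh h0.
pose h_ := nnsfun_approx measurableT mh.
have hE x : (fun n => (h_ n x)%:E) @ \oo --> h x by exact: cvg_nnsfun_approx.
have mh_ n : measurable_fun setT (fun x => (h_ n x)%:E).
  exact/measurable_EFinP.
transitivity (limn (fun n => \int[nu]_x (h_ n x)%:E)%E).
  rewrite -monotone_convergence//.
  - by apply: eq_integral => y _; apply/esym/cvg_lim => //; exact: hE.
  - by move=> n y _; rewrite lee_fin.
  - by move=> y _ m n mn; rewrite lee_fin; exact/lefP/nd_nnsfun_approx.
transitivity (limn (fun n => \int[mu]_x ((w x)%:E * (h_ n x)%:E))%E); last first.
  rewrite -monotone_convergence//.
  - apply: eq_integral => y _; apply/cvg_lim => //.
    by apply: cvgeZl => //; exact: hE.
  - by move=> n; exact: emeasurable_funM.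
  - by move=> n y _; rewrite mule_ge0// lee_fin.
  - by move=> y _ m n mn; rewrite lee_wpmul2l// lee_fin//; exact/lefP/nd_nnsfun_approx.
congr (limn _); apply/funext => n.
transitivity (\int[nu]_x \sum_(r \in range (h_ n))
    (r * \1_(h_ n @^-1` [set r]) x)%:E)%E.
  by apply: eq_integral => x _; rewrite {1}fimfunE -fsumEFin.
rewrite ge0_integral_fsum//; last 2 first.
- by move=> r; exact/measurable_EFinP/measurable_funM.
- by move=> r x _; rewrite nnfun_muleindic_ge0.
transitivity (\int[mu]_x \sum_(r \in range (h_ n))
    ((w x)%:E * (r * \1_(h_ n @^-1` [set r]) x)%:E))%E; last first.
  apply: eq_integral => x _; rewrite [in RHS]fimfunE -fsumEFin//.
  by rewrite ge0_mule_fsumr// => r; rewrite nnfun_muleindic_ge0.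
rewrite ge0_integral_fsum//; last 2 first.
- move=> r; apply: emeasurable_funM => //.
  exact/measurable_EFinP/measurable_funM.
- by move=> r x _; rewrite mule_ge0 ?nnfun_muleindic_ge0// lee_fin.
apply: eq_fsbigr => r; rewrite inE => -[x _ hxr].
have r0 : 0 <= r by rewrite -hxr.
rewrite integralZl_indic_nnsfun// integral_indic//= setIT.
under [RHS]eq_integral do rewrite EFinM muleCA.
rewrite ge0_integralZl//; last 2 first.
- by apply: emeasurable_funM => //; exact/measurable_EFinP.
- by move=> y _; rewrite mule_ge0 ?lee_fin.
congr (_ * _)%E; rewrite /density integral_mkcond; apply: eq_integral => y _.
by rewrite epatch_indic.
Qed.

End density.

Section cos_substitution.
Context {R : realType}.
Local Notation leb := (@lebesgue_measure R).

(** Cut to [0, pi] to be a nonnegative density on the whole line. *)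
Definition sin_part (t : measurableTypeR R) : R :=
  sin t * \1_(`[0, pi]%classic : set R) t.

Lemma sin_part_ge0 t : 0 <= sin_part t.
Proof.
rewrite /sin_part indicE; case: (boolP (_ \in _)) => [|_]; last by rewrite mulr0.
by rewrite inE/= in_itv/= => /andP[t0 tpi]; rewrite mulr1 sin_ge0_pi// t0.
Qed.

Lemma measurable_sin_part : measurable_fun setT sin_part.
Proof.
apply: measurable_funM.
  by apply: continuous_measurable_fun; exact: continuous_sin.
exact: measurable_indic.
Qed.

Let m := density leb measurable_sin_part sin_part_ge0.

Definition cosT (t : measurableTypeR R) : measurableTypeR R := cos t.

Lemma measurable_cosT : measurable_fun setT cosT.
Proof. by apply: continuous_measurable_fun; exact: continuous_cos. Qed.

HB.instance Definition _ :=
  @isMeasurableFun.Build _ _ _ _ cosT measurable_cosT.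

Lemma integral_sin (a : R) : 0 <= a ->
  (\int[leb]_(t in `[0%R, a]) (sin t)%:E = (1 - cos a)%:E)%E.
Proof.
rewrite le_eqVlt => /predU1P[<-|a0].
  by rewrite set_itv1 integral_set1 cos0 subrr.
rewrite (@continuous_FTC2 _ sin (fun t => - cos t))//.
- by rewrite cos0 -EFinB opprK addrC.
- by apply: continuous_subspaceT; exact: continuous_sin.
- split => //.
  + by apply: cvg_at_right_filter; apply: cvgN; exact: continuous_cos.
  + by apply: cvg_at_left_filter; apply: cvgN; exact: continuous_cos.
- move=> t _; rewrite derive1E deriveN//.
  by rewrite (@derive_val _ _ _ _ _ _ _ (is_derive_cos t)) opprK.
Qed.

Let ind11 (t : measurableTypeR R) : R := \1_(`[(-1)%R, 1%R]%classic : set R) t.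
Let ind11_ge0 t : 0 <= ind11 t. Proof. by rewrite /ind11 indicE. Qed.
Let measurable_ind11 : measurable_fun setT ind11.
Proof. exact: measurable_indic. Qed.

Let m1 := density leb measurable_ind11 ind11_ge0.

Let m1I (A : set (measurableTypeR R)) : measurable A ->
  m1 A = leb (`[(-1)%R, 1%R]%classic `&` A).
Proof. by move=> mA; rewrite /m1 /density /ind11 integral_indic. Qed.

Let m1E (q : R) : m1 `[q, +oo[%classic = m (cosT @^-1` `[q, +oo[%classic).
Proof.
rewrite m1I//.
have [q1|q1] := ltP 1 q.
  transitivity (0%E : \bar R).
    rewrite [X in leb X](_ : _ = set0) ?measure0//.
    apply/seteqP; split => // x [] /=; rewrite !in_itv/= => /andP[_ ?]; lra.
  apply/esym; rewrite /m /density integral0_eq// => x /=; rewrite in_itv/= andbT /cosT.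
  by move=> qx; have := lt_le_trans q1 (le_trans qx (cos_le1 _)); rewrite ltxx.
pose q' := Order.max q (-1).
have q'1 : -1 <= q' <= 1 by rewrite le_max lexx orbT ge_max q1/=; lra.
transitivity ((1 - q')%:E).
  rewrite [X in leb X](_ : _ = `[q', 1]%classic); last first.
    apply/seteqP; split => x /=; rewrite !in_itv/= ?andbT ge_max.
      by move=> [/andP[-> ->] ->].
    by move=> /andP[/andP[-> ->] ->].
  by rewrite lebesgue_measure_itv/= lte_fin; case: ltP => // ?; congr EFin; lra.
have a0 : 0 <= acos q' by exact: acos_ge0.
rewrite -{1}(@acosK _ q')// -integral_sin// [LHS]integral_mkcond.
rewrite /m /density [RHS]integral_mkcond.
apply: eq_integral => x _; rewrite !patchE /sin_part indicE.
have [xpi|xpi] := boolP (x \in (`[0, pi]%classic : set R)); last first.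
  rewrite mulr0; case: ifPn => [|_]; last by case: ifPn.
  rewrite inE/= in_itv/= => /andP[x0 xa]; case/negP: xpi.
  by rewrite inE/= in_itv/= x0 (le_trans xa)// acos_lepi.
rewrite mulr1.
have -> : (x \in `[0, acos q']%classic) = (x \in cosT @^-1` `[q, +oo[%classic).
  move: xpi; rewrite inE/= => xpi; apply/idP/idP; rewrite !inE/= !in_itv/= ?andbT.
    move=> /andP[x0 xa].
    rewrite (@le_trans _ _ q') ?le_max ?lexx// -(@acosK _ q')//.
    by rewrite leNgt ltr_cos ?in_itv/= ?a0 ?acos_lepi// -leNgt.
  move=> qx; move: (xpi); rewrite in_itv/= => /andP[-> _] /=.
  have : q' <= cos x by rewrite ge_max qx cos_geN1.
  rewrite -{1}(@acosK _ q')// leNgt ltr_cos ?in_itv/= ?a0 ?acos_lepi//.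
  by rewrite -leNgt.
by [].
Qed.

(** The image under cos of the measure sin t dt on [0, pi] and Lebesgue measure
    on [-1, 1] agree on the half-lines [q, +oo[, where both are 1 - q for q in
    [-1, 1]; these half-lines form a pi-system. *)
Lemma integral_cos_sin (h : R -> \bar R) : measurable_fun setT h ->
  (forall r, 0 <= h r)%E ->
  (\int[leb]_(r in `[(-1)%R, 1%R]) h r =
   \int[leb]_(t in `[0%R, pi]) ((sin t)%:E * h (cos t)))%E.
Proof.
move=> mh h0.
transitivity (\int[pushforward m cosT]_r h r)%E; last first.
  rewrite (ge0_integral_pushforward measurable_cosT)//.
  have mhc : measurable_fun setT (h \o cosT).
    by apply: measurableT_comp => //; exact: measurable_cosT.
  have hc0 t : (0 <= (h \o cosT) t)%E by exact: h0.
  rewrite preimage_setT (ge0_integral_density _ _ _ mhc hc0) [RHS]integral_mkcond; apply: eq_integral => t _ /=.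
  rewrite /sin_part patchE indicE; case: ifPn => _.
    by rewrite mulr1.
  by rewrite mulr0 mul0e.
transitivity (\int[m1]_r h r)%E.
  rewrite ge0_integral_density// [LHS]integral_mkcond.
  apply: eq_integral => r _.
  by rewrite patchE /ind11 indicE; case: ifPn => _; rewrite ?mul1e ?mul0e.
apply: eq_measure_integral => A mA _.
pose g (k : nat) : set (measurableTypeR R) := `[- k%:R, +oo[%classic.
refine (@measure_unique _ R (measurableTypeR R) (@RGenCInfty.G R) g (RGenCInfty.measurableE R) _ _ _ _ _ _ _ A mA) => //.
- move=> _ _ [x ->] [y ->]; exists (Order.max x y).
  by apply/seteqP; split => z /=; rewrite !in_itv/= !andbT ge_max; [move=> [-> ->]|move=> /andP].
- by move=> k; exists (- k%:R).
- apply/seteqP; split => // x _; exists (Num.truncn `|x|).+1 => //=.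
  rewrite /g /= in_itv/= andbT lerNl.
  by rewrite (le_trans (ler_norm _))// normrN ltW// truncnS_gt.
- by move=> _ [q ->]; exact: m1E.
- move=> k; apply: (@le_lt_trans _ _ (leb `[(-1)%R, 1%R]%classic)).
    have mgk : measurable (g k) by rewrite /g; exact: measurable_itv.
    rewrite [leLHS]m1I//; apply: (le_measure (@lebesgue_measure R)).
    - by rewrite inE; exact: measurableI.
    - by rewrite inE.
    - exact: subIsetl.
  by rewrite lebesgue_measure_itv/= lte_fin; case: ifPn; rewrite ltry.
Qed.
End cos_substitution.

(** * Truncated powers and beta integrals *)

Section pospow.
Context {R : realType}.
Local Notation leb := (@lebesgue_measure R).

(** Since [a `^ p] is 1 for a < 0, the value 0 has to be imposed there.  Weights
    built on [pospow] vanish outside a ball or an ellipsoid, and integrals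
    against them run over the whole space. *)
Definition pospow (p a : R) : R := if 0 < a then a `^ p else 0.

Lemma pospow_ge0 p a : 0 <= pospow p a.
Proof. by rewrite /pospow; case: ifPn => // _; exact: powR_ge0. Qed.

Lemma pospow_gt0 p a : 0 < a -> 0 < pospow p a.
Proof. by move=> a0; rewrite /pospow a0 powR_gt0. Qed.

Lemma gt0_pospow p a : 0 < a -> pospow p a = a `^ p.
Proof. by rewrite /pospow => ->. Qed.

Lemma le0_pospow p a : a <= 0 -> pospow p a = 0.
Proof. by rewrite /pospow ltNge => ->. Qed.

Lemma pospowZ p c a : 0 < c -> pospow p (c * a) = c `^ p * pospow p a.
Proof.
move=> c0; rewrite /pospow pmulr_rgt0//; case: ifPn => a0; last by rewrite mulr0.
by rewrite powRM// ltW.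
Qed.

Lemma measurable_pospow p : measurable_fun setT (pospow p).
Proof.
by apply: measurable_fun_ifT => //; exact: measurable_fun_ltr.
Qed.

Lemma measurableT_pospow d (T : measurableType d) p (f : T -> R) :
  measurable_fun setT f -> measurable_fun setT (fun x => pospow p (f x)).
Proof. by move=> mf; apply: (measurableT_comp (measurable_pospow p)). Qed.

(** Extended-real, hence meaningful for every exponent. *)
Definition beta_int p := (\int[leb]_t (pospow p (1 - t ^+ 2))%:E)%E.

(** The integrals over [1 / (n + 2), 1] increase to it, and on those intervals
    t^(p + 1) / (p + 1) is a primitive. *)
Lemma integral_powR_01 (p : R) : -1 < p ->
  (\int[leb]_(t in `]0%R, 1%R]) (t `^ p)%:E < +oo)%E.
Proof.
move=> p1.
pose F (n : nat) : set (measurableTypeR R) := `[n.+2%:R^-1, 1%R]%classic.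
have FE : (`]0%R, 1%R]%classic : set (measurableTypeR R)) = \bigcup_n F n.
  apply/seteqP; split => [x|x [n _]]; rewrite /F /= !in_itv/=.
    move=> /andP[x0 x1]; exists (Num.truncn x^-1) => //=.
    rewrite in_itv/= x1 andbT invf_ple ?posrE//.
    rewrite (le_trans (ltW (truncnS_gt _)))// ler_nat//.
  by move=> /andP[nx ->]; rewrite andbT (lt_le_trans _ nx).
rewrite FE.
have mp : measurable_fun setT (fun t : R => (t `^ p)%:E).
  by apply/measurable_EFinP; exact: measurable_powR.
have ndF : nondecreasing_seq F.
  apply/nondecreasing_seqP => n; apply/subsetPset => x; rewrite /F/= !in_itv/=.
  move=> /andP[nx ->]; rewrite andbT (le_trans _ nx)//.
  by rewrite lef_pV2 ?posrE// ler_nat.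
have cvF := @ge0_nondecreasing_set_cvg_integral _ _ _ F
  (fun t : R => (t `^ p)%:E) leb ndF.
apply: (@le_lt_trans _ _ ((p + 1)^-1)%:E); last by rewrite ltry.
have {}cvF := cvF (fun i => measurable_itv _) (fun i => measurable_funTS mp).
rewrite -(cvg_lim _ (cvF _))//; last by move=> i x _; rewrite lee_fin powR_ge0.
apply: lime_le.
  by apply/cvg_ex; eexists; apply: cvF => i x _; rewrite lee_fin powR_ge0.
apply: nearW => n.
have n0 : 0 < n.+2%:R^-1 :> R by rewrite invr_gt0.
have n1 : n.+2%:R^-1 < 1 :> R by rewrite invf_lt1// ltr1n.
have dF (x : R) : 0 < x ->
    is_derive x 1 (fun t => (p + 1)^-1 * t `^ (p + 1)) (x `^ p).
  move=> x0.
  have D := is_derive1_powR (p + 1) x0.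
  have D1 : is_derive x 1 ((p + 1)^-1 \*: (fun t : R => t `^ (p + 1)))
      ((p + 1)^-1 *: ((p + 1) * x `^ (p + 1 - 1))) by exact: is_deriveZ.
  apply: (is_derive_eq D1).
  rewrite addrK /GRing.scale/= mulrA mulVf ?mul1r//; lra.
have cF (x : R) : 0 < x -> {for x, continuous (fun t => (p + 1)^-1 * t `^ (p + 1))}.
  move=> x0; apply/differentiable_continuous/derivable1_diffP.
  exact: (@ex_derive _ _ _ _ _ _ _ (dF x x0)).
rewrite (@continuous_FTC2 _ _ (fun t => (p + 1)^-1 * t `^ (p + 1)))//.
- rewrite -EFinB lee_fin powR1 mulr1 lerBlDr lerDl mulr_ge0 ?powR_ge0//.
  by rewrite invr_ge0; lra.
- apply: continuous_in_subspaceT => x /set_mem/=; rewrite in_itv/= => /andP[nx _].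
  have x0 : 0 < x := lt_le_trans n0 nx.
  apply/differentiable_continuous/derivable1_diffP.
  by apply: derivable_powR; rewrite in_itv/= x0.
- split.
  + move=> x; rewrite in_itv/= => /andP[nx _].
    exact: (@ex_derive _ _ _ _ _ _ _ (dF x (lt_trans n0 nx))).
  + by apply: cvg_at_right_filter; exact: cF.
  + by apply: cvg_at_left_filter; exact: cF.
- move=> x; rewrite in_itv/= => /andP[nx _].
  have := dF x (lt_trans n0 nx) => dx.
  by rewrite derive1E (@derive_val _ _ _ _ _ _ _ dx).
Qed.

Let measurable_beta_int p : measurable_fun setT (fun t : R => (pospow p (1 - t ^+ 2))%:E).
Proof.
apply/measurable_EFinP; apply: measurableT_pospow.
by apply: measurable_funB => //; exact: measurable_funX.
Qed.

(** For t in [0, 1[ one has 1 - t^2 >= 1 - t, so that a negative power of 1 - t^2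
    is at most the same power of 1 - t, and of 1 + t when t is negative; a
    nonnegative power is at most 1.  The sum of the three bounds dominates in
    all cases. *)
Lemma beta_int_lty (p : R) : -1 < p -> (beta_int p < +oo)%E.
Proof.
move=> p1.
pose G (s : R) := (s `^ p * \1_(`]0%R, 1%R]%classic : set R) s)%:E.
have mG : measurable_fun setT G.
  apply/measurable_EFinP; apply: measurable_funM; first exact: measurable_powR.
  exact: measurable_indic.
have G0 s : (0 <= G s)%E by rewrite lee_fin mulr_ge0 ?powR_ge0// indicE.
have Goo : (\int[leb]_s G s < +oo)%E.
  apply: le_lt_trans (integral_powR_01 p1).
  rewrite [leRHS]integral_mkcond le_eqVlt; apply/orP; left; apply/eqP.
  apply: eq_integral => x _; rewrite /G patchE indicE.
  by case: ifPn => _; rewrite ?mulr1 ?mulr0.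
have n1 : (- 1 : R) != 0 by rewrite oppr_eq0.
have o1 : (1 : R) != 0 by [].
have := ge0_integral_affine 1 n1 mG G0; rewrite normrN1 mul1e => E1.
have := ge0_integral_affine 1 o1 mG G0; rewrite normr1 mul1e => E2.
have mG1 : measurable_fun setT (fun t : R => G (1 + -1 * t)).
  by apply: measurableT_comp => //; exact: (measurable_affine 1 (-1)).
have mG2 : measurable_fun setT (fun t : R => G (1 + 1 * t)).
  by apply: measurableT_comp => //; exact: (measurable_affine 1 1).
pose I11 : set (measurableTypeR R) := `[-1, 1]%classic.
have mI11 : measurable I11 by exact: measurable_itv.
have I11oo : (leb I11 < +oo)%E.
  by rewrite /I11 lebesgue_measure_itv/= lte_fin; case: ifPn; rewrite ltry.
have mI : measurable_fun setT (fun t : R => (\1_I11 t : R)%:E).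
  by apply/measurable_EFinP; exact: measurable_indic.
apply: (@le_lt_trans _ _ (\int[leb]_t ((G (1 + -1 * t)%R + G (1 + 1 * t)%R) +
  (\1_I11 t)%:E))%E); last first.
  have mGG := emeasurable_funD mG1 mG2.
  have I0 t : (0 <= (\1_I11 t : R)%:E)%E by rewrite lee_fin indicE.
  have GG0 (t : R) : (0 <= G (1 + -1 * t)%R + G (1 + 1 * t)%R)%E by rewrite adde_ge0.
  rewrite (ge0_integralD leb measurableT _ mGG _ mI)//.
  rewrite ge0_integralD// -E1 -E2 integral_indic//= setIT.
  by apply: lte_add_pinfty => //; apply: lte_add_pinfty.
apply: ge0_le_integral => //.
- by move=> t _; rewrite lee_fin pospow_ge0.
- exact: measurable_beta_int.
- by apply: emeasurable_funD => //; exact: emeasurable_funD.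
move=> t _; rewrite /G -!EFinD lee_fin.
have I0 (A : set R) x : 0 <= \1_A x :> R by rewrite indicE.
have GG0 s : 0 <= s `^ p * \1_(`]0, 1]%classic : set R) s by rewrite mulr_ge0// powR_ge0.
have [t1|t1] := leP (1 - t ^+ 2) 0.
  by rewrite le0_pospow// !addr_ge0.
rewrite gt0_pospow//.
have tN1 : -1 < t by nra.
have tP1 : t < 1 by nra.
have [p0|p0] := leP 0 p.
  rewrite -[leLHS]add0r lerD// ?addr_ge0// indicE mem_set/=; last first.
    by rewrite /I11/= in_itv/= !ltW.
  rewrite -[leRHS](powRr0 (1 - t ^+ 2)) ger_powR// t1/=; nra.
have le1 s u : 0 < s -> s <= u -> u `^ p <= s `^ p.
  move=> s0 su; have u0 := lt_le_trans s0 su.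
  have q0 : 0 <= - p by rewrite oppr_ge0 ltW.
  rewrite -[p]opprK; move: (- p) q0 => q q0.
  rewrite !powRN lef_pV2 ?posrE ?powR_gt0//.
  by rewrite ge0_ler_powR// ?nnegrE ?ltW.
have [t0|t0] := leP 0 t.
  rewrite -[leLHS]addr0 -addrA lerD ?addr_ge0//.
  rewrite indicE mem_set/=; last by rewrite in_itv/=; apply/andP; split; lra.
  rewrite mulr1; apply: le1; nra.
rewrite -[leLHS]addr0 addrAC addrC lerD ?addr_ge0//.
rewrite indicE mem_set/=; last by rewrite in_itv/=; apply/andP; split; lra.
rewrite mulr1; apply: le1; nra.
Qed.

Lemma beta_int_gt0 p : (0 < beta_int p)%E.
Proof.
(* On [0, 1/2] the base 1 - t^2 lies between 3/4 and 1. *)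
pose c : R := Order.min 1 ((3 / 4) `^ p).
pose I : set (measurableTypeR R) := `[0, 1 / 2]%classic.
have mI : measurable_fun setT (fun t : R => (\1_I t : R)%:E).
  by apply/measurable_EFinP; apply: measurable_indic; exact: measurable_itv.
have c0 : 0 < c by rewrite lt_min ltr01 powR_gt0//; lra.
apply: (@lt_le_trans _ _ (\int[leb]_t (c%:E * (\1_I t)%:E))%E).
  have I0 t : (0 <= (\1_I t : R)%:E)%E by rewrite lee_fin indicE.
  have cE : (0 <= c%:E)%E by rewrite lee_fin ltW.
  rewrite ge0_integralZl//.
  rewrite integral_indic//=; last exact: measurable_itv.
  rewrite setIT mule_gt0 ?lte_fin//.
  rewrite /I lebesgue_measure_itv/= lte_fin ifT; last by lra.
  by rewrite -EFinB lte_fin; lra.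
apply: ge0_le_integral => //.
- by move=> t _; rewrite mule_ge0 ?lee_fin// ?ltW// indicE.
- exact: emeasurable_funM.
- exact: measurable_beta_int.
move=> t _; rewrite -EFinM lee_fin indicE.
have [|_] := boolP (_ \in _); last by rewrite mulr0 pospow_ge0.
rewrite inE/= /I /= in_itv/= mulr1 => /andP[t0 t1].
have t2 : 3 / 4 <= 1 - t ^+ 2 by nra.
rewrite gt0_pospow; last by lra.
rewrite ge_min.
have [p0|p0] := leP 0 p.
  apply/orP; right; rewrite ge0_ler_powR ?nnegrE//; lra.
apply/orP; left; rewrite -[leLHS](powRr0 (1 - t ^+ 2)) ger_powR ?(ltW p0)//.
by apply/andP; split; nra.
Qed.

End pospow.

(** * Scalar products and integrals over balls *)

Section ball_beta.
Context {R : realType}.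
Local Notation leb := (@lebesgue_measure R).
Local Notation "'lebV' d" := (lebesgue_rV R d) (at level 10).
Implicit Types (p b : R).

Lemma dotrVC d (x y : 'rV[R]_d) : dotrV x y = dotrV y x.
Proof. by rewrite !dotrVE; apply: eq_bigr => i _; rewrite mulrC. Qed.

Lemma dotrVDl d (x y z : 'rV[R]_d) : dotrV (x + y) z = dotrV x z + dotrV y z.
Proof. by rewrite /dotrV mulmxDl mxE. Qed.

Lemma dotrVDr d (x y z : 'rV[R]_d) : dotrV z (x + y) = dotrV z x + dotrV z y.
Proof. by rewrite dotrVC dotrVDl !(dotrVC _ z). Qed.

Lemma dotrVZl d c (x z : 'rV[R]_d) : dotrV (c *: x) z = c * dotrV x z.
Proof. by rewrite /dotrV -scalemxAl mxE. Qed.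

Lemma dotrVZr d c (x z : 'rV[R]_d) : dotrV z (c *: x) = c * dotrV z x.
Proof. by rewrite dotrVC dotrVZl dotrVC. Qed.

Lemma dotrV_ge0 d (x : 'rV[R]_d) : 0 <= dotrV x x.
Proof. by rewrite dotrVE; apply: sumr_ge0 => i _; rewrite -expr2 sqr_ge0. Qed.

Lemma dotrV_eq0 d (x : 'rV[R]_d) : dotrV x x = 0 -> x = 0.
Proof.
rewrite dotrVE => /eqP; rewrite psumr_eq0; last by move=> i _; rewrite -expr2 sqr_ge0.
move=> /allP x0; apply/rowP => i; rewrite mxE.
by have /eqP := x0 i (mem_index_enum _); rewrite -expr2 => /eqP; rewrite sqrf_eq0 => /eqP.
Qed.

Lemma dotrV_cauchy d (x y : 'rV[R]_d) :
  dotrV x y ^+ 2 <= dotrV x x * dotrV y y.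
Proof.
have [Y0|Y0] := eqVneq (dotrV y y) 0.
  rewrite (dotrV_eq0 Y0) -(scale0r (0 : 'rV[R]_d)) !dotrVZr !mul0r mulr0 expr0n//.
have Yp : 0 < dotrV y y by rewrite lt_def Y0 dotrV_ge0.
have := dotrV_ge0 (dotrV y y *: x - dotrV x y *: y).
rewrite -scaleNr !(dotrVDl, dotrVDr, dotrVZl, dotrVZr) (dotrVC y x).
set X := dotrV x x; set Y := dotrV y y in Yp *; set c := dotrV x y.
rewrite [leRHS](_ : _ = Y * (X * Y - c ^+ 2)); last by ring.
by rewrite pmulr_rge0// subr_ge0.
Qed.

Lemma enorm_sqr d (x : 'rV[R]_d) : enorm x ^+ 2 = dotrV x x.
Proof. by rewrite /enorm sqr_sqrtr// dotrV_ge0. Qed.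

Lemma enorm_lt1 d (x : 'rV[R]_d) : (enorm x < 1) = (dotrV x x < 1).
Proof.
by rewrite -enorm_sqr expr_lt1// /enorm sqrtr_ge0.
Qed.

Lemma enorm_le1 d (x : 'rV[R]_d) : (enorm x <= 1) = (dotrV x x <= 1).
Proof.
by rewrite -enorm_sqr expr_le1// /enorm sqrtr_ge0.
Qed.

(** For a positive constant h need not be integrable, by [EFinZBr]. *)
Lemma integralZl_gt0 d (T : measurableType d) (m : {measure set T -> \bar R})
    (r : R) (h : T -> \bar R) : 0 < r -> measurable_fun setT h ->
  (\int[m]_v (r%:E * h v) = r%:E * \int[m]_v h v)%E.
Proof.
move=> r0 mh; have r0e : (0 <= r%:E)%E by rewrite lee_fin ltW.
rewrite integralE [in RHS]integralE EFinZBr//.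
rewrite -(ge0_integralZl _ measurableT (measurable_funepos mh))//.
rewrite -(ge0_integralZl _ measurableT (measurable_funeneg mh))//.
congr (_ - _)%E; apply: eq_integral => v _.
  by rewrite ge0_funeposM ?ltW.
by rewrite ge0_funenegM ?ltW.
Qed.

(** The substitution r = c + t sqrt b for b > 0; otherwise both sides vanish. *)
Lemma integral_beta_int_affine p b c (G : R -> \bar R) :
  measurable_fun setT G -> (forall r, 0 <= G r)%E ->
  (\int[leb]_r ((pospow p (b - (r - c) ^+ 2))%:E * G r) =
   (pospow (p + 2^-1) b)%:E *
   \int[leb]_t ((pospow p (1 - t ^+ 2))%:E * G (c + t * Num.sqrt b)%R))%E.
Proof.
move=> mG G0; have [b0|b0] := leP b 0.
  rewrite (le0_pospow _ b0) mul0e; apply: integral0_eq => r _.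
  by rewrite le0_pospow ?mul0e// subr_le0 (le_trans b0)// sqr_ge0.
have sb0 : 0 < Num.sqrt b by rewrite sqrtr_gt0.
have mh : measurable_fun setT (fun r : R => (pospow p (b - (r - c) ^+ 2))%:E * G r)%E.
  apply: emeasurable_funM => //; apply/measurable_EFinP.
  apply: measurableT_pospow; apply: measurable_funB => //.
  by apply: measurable_funX; exact: measurable_funB.
rewrite (ge0_integral_affine c (lt0r_neq0 sb0) mh); last first.
  by move=> r; rewrite mule_ge0 ?lee_fin ?pospow_ge0.
have -> : pospow (p + 2^-1) b = Num.sqrt b * b `^ p.
  by rewrite gt0_pospow// powRD ?(lt0r_neq0 b0) ?implybT// powR12_sqrt ?ltW// mulrC.
rewrite (gtr0_norm sb0) EFinM -muleA; congr (_ * _)%E.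
rewrite -(integralZl_gt0 _ (powR_gt0 p b0)); last first.
  apply: emeasurable_funM => //.
    apply/measurable_EFinP; apply: measurableT_pospow.
    by apply: measurable_funB => //; exact: measurable_funX.
  apply: measurableT_comp => //; apply: measurable_funD => //.
  exact: measurable_funM.
apply: eq_integral => t _; rewrite muleA -EFinM -pospowZ//.
have -> : b - (c + Num.sqrt b * t - c) ^+ 2 = b * (1 - t ^+ 2).
  by rewrite addrAC subrr add0r exprMn sqr_sqrtr ?ltW//; ring.
by rewrite [t * _]mulrC.
Qed.

Lemma integral_beta_int_scale p b :
  (\int[leb]_t (pospow p (b - t ^+ 2))%:E = (pospow (p + 2^-1) b)%:E * beta_int p)%E.
Proof.
have := @integral_beta_int_affine p b 0 (cst 1%E) (measurable_cst _) (fun=> @lee01 R).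
under eq_integral do rewrite mule1 subr0.
by under [in RHS]eq_integral do rewrite mule1.
Qed.

Definition ball_int d p := (\int[lebV d]_v (pospow p (1 - dotrV v v))%:E)%E.

Lemma measurable_pospow_ball d p b :
  measurable_fun setT (fun v : 'rV[R]_d => (pospow p (b - dotrV v v))%:E).
Proof.
apply/measurable_EFinP; apply: measurableT_pospow; apply: measurable_funB => //.
by apply: measurable_dotrV; exact: measurable_id.
Qed.

Lemma integral_ball_int_scale d p b :
  (\int[lebV d]_v (pospow p (b - dotrV v v))%:E =
   (pospow (p + d%:R / 2) b)%:E * ball_int d p)%E.
Proof.
have [b0|b0] := leP b 0.
  rewrite (le0_pospow _ b0) mul0e; apply: integral0_eq => v _.
  by rewrite le0_pospow// subr_le0 (le_trans b0)// dotrV_ge0.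
have sb0 : 0 < Num.sqrt b by rewrite sqrtr_gt0.
rewrite (ge0_integral_affine_rV 0 (lt0r_neq0 sb0)); last 2 first.
- exact: measurable_pospow_ball.
- by move=> v; rewrite lee_fin pospow_ge0.
have -> : pospow (p + d%:R / 2) b = Num.sqrt b ^+ d * b `^ p.
  rewrite gt0_pospow// powRD ?(lt0r_neq0 b0) ?implybT//.
  by rewrite [d%:R / 2]mulrC powRrM powR12_sqrt ?ltW// powR_mulrn ?ltW// mulrC.
rewrite (gtr0_norm sb0) EFinM -muleA; congr (_ * _)%E.
rewrite -(integralZl_gt0 _ (powR_gt0 p b0)); last exact: measurable_pospow_ball.
apply: eq_integral => v _; rewrite -EFinM -pospowZ//; congr (pospow _ _)%:E.
rewrite add0r dotrVZl dotrVZr mulrA -expr2 sqr_sqrtr ?ltW//; ring.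
Qed.

Lemma ball_int0 p : ball_int 0 p = 1%E.
Proof.
rewrite /ball_int integral_dirac//; last exact: measurable_pospow_ball.
by rewrite diracE mem_set// mul1e dotrVE big_ord0 subr0 gt0_pospow// powR1.
Qed.

(** The first coordinate is integrated first, over a segment whose half-length
    depends on the others. *)
Lemma ball_intS_betal d p : ball_int d.+1 p = (beta_int p * ball_int d (p + 2^-1))%E.
Proof.
rewrite {1}/ball_int ge0_integral_rVS_swap; last 2 first.
- exact: measurable_pospow_ball.
- by move=> v; rewrite lee_fin pospow_ge0.
rewrite -ge0_integralZl//; last 3 first.
- exact: measurable_pospow_ball.
- by move=> v _; rewrite lee_fin pospow_ge0.
- by apply: integral_ge0 => t _; rewrite lee_fin pospow_ge0.
apply: eq_integral => v _; rewrite muleC -integral_beta_int_scale.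
by apply: eq_integral => t _; rewrite dotrV_cons/= -expr2 opprD addrA addrAC.
Qed.

(** The first coordinate is integrated last, after the integral over the
    lower-dimensional ball of radius sqrt (1 - t^2). *)
Lemma ball_intS_betar d p : ball_int d.+1 p = (ball_int d p * beta_int (p + d%:R / 2))%E.
Proof.
rewrite {1}/ball_int ge0_integral_rVS; last 2 first.
- exact: measurable_pospow_ball.
- by move=> v; rewrite lee_fin pospow_ge0.
rewrite -ge0_integralZl//; last 3 first.
- apply/measurable_EFinP; apply: measurableT_pospow.
  by apply: measurable_funB => //; exact: measurable_funX.
- by move=> v _; rewrite lee_fin pospow_ge0.
- by apply: integral_ge0 => t _; rewrite lee_fin pospow_ge0.
apply: eq_integral => t _; rewrite muleC -integral_ball_int_scale.
by apply: eq_integral => v _; rewrite dotrV_cons/= -expr2 opprD addrA.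
Qed.

Lemma ball_int_gt0_lty d p : -1 < p -> (0 < ball_int d p < +oo)%E.
Proof.
elim: d p => [|d IH] p p1; first by rewrite ball_int0 lte01 ltry.
have /andP[I0 Ioo] : (0 < ball_int d (p + 2^-1) < +oo)%E by apply: IH; lra.
have Jp := beta_int_gt0 p; have Joo := beta_int_lty p1.
rewrite ball_intS_betal mule_gt0//= lte_mul_pinfty ?ltW//.
by rewrite ge0_fin_numE// ltW.
Qed.

End ball_beta.

(** * Orbits, ellipsoids and the average over the angle *)

Section ellipsoid_average.
Context {R : realType} {d : nat}.
Local Notation leb := (@lebesgue_measure R).
Local Notation lebV := (lebesgue_rV R d).
Implicit Types (x y u : 'rV[R]_d) (p th r : R).

(** The last coordinate of the lift of x to the unit sphere of R^(d+1). *)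
Definition height x : R := Num.sqrt (1 - enorm x ^+ 2).

(** For sin th <> 0 it parametrizes the points y with discr x y (cos th) >= 0 by
    the points u of an ellipsoid. *)
Definition orbit_pt th x u : 'rV[R]_d := cos th *: x + (sin th * height x) *: u.

(** For x and y in the ball, this is nonnegative exactly when
    |r - <x, y>| <= height x * height y, that is, when r is one of the arguments
    at which the convolution evaluates g. *)
Definition discr x y r : R :=
  (1 - dotrV x x) * (1 - dotrV y y) - (r - dotrV x y) ^+ 2.

Lemma AformE x u : Aform x u = (1 - dotrV x x) * dotrV u u + dotrV x u ^+ 2.
Proof.
rewrite /Aform /Amx enorm_sqr mulmxDr mulmxDl mxE; congr (_ + _).
  by rewrite mul_mx_scalar -scalemxAl mxE.
rewrite mulmxA -mulmxA mxE big_ord1 expr2; congr (_ * _).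
by rewrite dotrVC /dotrV.
Qed.

Lemma height_gt0 x : dotrV x x < 1 -> 0 < height x.
Proof. by move=> x1; rewrite sqrtr_gt0 enorm_sqr subr_gt0. Qed.

Lemma height_sqr x : dotrV x x <= 1 -> height x ^+ 2 = 1 - dotrV x x.
Proof. by move=> x1; rewrite sqr_sqrtr enorm_sqr ?subr_ge0. Qed.

(** The identity behind the theorem: it carries the ellipsoid of x to a
    condition that is symmetric in x and y, and the weight on the ellipsoid to
    a power of [discr]. *)
Lemma discr_orbit_pt th x u : dotrV x x <= 1 ->
  discr x (orbit_pt th x u) (cos th) = (sin th * height x) ^+ 2 * (1 - Aform x u).
Proof.
move=> x1; rewrite AformE /discr /orbit_pt.
rewrite !(dotrVDl, dotrVDr, dotrVZl, dotrVZr) (dotrVC u x).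
have s2 := height_sqr x1.
have -> : dotrV x x = 1 - height x ^+ 2 by rewrite s2 opprB addrCA subrr addr0.
have := cos2Dsin2 th; move: (cos th) (sin th) (height x) (dotrV x u) (dotrV u u).
move=> C S s w U CS1.
apply/eqP; rewrite -subr_eq0; apply/eqP.
(* The difference of the two sides is a multiple of 1 - cos^2 - sin^2. *)
transitivity (s ^+ 2 * (1 - (C ^+ 2 + S ^+ 2))); last by rewrite CS1 subrr mulr0.
ring.
Qed.

Lemma discrC x y r : discr x y r = discr y x r.
Proof. by rewrite /discr mulrC dotrVC. Qed.

(** Positivity of [discr] confines y and r by itself, so that no domain of
    integration has to be carried along. *)
Lemma discr_gt0_bounds x y r : dotrV x x < 1 -> 0 < discr x y r ->
  dotrV y y < 1 /\ -1 < r < 1.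
Proof.
move=> x1; rewrite /discr => D0.
have CS := dotrV_cauchy x y.
have X0 := dotrV_ge0 x; have Y0 := dotrV_ge0 y.
move: (dotrV x x) (dotrV y y) (dotrV x y) x1 D0 CS X0 Y0 => X Y c x1 D0 CS X0 Y0.
have y1 : Y < 1.
  have : 0 < (1 - X) * (1 - Y) by apply: lt_le_trans D0 _; rewrite gerBl sqr_ge0.
  by rewrite pmulr_rgt0 ?subr_gt0.
split => //.
suff : r ^+ 2 < 1 by rewrite -real_normK ?num_real// expr_lt1// ltr_norml.
(* From c^2 <= X Y and e^2 < (1 - X) (1 - Y), the inequality of arithmetic and
   geometric means bounds 2 c e, and (c + e)^2 < (X + (1 - X)) (Y + (1 - Y)) = 1. *)
pose e := r - c.
have e2 : e ^+ 2 < (1 - X) * (1 - Y) by rewrite -subr_gt0.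
have rE : r = c + e by rewrite /e addrC subrK.
pose A := X * (1 - Y) + Y * (1 - X).
have A0 : 0 <= A by rewrite addr_ge0// mulr_ge0// ?subr_ge0 ltW.
have ce : (2 * (c * e)) ^+ 2 <= A ^+ 2.
  have XY0 : 0 <= X * Y by rewrite mulr_ge0.
  have h : c ^+ 2 * e ^+ 2 <= (X * Y) * ((1 - X) * (1 - Y)).
    by apply: ler_pM; rewrite ?sqr_ge0// ltW.
  rewrite exprMn exprMn; apply: (@le_trans _ _ (2 ^+ 2 * (X * Y * ((1 - X) * (1 - Y))))).
    by rewrite ler_pM2l// exprn_gt0.
  rewrite -subr_ge0 (_ : _ - _ = (X * (1 - Y) - Y * (1 - X)) ^+ 2) ?sqr_ge0//.
  by rewrite /A; ring.
have ce' : 2 * (c * e) <= A.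
  rewrite (le_trans (ler_norm _))// -(ger0_norm A0).
  by rewrite -ler_sqr ?nnegrE// -!normrX ger0_norm ?sqr_ge0// ger0_norm ?sqr_ge0.
rewrite rE (_ : (c + e) ^+ 2 = c ^+ 2 + 2 * (c * e) + e ^+ 2); last by ring.
rewrite [ltRHS](_ : 1 = X * Y + A + (1 - X) * (1 - Y)); last by rewrite /A; ring.
by rewrite ler_ltD// lerD.
Qed.

Lemma discr_le0 x y r : dotrV x x < 1 -> 1 <= dotrV y y -> discr x y r <= 0.
Proof.
move=> x1 y1; rewrite leNgt; apply/negP => /(discr_gt0_bounds x1)[].
by rewrite ltNge y1.
Qed.

Lemma measurable_Aform d' (T : measurableType d') (f g : T -> 'rV[R]_d) :
  measurable_fun setT f -> measurable_fun setT g ->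
  measurable_fun setT (fun t => Aform (f t) (g t)).
Proof.
move=> mf mg; rewrite (_ : (fun t => _) = fun t =>
  (1 - dotrV (f t) (f t)) * dotrV (g t) (g t) + dotrV (f t) (g t) ^+ 2); last first.
  by apply/funext => t; rewrite AformE.
apply: measurable_funD; last by apply: measurable_funX; exact: measurable_dotrV.
apply: measurable_funM; last exact: measurable_dotrV.
by apply: measurable_funB => //; exact: measurable_dotrV.
Qed.

Lemma measurable_discr d' (T : measurableType d') (f g : T -> 'rV[R]_d) (h : T -> R) :
  measurable_fun setT f -> measurable_fun setT g -> measurable_fun setT h ->
  measurable_fun setT (fun t => discr (f t) (g t) (h t)).
Proof.
move=> mf mg mh; apply: measurable_funB.
  by apply: measurable_funM; apply: measurable_funB => //; exact: measurable_dotrV.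
by apply: measurable_funX; apply: measurable_funB => //; exact: measurable_dotrV.
Qed.

Definition ellipsoid_int p x (h : 'rV[R]_d -> \bar R) th : \bar R :=
  (\int[lebV]_u ((pospow p (1 - Aform x u))%:E * h (orbit_pt th x u)))%E.

Lemma measurable_orbit_pt th x : measurable_fun setT (orbit_pt th x).
Proof.
by apply: measurable_rVD => //; apply: measurable_rVZ.
Qed.

(** The substitution y = [orbit_pt th x u], with Jacobian (sin th height x)^d. *)
Lemma ellipsoid_int_discr p x h th : 0 < th < pi -> dotrV x x < 1 ->
  measurable_fun setT h ->
  (ellipsoid_int p x h th = ((sin th * height x) `^ (- (2 * p + d%:R)))%:E *
    \int[lebV]_y ((pospow p (discr x y (cos th)))%:E * h y))%E.
Proof.
move=> thpi x1 mh; set c := sin th * height x.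
have c0 : 0 < c by rewrite mulr_gt0 ?sin_gt0_pi ?height_gt0.
have mD : measurable_fun setT (fun y => (pospow p (discr x y (cos th)))%:E * h y)%E.
  apply: emeasurable_funM => //; apply/measurable_EFinP; apply: measurableT_pospow.
  by apply: measurable_discr => //; exact: measurable_id.
rewrite (integral_affine_rV (cos th *: x) (lt0r_neq0 c0) mD).
have -> : (\int[lebV]_v ((pospow p (discr x (cos th *: x + c *: v) (cos th)))%:E *
    h (cos th *: x + c *: v)%R) = ((c ^+ 2) `^ p)%:E * ellipsoid_int p x h th)%E.
  rewrite -integralZl_gt0 ?powR_gt0 ?exprn_gt0//; last first.
    apply: emeasurable_funM.
      apply/measurable_EFinP; apply: measurableT_pospow.
      apply: measurable_funB => //.
      by apply: measurable_Aform; [exact: measurable_cst|exact: measurable_id].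
    by apply: measurableT_comp => //; exact: measurable_orbit_pt.
  apply: eq_integral => u _; rewrite muleA -EFinM -pospowZ ?exprn_gt0//.
  by rewrite -discr_orbit_pt ?ltW.
rewrite !muleA -!EFinM (gtr0_norm c0).
have -> : c `^ (- (2 * p + d%:R)) * c ^+ d * (c ^+ 2) `^ p = 1.
  rewrite -powR_mulrn ?ltW// -(@powR_mulrn _ _ 2) ?ltW// -powRrM -!powRD ?(lt0r_neq0 c0) ?implybT//.
  rewrite (_ : _ + _ = 0) ?powRr0//; ring.
by rewrite mul1e.
Qed.

Lemma measurable_height : measurable_fun setT height.
Proof.
apply: (measurableT_comp (continuous_measurable_fun (@sqrt_continuous R))).
apply: measurable_funB => //; under eq_fun do rewrite enorm_sqr.
by apply: measurable_dotrV; exact: measurable_id.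
Qed.

Lemma measurable_ellipsoid_int p (phi : 'rV[R]_d -> R) :
  measurable_fun setT phi -> (forall y, 0 <= phi y) ->
  measurable_fun setT (fun z : measurableTypeR R * 'rV[R]_d =>
    ellipsoid_int p z.2 (EFin \o phi) z.1).
Proof.
move=> mphi phi0.
pose k (w : (measurableTypeR R * 'rV[R]_d) * 'rV[R]_d) :=
  ((pospow p (1 - Aform w.1.2 w.2))%:E * (phi (orbit_pt w.1.1 w.1.2 w.2))%:E)%E.
have mk : measurable_fun setT k.
  have m1 : measurable_fun setT (fun w : (measurableTypeR R * 'rV[R]_d) * 'rV[R]_d => (w.1.1 : R)).
    exact: (measurableT_comp measurable_fst measurable_fst).
  have m2 : measurable_fun setT (fun w : (measurableTypeR R * 'rV[R]_d) * 'rV[R]_d => w.1.2).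
    exact: (measurableT_comp measurable_snd measurable_fst).
  have m3 : measurable_fun setT (fun w : (measurableTypeR R * 'rV[R]_d) * 'rV[R]_d => w.2).
    exact: measurable_snd.
  apply: emeasurable_funM; apply/measurable_EFinP.
    apply: measurableT_pospow; apply: measurable_funB => //.
    exact: measurable_Aform.
  apply: (measurableT_comp mphi).
  apply: measurable_rVD; apply: measurable_rVZ => //.
    exact: (measurableT_comp (continuous_measurable_fun (@continuous_cos R)) m1).
  apply: measurable_funM.
    exact: (measurableT_comp (continuous_measurable_fun (@continuous_sin R)) m1).
  exact: (measurableT_comp measurable_height m2).
apply: (measurable_fun_fubini_tonelli_F k mk) => w.
by rewrite /k mule_ge0 ?lee_fin ?pospow_ge0.
Qed.

(** In terms of [discr] the angle enters through r = cos th only, so that r and y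
    can be exchanged; for fixed y the integral in r is then centred at <x, y>
    with radius height x * height y ([integral_beta_int_affine]). *)
Lemma ellipsoid_int_average p x (g : R -> R) (phi : 'rV[R]_d -> R) :
  0 < 2 * p + d%:R + 1 -> dotrV x x < 1 ->
  measurable_fun setT g -> (forall r, 0 <= g r) ->
  measurable_fun setT phi -> (forall y, 0 <= phi y) ->
  (\int[leb]_(th in `[0%R, pi])
     ((sin th `^ (2 * p + d%:R + 1) * g (cos th))%:E * ellipsoid_int p x (EFin \o phi) th) =
   (height x `^ (1 - d%:R))%:E *
   \int[lebV]_y ((pospow (p + 2^-1) (1 - dotrV y y) * phi y)%:E *
     \int[leb]_t (pospow p (1 - t ^+ 2) * g (dotrV x y + t * height x * height y))%:E))%E.
Proof.
move=> q0 x1 mg g0 mphi phi0.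
have s0 := height_gt0 x1.
have mphiE : measurable_fun setT (EFin \o phi) by exact/measurable_EFinP.
have mDr r : measurable_fun setT (fun y => (pospow p (discr x y r))%:E).
  by apply/measurable_EFinP; apply: measurableT_pospow; apply: measurable_discr.
pose k r y := ((g r)%:E * ((pospow p (discr x y r))%:E * (phi y)%:E))%E.
have k0 r y : (0 <= k r y)%E by rewrite !mule_ge0 ?lee_fin ?pospow_ge0.
have mk : measurable_fun setT (fun z : measurableTypeR R * 'rV[R]_d => k z.1 z.2).
  apply: emeasurable_funM.
    by apply/measurable_EFinP; exact: (measurableT_comp mg measurable_fst).
  apply: emeasurable_funM; apply/measurable_EFinP.
    by apply: measurableT_pospow; exact: measurable_discr.
  exact: (measurableT_comp mphi measurable_snd).
pose c := height x `^ (- (2 * p + d%:R)).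
have c0 : 0 < c by rewrite powR_gt0.
have c0E : (0 <= c%:E)%E by rewrite lee_fin ltW.
pose G r := (\int[lebV]_y k r y)%E.
have G0 r : (0 <= G r)%E by exact: integral_ge0.
have mG : measurable_fun setT G by exact: (measurable_fun_fubini_tonelli_F _ mk).
have GE r : (G r = (g r)%:E * \int[lebV]_y ((pospow p (discr x y r))%:E * (phi y)%:E))%E.
  rewrite /G ge0_integralZl//.
  - exact: emeasurable_funM.
  - by move=> y _; rewrite mule_ge0 ?lee_fin ?pospow_ge0.
  - by rewrite lee_fin.
transitivity (c%:E * \int[leb]_(r in `[(-1)%R, 1%R]) G r)%E.
  have mGc : measurable_fun setT (fun th : R => ((sin th)%:E * G (cos th))%E).
    apply: emeasurable_funM.
      by apply/measurable_EFinP; apply: continuous_measurable_fun; exact: continuous_sin.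
    apply: (measurableT_comp mG).
    by apply: continuous_measurable_fun; exact: continuous_cos.
  rewrite integral_cos_sin// -ge0_integralZl//; last 2 first.
  - exact: measurable_funTS.
  - move=> th; rewrite /= in_itv/= => thi.
    by rewrite mule_ge0// lee_fin sin_ge0_pi.
  apply: eq_integral => th; rewrite inE/= in_itv/= => /andP[th0 thpi].
  have [st0|st0] := eqVneq (sin th) 0.
    by rewrite st0 powR0 ?lt0r_neq0// mul0r !mul0e mule0.
  have thi : 0 < th < pi.
    rewrite !lt_neqAle th0 thpi !andbT; apply/andP; split.
      by apply: contraNneq st0 => <-; rewrite sin0.
    by apply: contraNneq st0 => ->; rewrite sinpi.
  have sp := sin_gt0_pi thi.
  rewrite ellipsoid_int_discr// GE !muleA -!EFinM; congr (_%:E * _)%E.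
  rewrite mulrAC; congr (_ * _).
  rewrite powRM ?ltW// mulrA [RHS]mulrC; congr (_ * _).
  rewrite -powRD ?(lt0r_neq0 sp) ?implybT//.
  have -> : 2 * p + d%:R + 1 + - (2 * p + d%:R) = 1 by ring.
  by rewrite powRr1 ?ltW.
have GT : (\int[leb]_(r in `[(-1)%R, 1%R]) G r = \int[leb]_r G r)%E.
  rewrite integral_mkcond; apply: eq_integral => r _; rewrite patchE.
  case: ifPn => // /negP rN; rewrite /G integral0_eq// => y _.
  rewrite /k le0_pospow ?mul0e ?mule0// leNgt; apply/negP.
  move=> /(discr_gt0_bounds x1)[_ /andP[r1 r2]]; apply: rN.
  by rewrite inE/= in_itv/= !ltW.
have kz0 (z : measurableTypeR R * 'rV[R]_d) : (0 <= k z.1 z.2)%E by exact: k0.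
rewrite GT /G (fubini_tonelli _ mk kz0) /=.
have mh y : measurable_fun setT (fun t : R =>
    (pospow p (1 - t ^+ 2) * g (dotrV x y + t * height x * height y))%:E).
  apply/measurable_EFinP; apply: measurable_funM.
    apply: measurableT_pospow; apply: measurable_funB => //; exact: measurable_funX.
  apply: (measurableT_comp mg); apply: measurable_funD => //.
  by apply: measurable_funM => //; apply: measurable_funM.
have yE y : (\int[leb]_r k r y = (((height x) ^+ 2) `^ (p + 2^-1))%:E *
    ((pospow (p + 2^-1) (1 - dotrV y y) * phi y)%:E *
     \int[leb]_t (pospow p (1 - t ^+ 2) * g (dotrV x y + t * height x * height y))%:E))%E.
  have gy0 r : (0 <= (g r)%:E * (phi y)%:E)%E by rewrite mule_ge0 ?lee_fin.
  have mgy : measurable_fun setT (fun r => (g r)%:E * (phi y)%:E)%E.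
    by apply: emeasurable_funM => //; exact/measurable_EFinP.
  under eq_integral do rewrite /k muleCA /discr.
  rewrite (integral_beta_int_affine _ _ _ mgy gy0).
  rewrite (pospowZ _ _ (_ : 0 < 1 - dotrV x x)) ?subr_gt0//.
  rewrite -height_sqr ?ltW//.
  rewrite !EFinM -!muleA; congr (_ * (_ * _))%E.
  rewrite -ge0_integralZl//; last 2 first.
  - by move=> t _; rewrite lee_fin mulr_ge0 ?pospow_ge0.
  - by rewrite lee_fin.
  apply: eq_integral => t _; rewrite -!EFinM; congr EFin.
  have -> : Num.sqrt (height x ^+ 2 * (1 - dotrV y y)) = height x * height y.
    by rewrite sqrtrM ?sqr_ge0// sqrtr_sqr gtr0_norm// /height !enorm_sqr.
  by rewrite mulrA [RHS]mulrC -[t * _ * _]mulrA.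
  exact: mh.
set C := (height x ^+ 2) `^ (p + 2^-1) in yE *.
have C0 : 0 < C by rewrite powR_gt0 ?exprn_gt0.
set h := fun y => ((pospow (p + 2^-1) (1 - dotrV y y) * phi y)%:E * _)%E.
have mhh : measurable_fun setT h.
  rewrite (_ : h = fun y => (C^-1%:E * \int[leb]_r k r y)%E); last first.
    apply/funext => y; rewrite yE muleA -EFinM mulVf ?mul1e//.
    by rewrite lt0r_neq0.
  apply: emeasurable_funM => //.
  exact: (measurable_fun_fubini_tonelli_G _ mk kz0).
have -> : (\int[lebV]_y \int[leb]_r k r y = \int[lebV]_y (C%:E * h y))%E.
  by apply: eq_integral => y _; exact: yE.
rewrite (integralZl_gt0 _ C0 mhh) muleA -EFinM; congr (_%:E * _)%E.
rewrite /C -(@powR_mulrn _ _ 2) ?ltW// -powRrM -powRD ?(lt0r_neq0 s0) ?implybT//.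
congr (_ `^ _); rewrite mulrDr mulfV//; ring.
Qed.

End ellipsoid_average.

(** * The volume and the boundary of the ellipsoid *)

Section ellipsoid_integral.
Context {R : realType} {d : nat} (p : R).
Hypothesis p1 : -1 < p.
Local Notation leb := (@lebesgue_measure R).
Local Notation lebV := (lebesgue_rV R d).
Implicit Types (x y u : 'rV[R]_d) (th r : R).

Lemma integral_sin_powR (q : R) : 0 < 2 * q + 1 ->
  (\int[leb]_(th in `[0%R, pi]) (sin th `^ (2 * q + 1))%:E = beta_int q)%E.
Proof.
move=> q0.
have mJ : measurable_fun setT (fun r : R => (pospow q (1 - r ^+ 2))%:E).
  apply/measurable_EFinP; apply: measurableT_pospow.
  by apply: measurable_funB => //; exact: measurable_funX.
transitivity (\int[leb]_(r in `[(-1)%R, 1%R]) (pospow q (1 - r ^+ 2))%:E)%E.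
  rewrite integral_cos_sin//; last by move=> r; rewrite lee_fin pospow_ge0.
  apply: eq_integral => th; rewrite inE/= in_itv/= => thi.
  have := sin_ge0_pi thi; rewrite -sin2cos2 le_eqVlt => /predU1P[<-|st0].
    by rewrite powR0 ?lt0r_neq0// mul0e.
  rewrite -EFinM gt0_pospow ?exprn_gt0//; congr EFin.
  rewrite -powR_mulrn ?ltW// -powRrM -{2}[sin th]powRr1 ?ltW//.
  by rewrite -powRD ?(lt0r_neq0 st0) ?implybT// addrC.
rewrite integral_mkcond; apply: eq_integral => r _; rewrite patchE.
case: ifPn => // /negP rN; rewrite le0_pospow// leNgt; apply/negP => r1; apply: rN.
rewrite inE/= in_itv/= -ler_norml -(@expr_le1 _ 2)// real_normK ?num_real//.
by rewrite subr_gt0 in r1; exact: ltW.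
Qed.

(** [ellipsoid_int_average] with constant g and phi: the left-hand side is then a
    beta integral times the integral wanted, and the right-hand side a ball
    integral one dimension higher.  The matrix A(x) is never diagonalized. *)
Lemma integral_ellipsoid x : (0 < d)%N -> dotrV x x < 1 ->
  (\int[lebV]_u (pospow p (1 - Aform x u))%:E = (height x `^ (1 - d%:R))%:E * ball_int d p)%E.
Proof.
move=> d0 x1.
have d1 : 1 <= d%:R :> R by rewrite ler1n.
have q0 : 0 < 2 * p + d%:R + 1.
  rewrite (_ : _ + 1 = 2 * (p + 1) + (d%:R - 1)); last by ring.
  by rewrite ltr_wpDr ?subr_ge0// mulr_gt0// -ltrBlDr sub0r.
have q0' : 0 < 2 * (p + d%:R / 2) + 1.
  by rewrite mulrDr mulrCA mulfV// mulr1.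
pose one := cst (1 : R) : R -> R.
pose onev := cst (1 : R) : 'rV[R]_d -> R.
have := @ellipsoid_int_average R d p x one onev q0 x1 (measurable_cst _) (fun=> ler01)
  (measurable_cst _) (fun=> ler01).
set N := (\int[lebV]_u (pospow p (1 - Aform x u))%:E)%E.
have N0 : (0 <= N)%E.
  by apply: integral_ge0 => u _; rewrite lee_fin pospow_ge0.
have -> : (\int[leb]_(th in `[0%R, pi])
    ((sin th `^ (2 * p + d%:R + 1) * one (cos th))%:E *
    ellipsoid_int p x (EFin \o onev) th) = beta_int (p + d%:R / 2) * N)%E.
  rewrite -integral_sin_powR// -ge0_integralZr//; last 2 first.
  - apply: measurable_funTS; apply/measurable_EFinP.
    apply: (measurableT_comp (measurable_powR _)).
    by apply: continuous_measurable_fun; exact: continuous_sin.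
  - by move=> th _; rewrite lee_fin powR_ge0.
  apply: eq_integral => th _.
  rewrite mulr1 mulrDr mulrCA mulfV// mulr1; congr (_ * _)%E.
  by rewrite /ellipsoid_int; apply: eq_integral => u _; rewrite mule1.
have -> : (\int[lebV]_y ((pospow (p + 2^-1) (1 - dotrV y y) * onev y)%:E *
   \int[leb]_t (pospow p (1 - t ^+ 2) * one (dotrV x y + t * height x * height y))%:E)
   = ball_int d p * beta_int (p + d%:R / 2))%E.
  rewrite -ball_intS_betar ball_intS_betal muleC -ge0_integralZr//; last 3 first.
  - exact: measurable_pospow_ball.
  - by move=> y _; rewrite lee_fin pospow_ge0.
  - by apply: integral_ge0 => t _; rewrite lee_fin pospow_ge0.
  apply: eq_integral => y _; rewrite mulr1; congr (_ * _)%E.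
  by rewrite /beta_int; apply: eq_integral => t _; rewrite mulr1.
have q1 : -1 < p + d%:R / 2.
  by rewrite (lt_le_trans p1)// lerDl divr_ge0.
have J0 := beta_int_gt0 (p + d%:R / 2); have Joo := beta_int_lty q1.
have /andP[I0 Ioo] := @ball_int_gt0_lty R d p p1.
case: (beta_int _) J0 Joo => [J| |] //; rewrite ?lte_fin => J0 _ H.
have : (J^-1%:E * (J%:E * N) = J^-1%:E * ((height x `^ (1 - d%:R))%:E * (ball_int d p * J%:E)))%E.
  by rewrite H.
rewrite muleA -EFinM mulVf ?lt0r_neq0// mul1e => ->.
rewrite muleCA; congr (_ * _)%E.
by rewrite muleCA -EFinM mulVf ?lt0r_neq0// mule1.
Qed.

End ellipsoid_integral.

Section null_boundary.
Context {R : realType} {d : nat}.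
Local Notation lebV := (lebesgue_rV R d).
Implicit Types (x y u : 'rV[R]_d).

Lemma AformZ x c u : Aform x (c *: u) = c ^+ 2 * Aform x u.
Proof. by rewrite !AformE !dotrVZl !dotrVZr; ring. Qed.

Lemma measurable_AformT x : measurable_fun setT (Aform x).
Proof. by apply: measurable_Aform; [exact: measurable_cst|exact: measurable_id]. Qed.

Lemma measurable_Aform_set x (B : set R) : measurable B -> measurable (Aform x @^-1` B).
Proof. by move=> mB; rewrite -[X in measurable X]setTI; exact: measurable_AformT. Qed.

Let ell x : set 'rV[R]_d := Aform x @^-1` `]-oo, 1[.

Let ell_lty x : (0 < d)%N -> dotrV x x < 1 -> (lebV (ell x) < +oo)%E.
Proof.
move=> d0 x1; have N10 : -1 < 0 :> R by rewrite ltrN10.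
have := integral_ellipsoid N10 d0 x1.
have -> : (\int[lebV]_u (pospow 0 (1 - Aform x u))%:E = lebV (ell x))%E.
  rewrite -[in RHS](setIT (ell x)) -integral_indic//; last exact: measurable_Aform_set.
  apply: eq_integral => u _; congr EFin; rewrite /pospow subr_gt0 indicE powRr0.
  have -> : (u \in ell x) = (Aform x u < 1).
    by apply/idP/idP; rewrite inE /ell/= in_itv/=.
  by case: ifP.
move=> ->; have /andP[I0 Ioo] := @ball_int_gt0_lty R d 0 N10.
by apply: lte_mul_pinfty => //; rewrite lee_fin powR_ge0.
Qed.

(** If V is the volume of the open ellipsoid and e that of its boundary, the
    c-fold dilate of the open ellipsoid contains both for every c > 1, so that
    V + e <= c^d V. *)
Lemma ellipsoid_boundary_null x : (0 < d)%N -> dotrV x x < 1 ->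
  lebV [set u | Aform x u = 1] = 0%E.
Proof.
move=> d0 x1.
pose E : set 'rV[R]_d := Aform x @^-1` [set 1].
have mE : measurable E by exact: measurable_Aform_set.
have mell : measurable (ell x) by exact: measurable_Aform_set.
rewrite (_ : [set u | _] = E)//.
have Voo := ell_lty d0 x1.
have key (c : R) : 1 < c -> (lebV (ell x) + lebV E <= (c ^+ d)%:E * lebV (ell x))%E.
  move=> c1; have c0 : 0 < c by rewrite (lt_trans _ c1).
  pose Ec : set 'rV[R]_d := Aform x @^-1` `]-oo, c ^+ 2[.
  have mEc : measurable Ec by exact: measurable_Aform_set.
  have -> : ((c ^+ d)%:E * lebV (ell x) = lebV Ec)%E.
    rewrite -[in RHS](setIT Ec) -integral_indic//.
    rewrite (ge0_integral_affine_rV 0 (lt0r_neq0 c0)); last 2 first.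
    - by apply/measurable_EFinP; exact: measurable_indic.
    - by move=> v; rewrite lee_fin indicE.
    rewrite gtr0_norm// -[in LHS](setIT (ell x)) -integral_indic//.
    congr (_ * _)%E; apply: eq_integral => u _; congr EFin; rewrite !indicE.
    have -> // : (0 + c *: u \in Ec) = (u \in ell x).
    apply/idP/idP; rewrite !inE /ell /Ec/= !in_itv/= add0r AformZ;
      by rewrite gtr_pMr ?exprn_gt0.
  rewrite -measureU//; last first.
    apply/seteqP; split => // u [Au A1]; move: Au A1.
    by rewrite /ell /E /= in_itv/= => Au A1; move: Au; rewrite A1 ltxx.
  apply: le_measure; rewrite ?inE//; first exact: measurableU.
  have c21 : 1 < c ^+ 2 by rewrite exprn_egt1.
  move=> u [|]; rewrite /ell /E /Ec /= !in_itv/=; first by move=> /lt_trans; apply.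
  by move=> ->.
have V0 : (0 <= lebV (ell x))%E by [].
have E0 : (0 <= lebV E)%E by [].
have Eoo : (lebV E < +oo)%E.
  apply: le_lt_trans (_ : (2 ^+ d)%:E * lebV (ell x) < +oo)%E.
    by apply: le_trans (key 2 (ltr1n R 2)); rewrite leeDr.
  by apply: lte_mul_pinfty => //; rewrite lee_fin exprn_ge0.
move: (lebV (ell x)) (lebV E) V0 E0 Voo Eoo key => [v| |] [e| |] //.
rewrite !lee_fin => v0 e0 _ _ key; congr EFin; apply/eqP.
case: (ltgtP e 0) e0 => // ep _.
(* A dilation ratio with c^d = K gives e (v + 1) <= e v. *)
pose K := 1 + e / (v + 1).
have v1 : 0 < v + 1 by rewrite ltr_wpDl.
have K1 : 1 < K by rewrite ltrDl divr_gt0.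
have d0' : 0 < d%:R^-1 :> R by rewrite invr_gt0 ltr0n.
pose c := K `^ d%:R^-1.
have c1 : 1 < c.
  have <- : 1 `^ (d%:R^-1) = 1 :> R by rewrite powR1.
  by rewrite gt0_ltr_powR// nnegrE// ltW// (lt_trans _ K1).
have cd : c ^+ d = K.
  rewrite -powR_mulrn; last by rewrite ltW// (lt_trans _ c1).
  rewrite -powRrM mulVf ?powRr1//; first by rewrite ltW// (lt_trans _ K1).
  by rewrite pnatr_eq0 -lt0n.
have := key c c1; rewrite cd -EFinD -EFinM lee_fin /K mulrDl mul1r lerD2l => ev.
have : e * (v + 1) <= e * v by rewrite -ler_pdivlMr// mulrAC.
by rewrite ler_pM2l// leNgt ltrDl ltr01.
Qed.

End null_boundary.

(** * Normalizing constants and weights *)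

Section eball.
Context {R : realType} {d : nat}.
Local Notation leb := (@lebesgue_measure R).
Local Notation lebV := (lebesgue_rV R d).
Implicit Types (x y u : 'rV[R]_d).

Lemma eballE x : eball x = (dotrV x x <= 1) :> Prop.
Proof. by rewrite /eball /= enorm_le1. Qed.

Lemma measurable_dotrVV : measurable_fun setT (fun x => dotrV x x).
Proof. by apply: measurable_dotrV; exact: measurable_id. Qed.

Lemma measurable_eball : measurable (@eball R d).
Proof.
rewrite (_ : eball = (fun x => dotrV x x) @^-1` `]-oo, 1]%classic).
  by rewrite -[X in measurable X]setTI; exact: measurable_dotrVV.
by apply/funext => x; rewrite eballE /= in_itv.
Qed.

(** The sphere is the boundary of the ellipsoid attached to x = 0. *)
Lemma sphere_null : (0 < d)%N -> lebV [set x | dotrV x x = 1] = 0%E.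
Proof.
move=> d0; have z1 : dotrV (0 : 'rV[R]_d) 0 < 1.
  by rewrite -(scale0r (0 : 'rV[R]_d)) dotrVZl mul0r.
rewrite -(ellipsoid_boundary_null d0 z1); congr (lebV _).
apply/seteqP; split => x /=; rewrite AformE -(scale0r (0 : 'rV[R]_d)) !dotrVZl !mul0r
  expr0n /= addr0 subr0 mul1r//.
Qed.

Lemma ae_not_sphere : (0 < d)%N -> {ae lebV, forall x, dotrV x x != 1}.
Proof.
move=> d0; exists [set x | dotrV x x = 1]; split.
- rewrite (_ : [set x | _] = (fun x => dotrV x x) @^-1` [set 1])//.
  by rewrite -[X in measurable X]setTI; exact: measurable_dotrVV.
- exact: sphere_null.
- by move=> x /= /negP; rewrite negbK => /eqP.
Qed.

(** As the sphere is null, an integral over the closed ball can be replaced by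
    one over the whole space of a function supported in the open ball. *)
Lemma integral_eball (F G : 'rV[R]_d -> \bar R) : (0 < d)%N ->
  measurable_fun eball F -> measurable_fun setT G ->
  (forall x, dotrV x x < 1 -> F x = G x) ->
  (forall x, 1 <= dotrV x x -> G x = 0%E) ->
  (\int[lebV]_(x in eball) F x = \int[lebV]_x G x)%E.
Proof.
move=> d0 mF mG FG G0.
rewrite [RHS](_ : _ = \int[lebV]_(x in eball) G x)%E; last first.
  rewrite [RHS]integral_mkcond; apply: eq_integral => x _; rewrite patchE.
  case: ifPn => // /negP xb; rewrite G0// leNgt; apply/negP => x1; apply: xb.
  by rewrite inE eballE ltW.
apply: ae_eq_integral => //.
- exact: measurable_eball.
- exact: measurable_funTS.
have := ae_not_sphere d0; apply: filterS => x x1.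
by rewrite eballE => x2; apply: FG; rewrite lt_neqAle x1.
Qed.

Lemma integral_segment11 (F G : R -> \bar R) :
  measurable_fun (`]-1, 1[%classic : set R) F ->
  (forall t, -1 < t < 1 -> F t = G t) ->
  (forall t, ~~ (-1 < t < 1) -> G t = 0%E) ->
  (\int[leb]_(t in `[(-1)%R, 1%R]) F t = \int[leb]_t G t)%E.
Proof.
move=> mF FG G0; rewrite integral_itv_bndoo//.
rewrite integral_mkcond; apply: eq_integral => t _; rewrite patchE.
case: ifPn => [|/negP tN]; first by rewrite inE/= in_itv/= => /FG.
rewrite G0//; apply/negP => t1; apply: tN.
by rewrite inE/= in_itv.
Qed.

End eball.

Section constants.
Context {R : realType} {d : nat} (mu : R).
Hypotheses (d0 : (0 < d)%N) (mu0 : 0 < mu).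
Local Notation leb := (@lebesgue_measure R).
Local Notation lebV := (lebesgue_rV R d).
Implicit Types (x y u : 'rV[R]_d) (th r : R).

Lemma integral_powR_eball q :
  (\int[lebV]_(x in eball) ((1 - enorm x ^+ 2) `^ q)%:E = ball_int d q)%E.
Proof.
apply: integral_eball => //.
- apply: measurable_funTS; apply/measurable_EFinP.
  apply: (measurableT_comp (measurable_powR _)).
  apply: measurable_funB => //; under eq_fun do rewrite enorm_sqr.
  exact: measurable_dotrVV.
- exact: measurable_pospow_ball.
- by move=> x x1; rewrite enorm_sqr gt0_pospow// subr_gt0.
- by move=> x x1; rewrite le0_pospow// subr_le0.
Qed.

Lemma integral_powR_segment q :
  (\int[leb]_(t in `[(-1)%R, 1%R]) ((1 - t ^+ 2) `^ q)%:E = beta_int q)%E.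
Proof.
have sq (t : R) : (0 < 1 - t ^+ 2) = (-1 < t < 1).
  by rewrite subr_gt0 -real_normK ?num_real// expr_lt1// ltr_norml.
apply: integral_segment11.
- apply: measurable_funTS; apply/measurable_EFinP.
  apply: (measurableT_comp (measurable_powR _)).
  by apply: measurable_funB => //; exact: measurable_funX.
- by move=> t t1; rewrite gt0_pospow// sq.
- by move=> t; rewrite -sq -leNgt => t1; rewrite le0_pospow.
Qed.

Let fin_inv (z : \bar R) (k : R) : (0 < z < +oo)%E -> k = (fine z)^-1 ->
  0 < k /\ z = k^-1%:E.
Proof.
move=> /andP[z0 zoo] ->; case: z z0 zoo => [z| |]//=; rewrite lte_fin => z0 _.
by rewrite invr_gt0 invrK.
Qed.

Local Notation A := (@A_const R d mu).
Local Notation a := (@a_const R d mu).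
Local Notation c := (c_const mu).
Local Notation b := (b_const (mu + (d%:R - 1) / 2)).

Let pN1 : -1 < mu - 1. Proof. by rewrite ltrBrDl addrN. Qed.
Let dge1 : 1 <= d%:R :> R. Proof. by rewrite ler1n. Qed.

Lemma A_constE : 0 < A /\ ball_int d (mu - 1) = A^-1%:E.
Proof.
apply: fin_inv; first exact: ball_int_gt0_lty.
by rewrite /A_const /Rintegral integral_powR_eball.
Qed.

Lemma a_constE : 0 < a /\ ball_int d (mu - 1 / 2) = a^-1%:E.
Proof.
apply: fin_inv; first by apply: ball_int_gt0_lty; move: mu0; lra.
rewrite /a_const /Rintegral /ball_weight.
by rewrite integral_powR_eball.
Qed.

Lemma c_constE : 0 < c /\ beta_int (mu - 1) = c^-1%:E.
Proof.
apply: fin_inv; first by rewrite beta_int_gt0 beta_int_lty.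
by rewrite /c_const /Rintegral integral_powR_segment.
Qed.

Lemma b_constE : 0 < b /\ beta_int (mu - 1 + d%:R / 2) = b^-1%:E.
Proof.
have e : mu + (d%:R - 1) / 2 - 1 / 2 = mu - 1 + d%:R / 2 by field.
apply: fin_inv.
  rewrite beta_int_gt0 beta_int_lty// (lt_le_trans pN1)// lerDl divr_ge0//.
by rewrite /b_const /Rintegral integral_powR_segment e.
Qed.

(** The two ways of splitting a coordinate off an integral over the
    (d+1)-dimensional ball. *)
Lemma constants_identity : b * A = a * c.
Proof.
have [A0 AE] := A_constE; have [a0 aE] := a_constE.
have [c0 cE] := c_constE; have [b0 bE] := b_constE.
have := ball_intS_betal d (mu - 1); rewrite ball_intS_betar.
have -> : mu - 1 + 2^-1 = mu - 1 / 2 by field.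
rewrite AE aE cE bE -!EFinM => -[].
by rewrite -!invfM => /invr_inj; rewrite mulrC => ->; rewrite mulrC.
Qed.

(** The weights are cut to their supports, so that from here on integrals run
    over whole spaces. *)
Definition ball_w x : R := pospow (mu - 1 / 2) (1 - dotrV x x).
Definition seg_w (t : R) : R := pospow (mu - 1) (1 - t ^+ 2).
Definition sin_w (th : R) : R :=
  sin th `^ (2 * mu + d%:R - 1) * \1_(`[0, pi]%classic : set R) th.
(** The density in u of the average in the theorem; its integral is 1. *)
Definition ell_w x u : R :=
  A * height x ^+ (d - 1) * pospow (mu - 1) (1 - Aform x u).

Lemma ell_w_ge0 x u : 0 <= ell_w x u.
Proof.
have [A0 _] := A_constE.
by rewrite /ell_w !mulr_ge0 ?pospow_ge0 ?exprn_ge0 ?sqrtr_ge0// ltW.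
Qed.

Lemma height_powE x : dotrV x x < 1 -> height x ^+ (d - 1) * height x `^ (1 - d%:R) = 1.
Proof.
move=> x1; have s0 := height_gt0 x1.
rewrite -powR_mulrn ?ltW// -powRD ?(lt0r_neq0 s0) ?implybT// natrB//.
by rewrite addrC subrKA subrr powRr0.
Qed.

Lemma integral_ell_w x : dotrV x x < 1 -> (\int[lebV]_u (ell_w x u)%:E = 1)%E.
Proof.
move=> x1; have [A0 AE] := A_constE; have s0 := height_gt0 x1.
have c0 : 0 < A * height x ^+ (d - 1) by rewrite mulr_gt0 ?exprn_gt0.
under eq_integral do rewrite EFinM.
rewrite integralZl_gt0//; last first.
  apply/measurable_EFinP; apply: measurableT_pospow; apply: measurable_funB => //.
  exact: measurable_AformT.
rewrite integral_ellipsoid// AE -!EFinM; congr EFin.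
rewrite mulrA -[A * _ * _]mulrA height_powE// mulr1 mulfV// lt0r_neq0//.
Qed.

Lemma ell_w_average x (g : R -> R) (phi : 'rV[R]_d -> R) :
  dotrV x x < 1 ->
  measurable_fun setT g -> (forall r, 0 <= g r) ->
  measurable_fun setT phi -> (forall y, 0 <= phi y) ->
  (b%:E * \int[leb]_th ((sin_w th * g (cos th))%:E *
     \int[lebV]_u (ell_w x u * phi (orbit_pt th x u))%:E) =
   (a * c)%:E * \int[lebV]_y ((ball_w y * phi y)%:E *
     \int[leb]_t (seg_w t * g (dotrV x y + t * height x * height y))%:E))%E.
Proof.
move=> x1 mg g0 mphi phi0.
have [A0 AE] := A_constE; have [b0 _] := b_constE; have s0 := height_gt0 x1.
have q0 : 0 < 2 * (mu - 1) + d%:R + 1 by move: mu0 dge1; lra.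
have := ellipsoid_int_average q0 x1 mg g0 mphi phi0.
have -> : 2 * (mu - 1) + d%:R + 1 = 2 * mu + d%:R - 1 by ring.
have -> : mu - 1 + 2^-1 = mu - 1 / 2 by field.
move=> H.
have c0 : 0 < A * height x ^+ (d - 1) by rewrite mulr_gt0 ?exprn_gt0.
transitivity (b%:E * ((A * height x ^+ (d - 1))%:E *
  ((height x `^ (1 - d%:R))%:E * \int[lebV]_y ((ball_w y * phi y)%:E *
     \int[leb]_t (seg_w t * g (dotrV x y + t * height x * height y))%:E))))%E; last first.
  rewrite !muleA -!EFinM -constants_identity; congr (_%:E * _)%E.
  by rewrite -!mulrA height_powE// mulr1.
have mS : measurable_fun setT (fun th : R =>
    (sin th `^ (2 * mu + d%:R - 1) * g (cos th))%:E *
    ellipsoid_int (mu - 1) x (EFin \o phi) th)%E.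
  apply: emeasurable_funM.
    apply/measurable_EFinP; apply: measurable_funM.
      apply: (measurableT_comp (measurable_powR _)).
      by apply: continuous_measurable_fun; exact: continuous_sin.
    apply: (measurableT_comp mg).
    by apply: continuous_measurable_fun; exact: continuous_cos.
  exact: (measurableT_comp (measurable_ellipsoid_int (mu - 1) mphi phi0) (pair2_measurable x)).
have mE th : measurable_fun setT (fun u =>
    (pospow (mu - 1) (1 - Aform x u))%:E * (phi (orbit_pt th x u))%:E)%E.
  apply: emeasurable_funM; apply/measurable_EFinP.
    apply: measurableT_pospow; apply: measurable_funB => //.
    exact: measurable_AformT.
  exact: (measurableT_comp mphi (measurable_orbit_pt th x)).
rewrite -H [in RHS]integral_mkcond -(integralZl_gt0 _ c0); last first.
  by apply/(measurable_restrictT _ _).1 => //; exact: measurable_funTS.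
congr (_ * _)%E; apply: eq_integral => th _; rewrite patchE /sin_w indicE.
case: ifPn => _; last by rewrite mulr0 mul0r mul0e mule0.
rewrite mulr1 muleCA; congr (_ * _)%E.
rewrite /ellipsoid_int -(integralZl_gt0 _ c0 (mE th)).
by apply: eq_integral => u _; rewrite -!EFinM mulrA.
Qed.

End constants.

(** * Iterated integrals of real-valued functions *)

Section Rfubini.
Context d1 d2 (T1 : measurableType d1) (T2 : measurableType d2) (R : realType).
Variable m1 : {sigma_finite_measure set T1 -> \bar R}.
Variable m2 : {sigma_finite_measure set T2 -> \bar R}.
Variable h : T1 -> T2 -> R.
Hypothesis mh : measurable_fun setT (fun z : T1 * T2 => h z.1 z.2).
Hypothesis hoo : (\int[m1]_x \int[m2]_y `|h x y|%:E < +oo)%E.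

Local Open Scope ereal_scope.

Let ih : (m1 \x m2).-integrable setT (fun z => (h z.1 z.2)%:E).
Proof. by apply/integrable12ltyP => //; exact/measurable_EFinP. Qed.

Let fine_le (z : \bar R) : `|(fine z)%:E| <= `|z|.
Proof. by case: z => [z| |]//=; rewrite ?normr0 ?leey. Qed.

Lemma measurable_Rintegral1 : measurable_fun setT (fun x => (\int[m2]_y h x y)%R).
Proof.
apply: (measurableT_comp (fine_measurable measurableT)).
exact: measurable_int (integrable_fubini_F ih).
Qed.

Lemma measurable_Rintegral2 : measurable_fun setT (fun y => (\int[m1]_x h x y)%R).
Proof.
apply: (measurableT_comp (fine_measurable measurableT)).
exact: (measurable_fubini_G ih).
Qed.

Lemma ae_integrable_section :
  {ae m1, forall x, m2.-integrable setT (fun y => (h x y)%:E)}.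
Proof. exact: ae_integrable1 ih. Qed.

Lemma ae_fine_integral :
  {ae m1, forall x, (\int[m2]_y h x y)%:E = \int[m2]_y (h x y)%:E}.
Proof.
have := ae_integrable_section; apply: filterS => x ihx.
by rewrite /Rintegral fineK//; exact: integrable_fin_num.
Qed.

Lemma ae_fine_integral2 :
  {ae m2, forall y, (\int[m1]_x h x y)%:E = \int[m1]_x (h x y)%:E}.
Proof.
have := ae_integrable2 ih; apply: filterS => y ihy.
by rewrite /Rintegral fineK//; exact: integrable_fin_num.
Qed.

Lemma integrable_Rintegral : m1.-integrable setT (fun x => (\int[m2]_y h x y)%:E).
Proof.
apply: le_integrable (integrable_fubini_F ih) => //.
- exact/measurable_EFinP/measurable_Rintegral1.
- by move=> x _; exact: fine_le.
Qed.

(** The inner real-valued integrals have a default value at the points where the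
    section is not integrable; these points form a null set. *)
Lemma Rfubini : (\int[m1]_x \int[m2]_y h x y = \int[m2]_y \int[m1]_x h x y)%R.
Proof.
have iF := integrable_fubini_F ih.
rewrite {1}/Rintegral {2}/Rintegral; congr fine.
transitivity (\int[m1]_x \int[m2]_y (h x y)%:E).
  apply: ae_eq_integral => //.
  - exact/measurable_EFinP/measurable_Rintegral1.
  - exact: measurable_int iF.
  - by have := ae_fine_integral; apply: filterS => x + _.
rewrite (Fubini ih); apply: ae_eq_integral => //.
- exact: (measurable_fubini_G ih).
- exact/measurable_EFinP/measurable_Rintegral2.
- by have := ae_fine_integral2; apply: filterS => x + _.
Qed.

End Rfubini.

Section product_domination.
Context {R : realType}.

Lemma product_integral_lty d1 d2 (T1 : measurableType d1) (T2 : measurableType d2)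
    (m1 : {sigma_finite_measure set T1 -> \bar R})
    (m2 : {sigma_finite_measure set T2 -> \bar R})
    (h : T1 -> T2 -> R) (al : T1 -> R) (be : T2 -> R) :
  measurable_fun setT (fun z : T1 * T2 => h z.1 z.2) ->
  (forall x y, `|h x y| <= al x * be y) ->
  (forall x, 0 <= al x) -> (forall y, 0 <= be y) ->
  m1.-integrable setT (EFin \o al) -> m2.-integrable setT (EFin \o be) ->
  (\int[m1]_x \int[m2]_y `|h x y|%:E < +oo)%E.
Proof.
move=> mh hle al0 be0 ial ibe.
have mal : measurable_fun setT (EFin \o al) := measurable_int _ ial.
have mbe : measurable_fun setT (EFin \o be) := measurable_int _ ibe.
have mh' : measurable_fun setT (fun z : T1 * T2 => `|h z.1 z.2|%:E).
  by apply/measurable_EFinP; exact: measurableT_comp.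
have mhx x : measurable_fun setT (fun y => `|h x y|%:E).
  exact: (measurableT_comp mh' (pair1_measurable x)).
have be0' : (0 <= \int[m2]_y (be y)%:E)%E.
  by apply: integral_ge0 => y _; rewrite lee_fin.
apply: (@le_lt_trans _ _ (\int[m1]_x ((al x)%:E * \int[m2]_y (be y)%:E))%E).
  apply: ge0_le_integral => //.
  - by move=> x _; apply: integral_ge0 => y _; rewrite lee_fin.
  - by apply: (measurable_fun_fubini_tonelli_F _ mh') => z; rewrite lee_fin.
  - exact: emeasurable_funM.
  - move=> x _; rewrite -ge0_integralZl//; last 2 first.
    + by move=> y _; rewrite lee_fin.
    + by rewrite lee_fin.
    apply: ge0_le_integral => //.
    * by apply: emeasurable_funM.
    * by move=> y _; rewrite -EFinM lee_fin.
rewrite ge0_integralZr//; last by move=> x _; rewrite lee_fin.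
have l1 : (\int[m1]_x (al x)%:E < +oo)%E.
  have /integrableP[_] := ial; congr (_ < +oo)%E; apply: eq_integral => x _.
  by rewrite /= ger0_norm.
have l2 : (\int[m2]_y (be y)%:E < +oo)%E.
  have /integrableP[_] := ibe; congr (_ < +oo)%E; apply: eq_integral => x _.
  by rewrite /= ger0_norm.
apply: lte_mul_pinfty => //; first by apply: integral_ge0 => x _; rewrite lee_fin.
by rewrite ge0_fin_numE//; apply: integral_ge0 => x _; rewrite lee_fin.
Qed.

Lemma integrable_mul01 d (T : measurableType d) (m : {measure set T -> \bar R})
    (h phi : T -> R) : m.-integrable setT (EFin \o h) ->
  measurable_fun setT phi -> (forall x, 0 <= phi x <= 1) ->
  m.-integrable setT (fun x => (h x * phi x)%:E).
Proof.
move=> ih mphi phi01; have mh := measurable_int _ ih.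
apply: le_integrable ih => //.
  by apply/measurable_EFinP; apply: measurable_funM => //; exact/measurable_EFinP.
move=> x _; have /andP[p0 p1] := phi01 x.
by rewrite /= lee_fin normrM (ger0_norm p0) ler_piMr.
Qed.

Lemma fineZ (r : R) (z : \bar R) : 0 < r -> fine (r%:E * z)%E = r * fine z.
Proof.
move=> r0; case: z => [z| |] //=.
  by rewrite gt0_muley ?lte_fin// mulr0.
by rewrite gt0_muleNy ?lte_fin// mulr0.
Qed.

Lemma RintegralZ_gt0 d (T : measurableType d) (m : {measure set T -> \bar R})
    (r : R) (h : T -> R) : 0 < r -> measurable_fun setT h ->
  \int[m]_v (r * h v) = r * \int[m]_v h v.
Proof.
move=> r0 mh; rewrite /Rintegral -fineZ// -integralZl_gt0//.
exact/measurable_EFinP.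
Qed.

End product_domination.

(** * Orbit means and the kernel of the convolution *)

Section orbit_means.
Context {R : realType} {d : nat} (mu : R).
Hypotheses (d0 : (0 < d)%N) (mu0 : 0 < mu).
Local Notation leb := (@lebesgue_measure R).
Local Notation lebV := (lebesgue_rV R d).
Local Notation A := (@A_const R d mu).
Local Notation a := (@a_const R d mu).
Local Notation c := (c_const mu).
Local Notation b := (b_const (mu + (d%:R - 1) / 2)).
Local Notation ball_w := (@ball_w R d mu).
Local Notation seg_w := (@seg_w R mu).
Local Notation sin_w := (@sin_w R d mu).
Local Notation ell_w := (@ell_w R d mu).
Implicit Types (x y u : 'rV[R]_d) (th r : R) (phi : 'rV[R]_d -> R) (g : R -> R).

(** The right-hand side of the theorem for a function phi defined on the whole
    space. *)
Definition orbit_mean phi th x : R := if dotrV x x < 1 then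
  A * height x ^+ (d - 1) * fine (ellipsoid_int (mu - 1) x (EFin \o phi) th) else 0.

(** With values in [0, 1] orbit means again have values in [0, 1], and no
    integrability question arises. *)
Definition test01 phi := measurable_fun setT phi /\ forall y, 0 <= phi y <= 1.

Lemma measurable_ell_w x : measurable_fun setT (ell_w x).
Proof.
apply: measurable_funM => //; apply: measurableT_pospow.
by apply: measurable_funB => //; exact: measurable_AformT.
Qed.

Lemma integrable_ell_w x : dotrV x x < 1 -> lebV.-integrable setT (EFin \o ell_w x).
Proof.
move=> x1; apply/integrableP; split.
  by apply/measurable_EFinP; exact: measurable_ell_w.
under eq_integral do rewrite /= ger0_norm ?ell_w_ge0//.
by rewrite integral_ell_w// ltry.
Qed.

Lemma orbit_meanE phi th x : test01 phi -> dotrV x x < 1 ->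
  ((orbit_mean phi th x)%:E = \int[lebV]_u (ell_w x u * phi (orbit_pt th x u))%:E)%E.
Proof.
move=> [mphi phi01] x1; rewrite /orbit_mean x1.
have [A0 _] := @A_constE R d mu d0 mu0.
have k0 : 0 < A * height x ^+ (d - 1) by rewrite mulr_gt0 ?exprn_gt0// height_gt0.
rewrite -fineZ// /ellipsoid_int -integralZl_gt0//; last first.
  apply: emeasurable_funM; apply/measurable_EFinP.
    by apply: measurableT_pospow; apply: measurable_funB => //; exact: measurable_AformT.
  exact: (measurableT_comp mphi (measurable_orbit_pt th x)).
have -> : (\int[lebV]_v ((A * height x ^+ (d - 1))%:E *
    ((pospow (mu - 1) (1 - Aform x v))%:E * (EFin \o phi) (orbit_pt th x v))) =
    \int[lebV]_u (ell_w x u * phi (orbit_pt th x u))%:E)%E.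
  by apply: eq_integral => u _; rewrite /= -!EFinM mulrA.
have i0 : (0 <= \int[lebV]_u (ell_w x u * phi (orbit_pt th x u))%:E)%E.
  apply: integral_ge0 => u _; rewrite lee_fin mulr_ge0 ?ell_w_ge0//.
  by have /andP[] := phi01 (orbit_pt th x u).
rewrite fineK// ge0_fin_numE//.
apply: (@le_lt_trans _ _ (\int[lebV]_u (ell_w x u)%:E)%E); last first.
  by rewrite integral_ell_w// ltry.
apply: ge0_le_integral => //.
- move=> u _; rewrite lee_fin mulr_ge0 ?ell_w_ge0//.
  by have /andP[] := phi01 (orbit_pt th x u).
- apply/measurable_EFinP; apply: measurable_funM; first exact: measurable_ell_w.
  exact: (measurableT_comp mphi (measurable_orbit_pt th x)).
- by apply/measurable_EFinP; exact: measurable_ell_w.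
- move=> u _; rewrite lee_fin ler_piMr ?ell_w_ge0//.
  by have /andP[] := phi01 (orbit_pt th x u).
Qed.

Lemma orbit_mean01 phi th x : test01 phi -> 0 <= orbit_mean phi th x <= 1.
Proof.
move=> tphi; have [x1|x1] := boolP (dotrV x x < 1); last first.
  by rewrite /orbit_mean (negbTE x1) lexx ler01.
have [mphi phi01] := tphi.
rewrite -!lee_fin orbit_meanE//; apply/andP; split.
  apply: integral_ge0 => u _; rewrite lee_fin mulr_ge0 ?ell_w_ge0//.
  by have /andP[] := phi01 (orbit_pt th x u).
rewrite -(integral_ell_w d0 mu0 x1); apply: ge0_le_integral => //.
- move=> u _; rewrite lee_fin mulr_ge0 ?ell_w_ge0//.
  by have /andP[] := phi01 (orbit_pt th x u).
- apply/measurable_EFinP; apply: measurable_funM; first exact: measurable_ell_w.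
  exact: (measurableT_comp mphi (measurable_orbit_pt th x)).
- by apply/measurable_EFinP; exact: measurable_ell_w.
- move=> u _; rewrite lee_fin ler_piMr ?ell_w_ge0//.
  by have /andP[] := phi01 (orbit_pt th x u).
Qed.

Lemma measurable_orbit_mean phi : test01 phi ->
  measurable_fun setT (fun z : measurableTypeR R * 'rV[R]_d => orbit_mean phi z.1 z.2).
Proof.
move=> [mphi phi01]; apply: measurable_fun_ifT => //.
  apply: measurable_fun_ltr => //.
  exact: (measurableT_comp measurable_dotrVV measurable_snd).
apply: measurable_funM.
  apply: measurable_funM => //; apply: measurable_funX.
  exact: (measurableT_comp measurable_height measurable_snd).
apply: (measurableT_comp (fine_measurable measurableT)).
by apply: measurable_ellipsoid_int => // y; have /andP[] := phi01 y.
Qed.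

(** The inner integral of the convolution, without its constant. *)
Definition conv_kernel g x y : R :=
  \int[leb]_t (seg_w t * g (dotrV x y + t * height x * height y)).

Definition bounded_ge0 g (M : R) := measurable_fun setT g /\ forall r, 0 <= g r <= M.

Lemma seg_w_ge0 t : 0 <= seg_w t. Proof. exact: pospow_ge0. Qed.

Lemma measurable_seg_w : measurable_fun setT seg_w.
Proof.
by apply: measurableT_pospow; apply: measurable_funB => //; exact: measurable_funX.
Qed.

Lemma integral_seg_w : (\int[leb]_t (seg_w t)%:E = c^-1%:E)%E.
Proof. by have [_ <-] := c_constE mu0. Qed.

Let measurable_conv_kernel_in g x y : measurable_fun setT g ->
  measurable_fun setT (fun t : R => (seg_w t * g (dotrV x y + t * height x * height y))%:E).
Proof.
move=> mg; apply/measurable_EFinP; apply: measurable_funM; first exact: measurable_seg_w.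
apply: (measurableT_comp mg); apply: measurable_funD => //.
by apply: measurable_funM => //; apply: measurable_funM.
Qed.

Lemma conv_kernel_le_int g M x y : bounded_ge0 g M ->
  (\int[leb]_t (seg_w t * g (dotrV x y + t * height x * height y))%:E <= (M * c^-1)%:E)%E.
Proof.
move=> [mg gM]; have M0 : 0 <= M by have /andP[+ +] := gM 0; exact: le_trans.
rewrite EFinM -integral_seg_w -ge0_integralZl//; last 2 first.
- by apply/measurable_EFinP; exact: measurable_seg_w.
- by move=> t _; rewrite lee_fin seg_w_ge0.
apply: ge0_le_integral => //.
- by move=> t _; rewrite lee_fin mulr_ge0 ?seg_w_ge0//; have /andP[] := gM (dotrV x y + t * height x * height y).
- exact: measurable_conv_kernel_in.
- by apply: emeasurable_funM => //; apply/measurable_EFinP; exact: measurable_seg_w.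
- move=> t _; rewrite -EFinM lee_fin mulrC ler_wpM2r ?seg_w_ge0//.
  by have /andP[] := gM (dotrV x y + t * height x * height y).
Qed.

Lemma conv_kernelE g M x y : bounded_ge0 g M ->
  ((conv_kernel g x y)%:E = \int[leb]_t (seg_w t * g (dotrV x y + t * height x * height y))%:E)%E.
Proof.
move=> gM; rewrite /conv_kernel /Rintegral fineK// ge0_fin_numE.
  by rewrite (le_lt_trans (conv_kernel_le_int x y gM))// ltry.
apply: integral_ge0 => t _; rewrite lee_fin mulr_ge0 ?seg_w_ge0//.
by have [_ /(_ (dotrV x y + t * height x * height y))/andP[]] := gM.
Qed.

Lemma conv_kernel_bounds g M x y : bounded_ge0 g M -> 0 <= conv_kernel g x y <= M * c^-1.
Proof.
move=> gM; rewrite -!lee_fin (conv_kernelE _ _ gM) conv_kernel_le_int// andbT.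
apply: integral_ge0 => t _; rewrite lee_fin mulr_ge0 ?seg_w_ge0//.
by have [_ /(_ (dotrV x y + t * height x * height y))/andP[]] := gM.
Qed.

Lemma conv_kernelC g x y : conv_kernel g x y = conv_kernel g y x.
Proof.
by rewrite /conv_kernel; apply: eq_Rintegral => t _; rewrite dotrVC mulrAC.
Qed.

Lemma measurable_conv_kernel g M : bounded_ge0 g M ->
  measurable_fun setT (fun z : 'rV[R]_d * 'rV[R]_d => conv_kernel g z.1 z.2).
Proof.
move=> [mg gM]; apply: (measurableT_comp (fine_measurable measurableT)).
pose k (z : ('rV[R]_d * 'rV[R]_d) * measurableTypeR R) : \bar R :=
  (seg_w z.2 * g (dotrV z.1.1 z.1.2 + z.2 * height z.1.1 * height z.1.2))%:E.
apply: (@measurable_fun_fubini_tonelli_F _ _ _ _ _ leb k); last first.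
  by move=> z; rewrite lee_fin mulr_ge0 ?seg_w_ge0//; have /andP[] := gM (dotrV z.1.1 z.1.2 + z.2 * height z.1.1 * height z.1.2).
have m1 : measurable_fun setT (fun z : ('rV[R]_d * 'rV[R]_d) * measurableTypeR R => z.1.1).
  exact: (measurableT_comp measurable_fst measurable_fst).
have m2 : measurable_fun setT (fun z : ('rV[R]_d * 'rV[R]_d) * measurableTypeR R => z.1.2).
  exact: (measurableT_comp measurable_snd measurable_fst).
have m3 : measurable_fun setT (fun z : ('rV[R]_d * 'rV[R]_d) * measurableTypeR R => (z.2 : R)).
  exact: measurable_snd.
apply/measurable_EFinP; apply: measurable_funM.
  exact: (measurableT_comp measurable_seg_w m3).
apply: (measurableT_comp mg); apply: measurable_funD; first exact: measurable_dotrV.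
by apply: measurable_funM; [apply: measurable_funM => //|];
  [exact: (measurableT_comp measurable_height m1)|exact: (measurableT_comp measurable_height m2)].
Qed.

(** The orbit mean of phi satisfies at every point of the open ball the identity
    that defines the translation of phi. *)
Lemma orbit_mean_average g M phi x : bounded_ge0 g M -> test01 phi -> dotrV x x < 1 ->
  b * \int[leb]_th (sin_w th * g (cos th) * orbit_mean phi th x) =
  a * c * \int[lebV]_y (ball_w y * phi y * conv_kernel g x y).
Proof.
move=> gM tphi x1.
have [mg g0] := gM; have [mphi phi01] := tphi.
have := @ell_w_average R d mu d0 mu0 x g phi x1 mg _ mphi _.
have g0' r : 0 <= g r by have /andP[] := g0 r.
have phi0' y : 0 <= phi y by have /andP[] := phi01 y.
move=> /(_ g0' phi0') H.
have [b0 _] := @b_constE R d mu mu0; have [a0 _] := a_constE d0 mu0; have [c0 _] := c_constE mu0.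
rewrite /Rintegral -!fineZ ?mulr_gt0//; congr fine.
transitivity (b%:E * \int[leb]_th ((sin_w th * g (cos th))%:E *
     \int[lebV]_u (ell_w x u * phi (orbit_pt th x u))%:E))%E.
  by congr (_ * _)%E; apply: eq_integral => th _; rewrite -orbit_meanE// -EFinM.
rewrite H; congr (_ * _)%E; apply: eq_integral => y _.
by rewrite -(conv_kernelE _ _ gM) -EFinM.
Qed.

End orbit_means.

Section orbit_kernels.
Context {R : realType} {d : nat} (mu : R).
Hypotheses (d0 : (0 < d)%N) (mu0 : 0 < mu).
Local Notation lebV := (lebesgue_rV R d).
Local Notation A := (@A_const R d mu).
Local Notation ball_w := (@ball_w R d mu).
Local Notation ell_w := (@ell_w R d mu).
Local Notation orbit_mean := (@orbit_mean R d mu).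
Implicit Types (x y u : 'rV[R]_d) (th r : R) (phi q : 'rV[R]_d -> R).

(** The condition on x alone suffices for symmetry: if y is outside the open ball
    and x inside, [discr] is not positive. *)
Definition orbit_kernel th x y : R := if dotrV x x < 1 then
  A * sin th `^ (- (2 * (mu - 1) + d%:R)) * pospow (mu - 1) (discr x y (cos th)) else 0.

Lemma orbit_kernelC th x y : orbit_kernel th x y = orbit_kernel th y x.
Proof.
rewrite /orbit_kernel; have [x1|x1] := ltP (dotrV x x) 1; have [y1|y1] := ltP (dotrV y y) 1 => //.
- by rewrite discrC.
- by rewrite (@le0_pospow _ _ (discr _ _ _)) ?mulr0// discr_le0.
- by rewrite (@le0_pospow _ _ (discr _ _ _)) ?mulr0// discr_le0.
Qed.

Lemma orbit_kernel_ge0 th x y : 0 <= orbit_kernel th x y.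
Proof.
rewrite /orbit_kernel; case: ifPn => // _; have [A0 _] := @A_constE R d mu d0 mu0.
by rewrite !mulr_ge0 ?powR_ge0 ?pospow_ge0// ltW.
Qed.

Lemma measurable_orbit_kernel th :
  measurable_fun setT (fun z : 'rV[R]_d * 'rV[R]_d => orbit_kernel th z.1 z.2).
Proof.
apply: measurable_fun_ifT => //.
  apply: measurable_fun_ltr => //.
  exact: (measurableT_comp measurable_dotrVV measurable_fst).
apply: measurable_funM => //; apply: measurableT_pospow.
exact: measurable_discr.
Qed.

Lemma ball_wE x : dotrV x x < 1 -> ball_w x = height x `^ (2 * mu - 1).
Proof.
move=> x1; have s0 := height_gt0 x1.
rewrite /ball_w gt0_pospow ?subr_gt0// -height_sqr ?ltW// -powR_mulrn ?ltW//.
by rewrite -powRrM; congr (_ `^ _); field.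
Qed.

(** Since [orbit_kernel] is symmetric, this expresses that orbit means are
    self-adjoint for the weight of the ball. *)
Lemma integral_ell_w_orbit_kernel th x (h : 'rV[R]_d -> \bar R) : 0 < th < pi ->
  dotrV x x < 1 -> measurable_fun setT h ->
  ((ball_w x)%:E * \int[lebV]_u ((ell_w x u)%:E * h (orbit_pt th x u)) =
   \int[lebV]_y ((orbit_kernel th x y)%:E * h y))%E.
Proof.
move=> thi x1 mh; have s0 := height_gt0 x1; have sp := sin_gt0_pi thi.
have [A0 _] := @A_constE R d mu d0 mu0.
have k0 : 0 < A * height x ^+ (d - 1) by rewrite mulr_gt0 ?exprn_gt0.
have a0 : 0 < A * sin th `^ (- (2 * (mu - 1) + d%:R)) by rewrite mulr_gt0 ?powR_gt0.
have mE : measurable_fun setT (fun u =>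
    (pospow (mu - 1) (1 - Aform x u))%:E * h (orbit_pt th x u))%E.
  apply: emeasurable_funM.
    apply/measurable_EFinP; apply: measurableT_pospow; apply: measurable_funB => //.
    exact: measurable_AformT.
  exact: (measurableT_comp mh (measurable_orbit_pt th x)).
have -> : (\int[lebV]_u ((ell_w x u)%:E * h (orbit_pt th x u)) =
    (A * height x ^+ (d - 1))%:E * ellipsoid_int (mu - 1) x h th)%E.
  rewrite /ellipsoid_int -(integralZl_gt0 _ k0 mE); apply: eq_integral => u _.
  by rewrite muleA -EFinM.
have mD : measurable_fun setT (fun y =>
    (pospow (mu - 1) (discr x y (cos th)))%:E * h y)%E.
  apply: emeasurable_funM => //; apply/measurable_EFinP; apply: measurableT_pospow.
  by apply: measurable_discr.
transitivity ((A * sin th `^ (- (2 * (mu - 1) + d%:R)))%:E *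
    \int[lebV]_y ((pospow (mu - 1) (discr x y (cos th)))%:E * h y))%E; last first.
  rewrite -(integralZl_gt0 _ a0 mD); apply: eq_integral => y _.
  by rewrite /orbit_kernel x1 muleA -EFinM.
rewrite ellipsoid_int_discr// !muleA -!EFinM; congr (_%:E * _)%E.
rewrite ball_wE// powRM ?ltW//.
set D := 2 * (mu - 1) + d%:R; set sD := sin th `^ _.
have -> : height x `^ (2 * mu - 1) * (A * height x ^+ (d - 1)) * (sD * height x `^ (- D)) =
    A * sD * (height x ^+ (d - 1) * (height x `^ (2 * mu - 1) * height x `^ (- D))) by ring.
rewrite -powRD ?(lt0r_neq0 s0) ?implybT//.
rewrite (_ : 2 * mu - 1 + - D = 1 - d%:R); last by rewrite /D; ring.
by rewrite height_powE// mulr1.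
Qed.

(** Weaker than continuity on the space, and what dominated convergence in th
    uses. *)
Definition orbit_continuous phi := forall x u, continuous (fun th => phi (orbit_pt th x u)).

Lemma continuous_orbit_mean phi x : test01 phi -> orbit_continuous phi ->
  continuous (fun th => orbit_mean phi th x).
Proof.
move=> tphi cphi th0; have [x1|x1] := boolP (dotrV x x < 1); last first.
  by rewrite /orbit_mean (negbTE x1); exact: cvg_cst.
have [mphi phi01] := tphi.
pose f th u := ell_w x u * phi (orbit_pt th x u).
have -> : (fun th => orbit_mean phi th x) = (fun th => \int[lebV]_u f th u).
  by apply/funext => th; rewrite /Rintegral /f -orbit_meanE.
have mf th : measurable_fun setT (f th).
  apply: measurable_funM; first exact: measurable_ell_w.
  exact: (measurableT_comp mphi (measurable_orbit_pt th x)).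
have fle th u : `|f th u| <= ell_w x u.
  have /andP[p0 p1] := phi01 (orbit_pt th x u).
  have e0 := ell_w_ge0 d0 mu0 x u.
  by rewrite /f (ger0_norm (mulr_ge0 e0 p0)) ler_piMr.
have ie := integrable_ell_w d0 mu0 x1.
have := @continuity_under_integral R _ _ lebV f setT measurableT (th0 - 1) (th0 + 1) _ _ (ell_w x) ie _.
apply.
- move=> th _; apply: le_integrable ie => //; first exact/measurable_EFinP.
  by move=> u _; rewrite /= lee_fin (le_trans (fle th u))// ler_norm.
- apply: aeW => u _ th _; apply: cvgM; first exact: cvg_cst.
  exact: cphi.
- by move=> th _; apply: aeW => u _; exact: fle.
- by rewrite inE/= in_itv/= ltrBlDr ltrDl ltr01.
Qed.

Lemma continuous_integral_orbit_mean phi q : test01 phi -> orbit_continuous phi ->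
  lebV.-integrable setT (EFin \o q) ->
  continuous (fun th => \int[lebV]_x (q x * orbit_mean phi th x)).
Proof.
move=> tphi cphi iq th0.
have mq : measurable_fun setT q by apply/measurable_EFinP; exact: measurable_int iq.
have mt th : measurable_fun setT (fun x => orbit_mean phi th x).
  exact: (measurableT_comp (@measurable_orbit_mean R d mu phi tphi)
    (pair1_measurable (th : measurableTypeR R))).
pose f th x := q x * orbit_mean phi th x.
have fle th x : `|f th x| <= `|q x|.
  have /andP[p0 p1] := orbit_mean01 d0 mu0 th x tphi.
  by rewrite normrM [X in _ * X]ger0_norm// ler_piMr.
have mf th : measurable_fun setT (f th) by exact: measurable_funM.
have := @continuity_under_integral R _ _ lebV f setT measurableT (th0 - 1) (th0 + 1) _ _
  (fun x => `|q x|) (integrable_norm iq) _.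
apply.
- move=> th _; apply: le_integrable iq => //; first exact/measurable_EFinP.
  by move=> x _; rewrite /= lee_fin fle.
- apply: aeW => x _ th _; apply: cvgM; first exact: cvg_cst.
  exact: continuous_orbit_mean.
- by move=> th _; apply: aeW => x _; exact: fle.
- by rewrite inE/= in_itv/= ltrBlDr ltrDl ltr01.
Qed.

(** For sin th = 0 the orbit is reduced to one point. *)
Lemma orbit_mean_axis phi th x : test01 phi -> dotrV x x < 1 -> sin th = 0 ->
  orbit_mean phi th x = phi (cos th *: x).
Proof.
move=> tphi x1 s0; apply: EFin_inj; rewrite orbit_meanE//.
under eq_integral do rewrite /orbit_pt s0 mul0r scale0r addr0 mulrC EFinM.
have [_ phi01] := tphi; have /andP[p0 _] := phi01 (cos th *: x).
rewrite ge0_integralZl//.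
- by rewrite integral_ell_w// mule1.
- by apply/measurable_EFinP; exact: measurable_ell_w.
- by move=> u _; rewrite lee_fin ell_w_ge0.
Qed.

End orbit_kernels.

(** * Functions multiplied by the weight of the ball *)

Section weighted.
Context {R : realType} {d : nat} (mu : R).
Hypotheses (d0 : (0 < d)%N) (mu0 : 0 < mu).
Local Notation leb := (@lebesgue_measure R).
Local Notation lebV := (lebesgue_rV R d).
Local Notation a := (@a_const R d mu).
Local Notation c := (c_const mu).
Local Notation ball_w := (@ball_w R d mu).
Local Notation seg_w := (@seg_w R mu).
Implicit Types (x y u : 'rV[R]_d) (th r : R) (phi q h f : 'rV[R]_d -> R) (g : R -> R).

(** Turns an element of the weighted L1 space, whose values outside the open ball
    are arbitrary, into an integrable function on the whole space. *)
Definition weighted h x : R := if dotrV x x < 1 then h x * ball_w x else 0.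

Lemma measurable_ball_w : measurable_fun setT ball_w.
Proof.
apply: measurableT_pospow; apply: measurable_funB => //.
exact: measurable_dotrVV.
Qed.

Lemma ball_w_ge0 x : 0 <= ball_w x. Proof. exact: pospow_ge0. Qed.

Lemma ball_w_gt0 x : dotrV x x < 1 -> 0 < ball_w x.
Proof. by move=> x1; apply: pospow_gt0; rewrite subr_gt0. Qed.

Lemma ball_w_out x : 1 <= dotrV x x -> ball_w x = 0.
Proof. by move=> x1; rewrite /ball_w le0_pospow// subr_le0. Qed.

Lemma integrable_ball_w : lebV.-integrable setT (EFin \o ball_w).
Proof.
apply/integrableP; split; first by apply/measurable_EFinP; exact: measurable_ball_w.
under eq_integral do rewrite /= ger0_norm ?ball_w_ge0//.
by have [_ aE] := a_constE d0 mu0; rewrite -/(ball_int d _) aE ltry.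
Qed.

Lemma ball_weightE x : dotrV x x < 1 -> ball_weight mu x = ball_w x.
Proof. by move=> x1; rewrite /ball_weight enorm_sqr /ball_w gt0_pospow ?subr_gt0. Qed.

Lemma measurable_ball_weight : measurable_fun setT (@ball_weight R d mu).
Proof.
apply: (measurableT_comp (measurable_powR _)); apply: measurable_funB => //.
by under eq_fun do rewrite enorm_sqr; exact: measurable_dotrVV.
Qed.

Lemma measurable_oball : measurable [set x : 'rV[R]_d | dotrV x x < 1].
Proof.
rewrite (_ : [set x | _] = (fun x => dotrV x x) @^-1` `]-oo, 1[%classic).
  by rewrite -[X in measurable X]setTI; exact: measurable_dotrVV.
by apply/seteqP; split => x /=; rewrite in_itv.
Qed.

Lemma measurable_weighted h : measurable_fun eball h -> measurable_fun setT (weighted h).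
Proof.
move=> mh.
have -> : weighted h = (fun x => (h \_ [set x | dotrV x x < 1]) x * ball_w x).
  apply/funext => x; rewrite /weighted patchE.
  have [x1|x1] := boolP (dotrV x x < 1); first by rewrite mem_set.
  by rewrite memNset ?mul0r//=; exact/negP.
apply: measurable_funM; last exact: measurable_ball_w.
apply/(measurable_restrictT _ measurable_oball).
apply: measurable_funS mh; first exact: measurable_eball.
by move=> x /= x1; rewrite eballE ltW.
Qed.

Lemma integral_weighted_norm h1 h2 : measurable_fun eball h1 -> measurable_fun eball h2 ->
  (\int[lebV]_(x in eball) (`|h1 x - h2 x| * ball_weight mu x)%:E =
   \int[lebV]_x `|weighted h1 x - weighted h2 x|%:E)%E.
Proof.
move=> mh1 mh2; apply: integral_eball => //.
- apply/measurable_EFinP; apply: measurable_funM.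
    by apply: measurableT_comp => //; exact: measurable_funB.
  by apply: measurable_funTS; exact: measurable_ball_weight.
- apply/measurable_EFinP; apply: measurableT_comp => //.
  by apply: measurable_funB; exact: measurable_weighted.
- move=> x x1; rewrite /weighted x1 ball_weightE// -mulrBl normrM.
  by rewrite (ger0_norm (ball_w_ge0 x)).
- by move=> x; rewrite leNgt /weighted => /negbTE ->; rewrite subrr normr0.
Qed.

Lemma integrable_weighted h : L1_ball mu h -> lebV.-integrable setT (EFin \o weighted h).
Proof.
move=> [mh hoo]; apply/integrableP; split.
  by apply/measurable_EFinP; exact: measurable_weighted.
have := @integral_weighted_norm h (cst 0) mh (measurable_cst _).
under eq_integral do rewrite subr0.
move=> E; move: hoo; rewrite E; congr (_ < +oo)%E.
apply: eq_integral => x _; congr (_%:E); rewrite /weighted.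
by case: ifP => _; rewrite /cst ?mul0r subr0.
Qed.

Lemma L1_distE h1 h2 : L1_ball mu h1 -> L1_ball mu h2 ->
  L1_dist mu h1 h2 = \int[lebV]_x `|weighted h1 x - weighted h2 x|.
Proof.
by move=> [mh1 _] [mh2 _]; rewrite /L1_dist /Rintegral integral_weighted_norm.
Qed.

Let integrable_dist h1 h2 : L1_ball mu h1 -> L1_ball mu h2 ->
  lebV.-integrable setT (EFin \o (fun x => `|weighted h1 x - weighted h2 x|)).
Proof.
move=> i1 i2; apply: integrable_norm.
exact: (integrableB measurableT (integrable_weighted i1) (integrable_weighted i2)).
Qed.

Lemma pairing_dist h1 h2 phi : L1_ball mu h1 -> L1_ball mu h2 -> test01 phi ->
  `|\int[lebV]_x (weighted h1 x * phi x) - \int[lebV]_x (weighted h2 x * phi x)| <=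
  L1_dist mu h1 h2.
Proof.
move=> i1 i2 [mphi phi01]; rewrite L1_distE//.
have ip h : L1_ball mu h -> lebV.-integrable setT (EFin \o (fun x => weighted h x * phi x)).
  by move=> ih; exact: integrable_mul01 (integrable_weighted ih) mphi phi01.
rewrite -RintegralB//; [|exact: ip|exact: ip].
have iB := integrableB measurableT (ip _ i1) (ip _ i2).
apply: (le_trans (le_normr_Rintegral measurableT iB)).
apply: le_Rintegral => //; first exact: integrable_norm.
  exact: integrable_dist.
move=> x _ /=; rewrite -mulrBl normrM ler_piMr//.
by have /andP[p0 p1] := phi01 x; rewrite ger0_norm.
Qed.

Lemma norm_dist h1 h2 : L1_ball mu h1 -> L1_ball mu h2 ->
  `|\int[lebV]_x `|weighted h1 x| - \int[lebV]_x `|weighted h2 x| | <= L1_dist mu h1 h2.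
Proof.
move=> i1 i2; rewrite L1_distE//.
have ip h : L1_ball mu h -> lebV.-integrable setT (EFin \o (fun x => `|weighted h x|)).
  by move=> ih; apply: integrable_norm; exact: integrable_weighted.
rewrite -RintegralB//; [|exact: ip|exact: ip].
have iB := integrableB measurableT (ip _ i1) (ip _ i2).
apply: (le_trans (le_normr_Rintegral measurableT iB)).
apply: le_Rintegral => //; first exact: integrable_norm.
  exact: integrable_dist.
by move=> x _ /=; exact: ler_dist_dist.
Qed.

Lemma ball_convE f g M x : bounded_ge0 g M -> L1_ball mu f ->
  ball_conv mu f g x = a * c * \int[lebV]_y (weighted f y * conv_kernel mu g x y).
Proof.
move=> gM [mf foo]; have [mg g0] := gM.
have [a0 _] := a_constE d0 mu0; have [c0 _] := c_constE mu0.
have mk : measurable_fun setT (fun y => conv_kernel mu g x y).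
  exact: (measurableT_comp (@measurable_conv_kernel R d mu g M gM) (pair1_measurable x)).
have mck : measurable_fun setT (fun y => weighted f y * conv_kernel mu g x y).
  by apply: measurable_funM => //; exact: measurable_weighted.
rewrite /ball_conv -mulrA; congr (_ * _); rewrite /Rintegral -fineZ//; congr fine.
rewrite -(integralZl_gt0 _ c0); last exact/measurable_EFinP.
have kgE' y : fine (\int[leb]_(t in `[(-1)%R, 1%R])
   (g (dotrV x y + t * Num.sqrt (1 - enorm x ^+ 2) * Num.sqrt (1 - enorm y ^+ 2)) *
   (1 - t ^+ 2) `^ (mu - 1))%:E)%E = conv_kernel mu g x y.
  have sq (t : R) : (0 < 1 - t ^+ 2) = (-1 < t < 1).
    by rewrite subr_gt0 -real_normK ?num_real// expr_lt1// ltr_norml.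
  rewrite /conv_kernel /Rintegral; congr fine; apply: integral_segment11.
  - apply: measurable_funTS; apply/measurable_EFinP; apply: measurable_funM.
      apply: (measurableT_comp mg); apply: measurable_funD => //.
      by apply: measurable_funM => //; apply: measurable_funM.
    apply: (measurableT_comp (measurable_powR _)).
    by apply: measurable_funB => //; exact: measurable_funX.
  - by move=> t t1; rewrite /seg_w gt0_pospow ?sq// mulrC.
  - by move=> t; rewrite -sq -leNgt => t1; rewrite /seg_w le0_pospow// mul0r.
transitivity (\int[lebV]_(y in eball) (f y * (c * conv_kernel mu g x y) * ball_weight mu y)%:E)%E.
  by apply: eq_integral => y _; rewrite kgE'.
apply: integral_eball => //.
- apply/measurable_EFinP; apply: measurable_funM; last first.
    by apply: measurable_funTS; exact: measurable_ball_weight.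
  apply: measurable_funM => //; apply: measurable_funTS.
  exact: measurable_funM.
- by apply: emeasurable_funM => //; exact/measurable_EFinP.
- move=> y y1; rewrite /weighted y1 ball_weightE// -EFinM; congr EFin; ring.
- by move=> y; rewrite leNgt /weighted => /negbTE ->; rewrite mul0r mule0.
Qed.

End weighted.

(** * The average of orbit means paired with a weighted function *)

Section symmetric_average.
Context {R : realType} {d : nat} (mu : R).
Hypotheses (d0 : (0 < d)%N) (mu0 : 0 < mu).
Local Notation leb := (@lebesgue_measure R).
Local Notation lebV := (lebesgue_rV R d).
Local Notation A := (@A_const R d mu).
Local Notation a := (@a_const R d mu).
Local Notation c := (c_const mu).
Local Notation b := (b_const (mu + (d%:R - 1) / 2)).
Local Notation ball_w := (@ball_w R d mu).
Local Notation sin_w := (@sin_w R d mu).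
Local Notation orbit_mean := (@orbit_mean R d mu).
Local Notation weighted := (@weighted R d mu).
Local Notation conv_kernel := (@conv_kernel R d mu).
Implicit Types (x y u : 'rV[R]_d) (th r : R) (phi q h : 'rV[R]_d -> R) (g : R -> R).

Lemma sin_w_ge0 th : 0 <= sin_w th.
Proof. by rewrite /sin_w mulr_ge0 ?powR_ge0// indicE. Qed.

Lemma measurable_sin_w : measurable_fun setT sin_w.
Proof.
apply: measurable_funM; last exact: measurable_indic.
apply: (measurableT_comp (measurable_powR _)).
by apply: continuous_measurable_fun; exact: continuous_sin.
Qed.

Lemma sin_w_le th : sin_w th <= \1_(`[0, pi]%classic : set R) th.
Proof.
rewrite /sin_w indicE; case: (boolP (th \in _)) => [|_]; last by rewrite mulr0.
rewrite inE/= in_itv/= => thi; rewrite mulr1.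
have s0 := sin_ge0_pi thi.
have e0 : 0 <= 2 * mu + d%:R - 1.
  have : 1 <= d%:R :> R by rewrite ler1n.
  by move: mu0; lra.
rewrite [leRHS](_ : _ = 1 `^ (2 * mu + d%:R - 1)); last by rewrite powR1.
by rewrite ge0_ler_powR// ?nnegrE// sin_le1.
Qed.

Lemma integrable_sin_w : leb.-integrable setT (EFin \o sin_w).
Proof.
have ii : leb.-integrable setT (EFin \o (\1_(`[0, pi]%classic : set R))).
  exact: integrable_indic_itv.
apply: le_integrable ii => //.
  by apply/measurable_EFinP; exact: measurable_sin_w.
by move=> th _; rewrite /= lee_fin ger0_norm ?sin_w_ge0// ger0_norm ?sin_w_le.
Qed.

Section symmetric.
Variables (phi : 'rV[R]_d -> R) (q : 'rV[R]_d -> R) (g : R -> R) (M : R).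
Hypotheses (tphi : test01 phi) (gM : bounded_ge0 g M).
Hypotheses (iq : lebV.-integrable setT (EFin \o q)).
Hypothesis q_out : forall x, 1 <= dotrV x x -> q x = 0.

Let mq : measurable_fun setT q.
Proof. by apply/measurable_EFinP; exact: measurable_int iq. Qed.

Let mg : measurable_fun setT g. Proof. by case: gM. Qed.
Let g0 r : 0 <= g r. Proof. by have [_ /(_ r)/andP[]] := gM. Qed.
Let gle r : g r <= M. Proof. by have [_ /(_ r)/andP[]] := gM. Qed.
Let M0 : 0 <= M. Proof. exact: le_trans (g0 0) (gle 0). Qed.
Let mphi : measurable_fun setT phi. Proof. by case: tphi. Qed.
Let phi0 x : 0 <= phi x. Proof. by have [_ /(_ x)/andP[]] := tphi. Qed.
Let phi1 x : phi x <= 1. Proof. by have [_ /(_ x)/andP[]] := tphi. Qed.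

Let iqn : lebV.-integrable setT (EFin \o (fun y => `|q y|)).
Proof. exact: integrable_norm. Qed.

Let cosT_g : measurable_fun setT (fun th : R => g (cos th)).
Proof.
apply: (measurableT_comp mg).
by apply: continuous_measurable_fun; exact: continuous_cos.
Qed.

Let integrable_qk x : lebV.-integrable setT (fun y => (q y * conv_kernel g x y)%:E).
Proof.
have iqM := integrableZr measurableT (M * c^-1) iqn.
apply: le_integrable iqM => //.
  apply/measurable_EFinP; apply: measurable_funM => //.
  exact: (measurableT_comp (@measurable_conv_kernel R d mu g M gM) (pair1_measurable x)).
move=> y _; have /andP[k0 k1] := conv_kernel_bounds mu0 x y gM.
rewrite /= lee_fin !normrM normr_id ler_wpM2l// (ger0_norm k0).
by rewrite -normrM (le_trans k1)// ler_norm.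
Qed.

Let integrable_wk y : lebV.-integrable setT (fun x => (ball_w x * phi x * conv_kernel g y x)%:E).
Proof.
have iqM := integrableZr measurableT (M * c^-1) (integrable_ball_w d0 mu0).
apply: le_integrable iqM => //.
  apply/measurable_EFinP; apply: measurable_funM => //.
    by apply: measurable_funM => //; exact: measurable_ball_w.
  exact: (measurableT_comp (@measurable_conv_kernel R d mu g M gM) (pair1_measurable y)).
move=> x _; have /andP[k0 k1] := conv_kernel_bounds mu0 y x gM.
have w0 := ball_w_ge0 mu x.
rewrite /= lee_fin !normrM (ger0_norm w0) (ger0_norm (phi0 x)) (ger0_norm k0) -mulrA ler_wpM2l//.
rewrite -normrM (le_trans _ (ler_norm _))// (le_trans _ k1)// ler_piMl//.
Qed.

Let conv_integrand x y := ball_w x * phi x * (q y * conv_kernel g x y).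

Let measurable_conv_integrand :
  measurable_fun setT (fun z : 'rV[R]_d * 'rV[R]_d => conv_integrand z.1 z.2).
Proof.
apply: measurable_funM.
  apply: measurable_funM; first exact: (measurableT_comp (@measurable_ball_w R d mu) measurable_fst).
  exact: (measurableT_comp mphi measurable_fst).
apply: measurable_funM; first exact: (measurableT_comp mq measurable_snd).
exact: measurable_conv_kernel gM.
Qed.

Let conv_integrand_lty :
  (\int[lebV]_x \int[lebV]_y `|conv_integrand x y|%:E < +oo)%E.
Proof.
have iqM := integrableZr measurableT (M * c^-1) iqn.
apply: (@product_integral_lty _ _ _ _ _ lebV lebV conv_integrand ball_w
  (fun y => `|q y| * (M * c^-1)) measurable_conv_integrand) => //.
- move=> x y; have /andP[k0 k1] := conv_kernel_bounds mu0 x y gM.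
  have w0 := ball_w_ge0 mu x.
  rewrite /conv_integrand !normrM (ger0_norm w0) (ger0_norm (phi0 x)) (ger0_norm k0) -mulrA ler_wpM2l//.
  rewrite mulrCA ler_wpM2l// (le_trans _ k1)// ler_piMl//.
- by move=> x; exact: ball_w_ge0.
- move=> y; have /andP[k0 k1] := conv_kernel_bounds mu0 y y gM.
  by rewrite mulr_ge0// (le_trans k0).
- exact: integrable_ball_w.
Qed.

Lemma measurable_conv :
  measurable_fun setT (fun x => ball_w x * phi x * \int[lebV]_y (q y * conv_kernel g x y)).
Proof.
have := measurable_Rintegral1 measurable_conv_integrand conv_integrand_lty.
congr (measurable_fun _ _); apply/funext => x.
by rewrite -(RintegralZl _ measurableT (integrable_qk x)).
Qed.

(** The convolution kernel is symmetric, so that convolution with g can be moved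
    from q to phi. *)
Lemma conv_symmetric :
  \int[lebV]_x (ball_w x * phi x * \int[lebV]_y (q y * conv_kernel g x y)) =
  \int[lebV]_y (q y * \int[lebV]_x (ball_w x * phi x * conv_kernel g y x)).
Proof.
transitivity (\int[lebV]_x \int[lebV]_y conv_integrand x y).
  by apply: eq_Rintegral => x _; rewrite (RintegralZl _ _ (integrable_qk x)).
rewrite (Rfubini measurable_conv_integrand conv_integrand_lty).
apply: eq_Rintegral => y _.
rewrite -(RintegralZl (q y) measurableT (integrable_wk y)).
apply: eq_Rintegral => x _.
by rewrite /conv_integrand (conv_kernelC mu g x y) mulrCA.
Qed.

(** After [conv_symmetric] the convolution acts on phi, where
    [orbit_mean_average] applies at each point y. *)
Lemma average_symmetric :
  a * c * \int[lebV]_x (ball_w x * phi x * \int[lebV]_y (q y * conv_kernel g x y)) =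
  b * \int[leb]_th (sin_w th * g (cos th) * \int[lebV]_y (q y * orbit_mean phi th y)).
Proof.
rewrite conv_symmetric.
pose h th y := sin_w th * g (cos th) * (q y * orbit_mean phi th y).
have mt := @measurable_orbit_mean R d mu phi tphi.
have mh : measurable_fun setT (fun z : measurableTypeR R * 'rV[R]_d => h z.1 z.2).
  apply: measurable_funM.
    apply: measurable_funM; first exact: (measurableT_comp measurable_sin_w measurable_fst).
    exact: (measurableT_comp cosT_g measurable_fst).
  by apply: measurable_funM => //; exact: (measurableT_comp mq measurable_snd).
have bnd : (\int[leb]_th \int[lebV]_y `|h th y|%:E < +oo)%E.
  have iM := integrableZr measurableT M integrable_sin_w.
  apply: (@product_integral_lty _ _ _ _ _ leb lebV h (fun th => sin_w th * M) (fun y => `|q y|) mh) => //.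
  - move=> th y; have /andP[t0 t1] := orbit_mean01 d0 mu0 th y tphi.
    have s0 := sin_w_ge0 th; have sg0 := mulr_ge0 s0 (g0 (cos th)).
    rewrite /h normrM (ger0_norm sg0) normrM (ger0_norm t0).
    by apply: ler_pM => //; [exact: mulr_ge0|exact: ler_wpM2l|exact: ler_piMr].
  - by move=> th; rewrite mulr_ge0 ?sin_w_ge0.
have iq_orbit_mean th : lebV.-integrable setT (fun y => (q y * orbit_mean phi th y)%:E).
  apply: (integrable_mul01 iq); last by move=> y; exact: (orbit_mean01 d0 mu0 th y tphi).
  exact: (measurableT_comp mt (pair1_measurable (th : measurableTypeR R))).
have isg y : leb.-integrable setT (fun th => (sin_w th * g (cos th) * orbit_mean phi th y)%:E).
  have iM := integrableZr measurableT M integrable_sin_w.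
  apply: le_integrable iM => //.
    apply/measurable_EFinP; apply: measurable_funM.
      by apply: measurable_funM => //; exact: measurable_sin_w.
    exact: (measurableT_comp mt (pair2_measurable y)).
  move=> th _; have /andP[t0 t1] := orbit_mean01 d0 mu0 th y tphi.
  have s0 := sin_w_ge0 th; have sg0 := mulr_ge0 s0 (g0 (cos th)).
  rewrite /= lee_fin (ger0_norm (mulr_ge0 sg0 t0)) (ger0_norm (mulr_ge0 s0 M0)).
  rewrite (le_trans (ler_piMr sg0 t1))//.
  exact: ler_wpM2l.
transitivity (b * \int[leb]_th \int[lebV]_y h th y); last first.
  congr (_ * _); apply: eq_Rintegral => th _.
  by rewrite (RintegralZl _ measurableT (iq_orbit_mean th)).
rewrite (@Rfubini _ _ _ _ R leb lebV h mh bnd).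
have [a0 _] := a_constE d0 mu0; have [c0 _] := c_constE mu0.
have [b0 _] := @b_constE R d mu mu0.
have ac0 : 0 < a * c by rewrite mulr_gt0.
have mi1 : measurable_fun setT (fun y => \int[leb]_th h th y).
  exact: measurable_Rintegral2 mh bnd.
have mi2 : measurable_fun setT
   (fun y => q y * \int[lebV]_x (ball_w x * phi x * conv_kernel g y x)).
  apply: measurable_funM => //.
  apply: (measurableT_comp (fine_measurable measurableT)).
  pose k (z : 'rV[R]_d * 'rV[R]_d) := (ball_w z.2 * phi z.2 * conv_kernel g z.1 z.2)%:E.
  apply: (@measurable_fun_fubini_tonelli_F _ _ _ _ _ lebV k); last first.
    move=> z; have /andP[k0 k1] := conv_kernel_bounds mu0 z.1 z.2 gM.
    by rewrite lee_fin !mulr_ge0 ?ball_w_ge0.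
  apply/measurable_EFinP; apply: measurable_funM; last exact: measurable_conv_kernel gM.
  apply: measurable_funM; last exact: (measurableT_comp mphi measurable_snd).
  exact: (measurableT_comp (@measurable_ball_w R d mu) measurable_snd).
rewrite -(RintegralZ_gt0 _ ac0 mi2) -(RintegralZ_gt0 _ b0 mi1).
apply: eq_Rintegral => y _.
have [y1|y1] := ltP (dotrV y y) 1; last first.
  rewrite q_out// mul0r mulr0 (_ : (fun th => h th y) = cst 0).
    by rewrite Rintegral_cst// mul0r mulr0.
  by apply/funext => th; rewrite /h q_out// mul0r mulr0.
rewrite mulrCA -(orbit_mean_average d0 mu0 gM tphi y1) mulrCA; congr (_ * _).
rewrite -(RintegralZl _ measurableT (isg y)); apply: eq_Rintegral => th _.
by rewrite /h mulrCA.
Qed.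

End symmetric.
End symmetric_average.

(** * The translation paired with a test function *)

Section translation.
Context {R : realType} {d : nat} (mu : R).
Hypotheses (d0 : (0 < d)%N) (mu0 : 0 < mu).
Local Notation leb := (@lebesgue_measure R).
Local Notation lebV := (lebesgue_rV R d).
Local Notation a := (@a_const R d mu).
Local Notation c := (c_const mu).
Local Notation b := (b_const (mu + (d%:R - 1) / 2)).
Local Notation ball_w := (@ball_w R d mu).
Local Notation sin_w := (@sin_w R d mu).
Local Notation weighted := (@weighted R d mu).
Local Notation conv_kernel := (@conv_kernel R d mu).
Implicit Types (x y u : 'rV[R]_d) (th r : R) (phi q h : 'rV[R]_d -> R) (g : R -> R).
Variables (f : 'rV[R]_d -> R) (F : R -> 'rV[R]_d -> R).
Hypotheses (fL1 : L1_ball mu f) (trF : translation_of mu f F).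

Definition pairing phi th := \int[lebV]_x (weighted (F th) x * phi x).

Let FL1 th : 0 <= th <= pi -> L1_ball mu (F th).
Proof. by case: trF => _ + _ _; apply. Qed.

Let Q th x : R := if 0 <= th <= pi then weighted (F th) x else 0.

Let measurable_Q :
  measurable_fun setT (fun z : measurableTypeR R * 'rV[R]_d => Q z.1 z.2).
Proof.
case: trF => mF _ _ _.
pose D : set (measurableTypeR R * 'rV[R]_d) :=
  (`[0, pi]%classic : set R) `*` [set x | dotrV x x < 1].
have mD : measurable D by apply: measurableX => //; exact: measurable_oball.
have -> : (fun z : measurableTypeR R * 'rV[R]_d => Q z.1 z.2) =
    (fun z => ((fun p : measurableTypeR R * 'rV[R]_d => F p.1 p.2) \_ D) z * ball_w z.2).
  apply/funext => -[th x] /=; rewrite /Q patchE.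
  have [thi|thi] := boolP (0 <= th <= pi); last first.
    by rewrite memNset ?mul0r//= => -[] /=; rewrite in_itv/= (negbTE thi).
  rewrite /weighted; have [x1|x1] := boolP (dotrV x x < 1).
    by rewrite mem_set//; split => //=; rewrite in_itv.
  by rewrite memNset ?mul0r//= => -[_] /=; exact/negP.
apply: measurable_funM; last first.
  exact: (measurableT_comp (@measurable_ball_w R d mu) measurable_snd).
apply/(measurable_restrictT _ mD); apply: measurable_funS mF.
  by apply: measurableX => //; exact: measurable_eball.
by move=> [th x] [/= thi x1]; split => //=; rewrite eballE ltW.
Qed.

Let continuous_of_dist (N : R -> R) :
  (forall th th0, 0 <= th <= pi -> 0 <= th0 <= pi ->
     `|N th - N th0| <= L1_dist mu (F th) (F th0)) ->
  {within `[0, pi], continuous N}.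
Proof.
move=> NF; apply/subspace_continuousP => th0; rewrite /= in_itv/= => th0i.
case: trF => _ _ cF _; have := cF th0 th0i => c0.
apply/cvgrPdist_le => e e0.
have /cvgrPdist_le/(_ e e0) := c0.
rewrite !near_withinE; apply: filterS => th H thi.
have := H thi; rewrite sub0r normrN => H'.
have thi' : 0 <= th <= pi by move: thi; rewrite /= in_itv.
rewrite distrC (le_trans (NF _ _ thi' th0i))// (le_trans _ H')// ler_norm//.
Qed.

(** The pairing is 1-Lipschitz for the L1 distance, in which the translation is
    continuous. *)
Lemma continuous_pairing phi : test01 phi -> {within `[0, pi], continuous (pairing phi)}.
Proof.
move=> tphi; apply: continuous_of_dist => th th0 thi th0i.
by apply: pairing_dist => //; exact: FL1.
Qed.

Let norm_bound : exists C, forall th, 0 <= th <= pi ->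
  (\int[lebV]_x `|weighted (F th) x|%:E <= C%:E)%E.
Proof.
have cN : {within `[0, pi], continuous (fun th => \int[lebV]_x `|weighted (F th) x|)}.
  apply: continuous_of_dist => th th0 thi th0i.
  by apply: norm_dist => //; exact: FL1.
have [th1 _ H] := EVT_max (pi_ge0 R) cN.
exists (\int[lebV]_x `|weighted (F th1) x|) => th thi.
have ic := integrable_weighted d0 (FL1 thi).
rewrite -[leLHS]fineK; last first.
  apply: (integrable_fin_num measurableT).
  exact: (integrable_norm ic).
by rewrite lee_fin; apply: H; rewrite in_itv.
Qed.

(** The defining identity of the translation, which holds for almost every x, is
    multiplied by phi and integrated; exchanging x and th is licit because the
    L1 norm of the translation is continuous, hence bounded, on [0, pi]. *)
Lemma translation_average phi g M : test01 phi -> bounded_ge0 g M ->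
  {within `[-1, 1], continuous g} ->
  b * \int[leb]_th (sin_w th * g (cos th) * pairing phi th) =
  a * c * \int[lebV]_x (ball_w x * phi x * \int[lebV]_y (weighted f y * conv_kernel g x y)).
Proof.
move=> tphi gM cg.
have [mg gle] := gM; have [mphi phi01] := tphi.
have g0 r : 0 <= g r by have /andP[] := gle r.
have phi0 x : 0 <= phi x by have /andP[] := phi01 x.
have [a0 _] := a_constE d0 mu0; have [c0 _] := c_constE mu0.
have [b0 _] := @b_constE R d mu mu0.
have ac0 : 0 < a * c by rewrite mulr_gt0.
have mcg : measurable_fun setT (fun th : R => g (cos th)).
  apply: (measurableT_comp mg).
  by apply: continuous_measurable_fun; exact: continuous_cos.
have msg : measurable_fun setT (fun th : R => sin_w th * g (cos th)).
  by apply: measurable_funM => //; exact: measurable_sin_w.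
pose h th x := sin_w th * g (cos th) * (Q th x * phi x).
have mh : measurable_fun setT (fun z : measurableTypeR R * 'rV[R]_d => h z.1 z.2).
  apply: measurable_funM; first exact: (measurableT_comp msg measurable_fst).
  apply: measurable_funM; first exact: measurable_Q.
  exact: (measurableT_comp mphi measurable_snd).
have bnd : (\int[leb]_th \int[lebV]_x `|h th x|%:E < +oo)%E.
  have [C HC] := norm_bound.
  have M0 : 0 <= M by have /andP[+ +] := gle 0; exact: le_trans.
  have C0 : 0 <= C.
    rewrite -lee_fin (le_trans _ (HC 0 _)) ?lexx ?pi_ge0//.
    by apply: integral_ge0 => x _; rewrite lee_fin.
  have iM := integrableZr measurableT (M * C) (@integrable_sin_w R d mu d0 mu0).
  have mhe : measurable_fun setT (fun z : measurableTypeR R * 'rV[R]_d => `|h z.1 z.2|%:E).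
    by apply/measurable_EFinP; exact: measurableT_comp.
  apply: (@le_lt_trans _ _ (\int[leb]_th ((sin_w th)%:E * (M * C)%:E))%E); last first.
    have /integrableP[_] := iM; congr (_ < +oo)%E; apply: eq_integral => th _.
    by rewrite -EFinM gee0_abs// lee_fin; apply: mulr_ge0; [exact: sin_w_ge0|exact: mulr_ge0].
  apply: ge0_le_integral => //.
  - by move=> th _; apply: integral_ge0 => x _; rewrite lee_fin.
  - by apply: (measurable_fun_fubini_tonelli_F _ mhe) => z; rewrite lee_fin.
  - by case/integrableP: iM.
  move=> th _; have s0 := @sin_w_ge0 R d mu th; have sg0 := mulr_ge0 s0 (g0 (cos th)).
  have sM0 : 0 <= sin_w th * M by exact: mulr_ge0.
  have [thi|thi] := boolP (0 <= th <= pi); last first.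
    rewrite integral0_eq; first by rewrite -EFinM lee_fin mulrA; exact: mulr_ge0.
    by move=> x _; rewrite /h /Q (negbTE thi) mul0r mulr0 normr0.
  rewrite [leRHS](_ : _ = ((sin_w th * M)%:E * C%:E)%E); last by rewrite -!EFinM mulrA.
  apply: (@le_trans _ _ ((sin_w th * M)%:E * \int[lebV]_x `|weighted (F th) x|%:E)%E); last first.
    by apply: lee_wpmul2l; [rewrite lee_fin|exact: HC].
  have mQ : measurable_fun setT (fun x => `|weighted (F th) x|%:E).
    apply/measurable_EFinP; apply: measurableT_comp => //.
    by apply: measurable_weighted; case: (FL1 thi).
  rewrite -ge0_integralZl//.
  apply: ge0_le_integral => //.
  - exact: (measurableT_comp mhe (pair1_measurable (th : measurableTypeR R))).
  - exact: emeasurable_funM.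
  move=> x _; rewrite -EFinM lee_fin /h /Q thi normrM (ger0_norm sg0) normrM.
  apply: ler_pM => //; first by apply: ler_wpM2l => //; have /andP[] := gle (cos th).
  rewrite (ger0_norm (phi0 x)) ler_piMr//.
  by have /andP[] := phi01 x.
have ipair th : 0 <= th <= pi -> lebV.-integrable setT (fun x => (weighted (F th) x * phi x)%:E).
  by move=> thi; exact: integrable_mul01 (integrable_weighted d0 (FL1 thi)) mphi phi01.
transitivity (b * \int[leb]_th \int[lebV]_x h th x).
  congr (_ * _); apply: eq_Rintegral => th _.
  have [thi|thi] := boolP (0 <= th <= pi).
    rewrite /pairing -(RintegralZl _ measurableT (ipair th thi)).
    by apply: eq_Rintegral => x _; rewrite /h /Q thi.
  have s0 : sin_w th = 0.
    rewrite /sin_w indicE memNset ?mulr0//= in_itv/=; exact/negP.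
  rewrite s0 !mul0r; apply/esym; rewrite (_ : (fun x => _) = cst 0).
    by rewrite Rintegral_cst// mul0r.
  by apply/funext => x; rewrite /h s0 !mul0r.
rewrite (Rfubini mh bnd).
have mi1 := measurable_Rintegral2 mh bnd.
have mi2 := measurable_conv d0 mu0 tphi gM (integrable_weighted d0 fL1).
rewrite -(RintegralZ_gt0 _ b0 mi1) -(RintegralZ_gt0 _ ac0 mi2).
rewrite {1}/Rintegral [in RHS]/Rintegral; congr fine; apply: ae_eq_integral => //.
- by apply/measurable_EFinP; exact: measurable_funM.
- by apply/measurable_EFinP; exact: measurable_funM.
case: trF => _ _ _ /(_ g cg); apply: filterS => x conv _; congr EFin.
have [x1|x1] := ltP (dotrV x x) 1; last first.
  rewrite ball_w_out// !mul0r mulr0 (_ : (fun th => h th x) = cst 0).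
    by rewrite Rintegral_cst// mul0r mulr0.
  apply/funext => th; rewrite /h /Q /weighted ltNge x1 /=.
  by case: ifP => _; rewrite mul0r mulr0.
have w0 := ball_w_gt0 mu x1.
have {}conv := conv (_ : eball x); rewrite eballE in conv.
have {}conv := conv (ltW x1).
(* The constant taken out of the integral next has to be positive. *)
have [p0|pn] := eqVneq (phi x) 0.
  rewrite p0 mulr0 mul0r mulr0 (_ : (fun th => h th x) = cst 0).
    by rewrite Rintegral_cst// mul0r mulr0.
  by apply/funext => th; rewrite /h p0 !mulr0.
have pp : 0 < phi x by rewrite lt_neqAle eq_sym pn phi0.
have wp0 : 0 < ball_w x * phi x by rewrite mulr_gt0.
rewrite mulrCA -(ball_convE d0 mu0 x gM fL1) -conv mulrCA; congr (_ * _).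
pose k (th : measurableTypeR R) : R := sin_w th * g (cos th) * (Q th x / ball_w x).
have mk : measurable_fun setT k.
  apply: measurable_funM => //; apply: measurable_funM => //.
  exact: (measurableT_comp measurable_Q (pair2_measurable x)).
transitivity (\int[leb]_th (ball_w x * phi x * k th)).
  apply: eq_Rintegral => th _; rewrite /h /k.
  by field; rewrite lt0r_neq0.
rewrite (RintegralZ_gt0 _ wp0 mk); congr (_ * _).
rewrite [RHS]Rintegral_mkcond; apply: eq_Rintegral => th _; rewrite patchE /k /sin_w indicE /Q.
case: (boolP (th \in _)) => [|_]; last by rewrite mulr0 !mul0r.
rewrite inE/= in_itv/= => thi; rewrite thi mulr1 /weighted x1.
by field; rewrite lt0r_neq0.
Qed.

End translation.

(** * Continuous functions of the angle are determined by their averages *)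

Section cosine_tests.
Context {R : realType} {d : nat} (mu : R).
Hypotheses (d0 : (0 < d)%N) (mu0 : 0 < mu).
Local Notation leb := (@lebesgue_measure R).
Local Notation sin_w := (@sin_w R d mu).
Implicit Types (dl N P : R -> R).

Lemma within_continuous_acos : {within `[-1, 1], continuous (@acos R)}.
Proof.
have := @segment_can_ge_continuous R 0 pi cos acos (pi_ge0 R) _ (@cosK R).
by rewrite cospi cos0; apply; apply: continuous_subspaceT; exact: continuous_cos.
Qed.

(** A nonzero value would persist on an interval, which has positive measure. *)
Lemma within_eq0_of_ae0 P : {within `[0, pi], continuous P} ->
  {ae leb, forall th, 0 < th < pi -> P th = 0} ->
  forall th, 0 <= th <= pi -> P th = 0.
Proof.
move=> cP [Z [mZ Z0 subZ]] th thi; apply/eqP/negPn/negP => Pn0.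
have /subspace_continuousP/(_ th) := cP.
rewrite /= in_itv/= => /(_ thi) /cvgrPdist_lt /(_ `|P th|).
rewrite normr_gt0 => /(_ Pn0); rewrite near_withinE => /nbhs_ballP[e /= e0 H].
pose l := Order.max 0 (th - e); pose r := Order.min pi (th + e).
have /andP[th0 thpi] := thi.
have lr : l < r.
  rewrite lt_min !gt_max pi_gt0 /=; apply/andP; split.
    by rewrite (lt_le_trans _ thpi)// gtrBl.
  by apply/andP; split; [rewrite ltr_wpDl|lra].
have sub : (`]l, r[%classic : set R) `<=` Z.
  move=> t; rewrite /= in_itv/= gt_max lt_min => /andP[/andP[t0 t1] /andP[t2 t3]].
  apply: subZ => /= Pt.
  have t03 : 0 < t < pi by rewrite t0 t2.
  have bt : ball th e t by rewrite /ball/= ltr_distlC; apply/andP; split; lra.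
  have ti : (`[0, pi]%classic : set R) t by rewrite /= in_itv/= !ltW.
  by have := H t bt ti; rewrite /from_subspace (Pt t03) subr0 ltxx.
have : (leb (`]l, r[%classic : set R) <= leb Z)%E by apply: le_measure; rewrite ?inE.
rewrite Z0 lebesgue_measure_itv/= lte_fin lr -EFinB lee_fin.
by rewrite leNgt subr_gt0 lr.
Qed.

(** The test g r = max (dl (arccos r)) 0 makes the integrand
    sin_w th * (max (dl th) 0)^2, which is nonnegative and has integral 0. *)
Lemma cosine_tests_separate dl : {within `[0, pi], continuous dl} ->
  (forall g M, bounded_ge0 g M -> {within `[-1, 1], continuous g} ->
     \int[leb]_th (sin_w th * g (cos th) * dl th) = 0) ->
  forall th, 0 <= th <= pi -> dl th <= 0.
Proof.
move=> cdl H.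
pose P th := Order.max (dl th) 0.
have P0 th : 0 <= P th by rewrite le_max lexx orbT.
have cP : {within `[0, pi], continuous P}.
  move=> th; apply: (@continuous_max _ _ _ (cst 0)); first exact: cdl.
  exact: cst_continuous.
suff PE th : 0 <= th <= pi -> P th = 0.
  by move=> th thi; rewrite -(PE th thi) le_max lexx.
move: th; apply: within_eq0_of_ae0 => //.
have [th1 _ Pmax] := EVT_max (pi_ge0 R) cP.
pose g (r : R) : R := if -1 <= r <= 1 then P (acos r) else 0.
have acosi (r : R) : -1 <= r <= 1 -> 0 <= acos r <= pi.
  by move=> r1; rewrite acos_ge0 ?acos_lepi.
have gE (th : R) : 0 <= th <= pi -> g (cos th) = P th.
  by move=> thi; rewrite /g cos_geN1 cos_le1/= cosK// in_itv.
have cg : {within `[-1, 1], continuous g}.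
  have cPa : {within `[-1, 1], continuous (P \o acos)}.
    apply/subspace_continuousP => r r1.
    have ri : -1 <= r <= 1 by move: r1; rewrite /= in_itv.
    move/subspace_continuousP : cP => /(_ (acos r)); rewrite /= in_itv/= => /(_ (acosi (r : R) ri)) cPr.
    have /subspace_continuousP/(_ r r1) car := within_continuous_acos.
    have aW : acos t @[t --> within `[-1, 1] (nbhs r)] --> within `[0, pi] (nbhs (acos r)).
      move=> U nU; have nV := car _ nU.
      rewrite /= /nbhs/= /within/= in nV *.
      by apply: filterS nV => t h t1; apply: h => //; rewrite in_itv/= acosi//; move: t1; rewrite /= in_itv.
    exact: (cvg_comp _ _ aW cPr).
  apply: (subspace_eq_continuous _ cPa) => r; rewrite inE/= in_itv/= => r1.
  by rewrite /from_subspace /g/=; case: ifPn => //; rewrite r1.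
have gM : bounded_ge0 g (P th1).
  split; last first.
    move=> r; rewrite /g; case: ifPn => [r1|_]; last by rewrite lexx P0.
    by rewrite P0 Pmax// in_itv; exact: acosi.
  have -> : g = g \_ `[-1, 1].
    apply/funext => r; rewrite patchE; case: ifPn => // /negP rN.
    by rewrite /g ifF//; apply/negP => r1; apply: rN; rewrite inE/= in_itv.
  apply/(measurable_restrictT _ (measurable_itv _)).
  exact: subspace_continuous_measurable_fun.
have H0 := H g _ gM cg.
pose K th := sin_w th * g (cos th) * dl th.
have KE th : K th = sin_w th * (P \_ `[0, pi]) th ^+ 2.
  rewrite /K patchE; case: ifPn => [|thN]; last first.
    by rewrite /sin_w indicE (negbTE thN) mulr0 !mul0r.
  rewrite inE/= in_itv/= => thi; rewrite gE// -mulrA; congr (_ * _).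
  by rewrite /P; case: leP => _; rewrite expr2 ?mul0r.
have mP : measurable_fun setT (P \_ `[0, pi]).
  apply/(measurable_restrictT _ (measurable_itv _)).
  exact: subspace_continuous_measurable_fun.
have mK : measurable_fun setT K.
  rewrite (funext KE); apply: measurable_funM; last exact: measurable_funX.
  exact: measurable_sin_w.
have K0 th : 0 <= K th by rewrite KE mulr_ge0 ?sqr_ge0 ?sin_w_ge0.
have K1 th : K th <= sin_w th * P th1 ^+ 2.
  rewrite KE ler_wpM2l ?sin_w_ge0// ler_sqr ?nnegrE//.
    rewrite patchE; case: ifPn => // ; rewrite inE => thi; exact: Pmax.
  by rewrite patchE; case: ifPn.
have iK : leb.-integrable setT (EFin \o K).
  have iM := integrableZr measurableT (P th1 ^+ 2) (@integrable_sin_w R d mu d0 mu0).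
  apply: le_integrable iM => //; first exact/measurable_EFinP.
  by move=> th _; rewrite /= lee_fin ger0_norm// (le_trans (K1 th))// ler_norm.
have intK : (\int[leb]_th `|(K th)%:E| = 0)%E.
  transitivity ((\int[leb]_th K th)%:E)%E; last by rewrite H0.
  rewrite /Rintegral fineK; last exact: integrable_fin_num.
  by apply: eq_integral => th _; rewrite gee0_abs// lee_fin.
have mKE : measurable_fun setT (EFin \o K) by exact/measurable_EFinP.
have /(ae_eq_integral_abs leb measurableT mKE) := intK.
apply: filterS => th Kth /andP[t0 tpi].
have := Kth Logic.I; rewrite /= KE => -[] /eqP.
have thi : 0 <= th <= pi by rewrite !ltW.
rewrite patchE mem_set/=; last by rewrite in_itv.
rewrite mulf_eq0 => /orP[|]; last by rewrite sqrf_eq0 => /eqP.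
rewrite /sin_w indicE mem_set/=; last by rewrite in_itv.
by rewrite mulr1 gt_eqF// powR_gt0// sin_gt0_pi// t0.
Qed.

End cosine_tests.

Section duality.
Context {R : realType} {d : nat} (mu : R).
Hypotheses (d0 : (0 < d)%N) (mu0 : 0 < mu).
Local Notation leb := (@lebesgue_measure R).
Local Notation lebV := (lebesgue_rV R d).
Local Notation b := (b_const (mu + (d%:R - 1) / 2)).
Local Notation sin_w := (@sin_w R d mu).
Local Notation orbit_mean := (@orbit_mean R d mu).
Local Notation weighted := (@weighted R d mu).
Implicit Types (phi : 'rV[R]_d -> R) (g N : R -> R).

Lemma integrable_cosine_test g M N : bounded_ge0 g M ->
  {within `[0, pi], continuous N} ->
  leb.-integrable setT (fun th => (sin_w th * g (cos th) * N th)%:E).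
Proof.
move=> gM cN; have [mg gle] := gM.
have cNn : {within `[0, pi], continuous (fun th : R => `|N th|)}.
  by move=> th; apply: continuous_comp; [exact: cN|exact: norm_continuous].
have [th1 _ Nmax] := EVT_max (pi_ge0 R) cNn.
pose N0 : R -> R := N \_ `[0, pi].
have NE (th : R) : sin_w th * g (cos th) * N th = sin_w th * g (cos th) * N0 th.
  rewrite /N0 patchE; case: ifPn => // thN.
  by rewrite /sin_w indicE (negbTE thN) mulr0 !mul0r.
have mN0 : measurable_fun setT N0.
  apply/(measurable_restrictT _ (measurable_itv _)).
  exact: subspace_continuous_measurable_fun.
have N0le (th : R) : `|N0 th| <= `|N th1|.
  rewrite /N0 patchE; case: ifPn => [|_]; last by rewrite normr0.
  by rewrite inE => thi; exact: Nmax.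
have mcg : measurable_fun setT (fun th : R => g (cos th)).
  apply: (measurableT_comp mg).
  by apply: continuous_measurable_fun; exact: continuous_cos.
have iM := integrableZr measurableT (M * `|N th1|) (@integrable_sin_w R d mu d0 mu0).
apply: le_integrable iM => //.
  apply/measurable_EFinP; rewrite (funext NE).
  apply: measurable_funM => //; apply: measurable_funM => //.
  exact: measurable_sin_w.
move=> th _; rewrite /= lee_fin NE.
have s0 := @sin_w_ge0 R d mu th; have /andP[g0 g1] := gle (cos th).
rewrite -mulrA normrM [leRHS]normrM; apply: ler_wpM2l => //.
rewrite normrM [leRHS]normrM (ger0_norm g0) normr_id.
by apply: ler_pM => //; rewrite (le_trans g1)// ler_norm.
Qed.

Section pairing_dual.
Variables (f : 'rV[R]_d -> R) (F : R -> 'rV[R]_d -> R).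
Hypotheses (fL1 : L1_ball mu f) (trF : translation_of mu f F).

(** Both sides are continuous in th and have the same averages against functions
    of cos th, so [cosine_tests_separate] applies to their difference and to
    its opposite.  The identity holds at each th, without exceptional set. *)
Lemma pairing_dual phi : test01 phi -> orbit_continuous phi ->
  forall th : R, 0 <= th <= pi ->
  pairing mu F phi th = \int[lebV]_x (weighted f x * orbit_mean phi th x).
Proof.
move=> tphi cphi.
pose D (th : R) : R := \int[lebV]_x (weighted f x * orbit_mean phi th x).
pose N := pairing mu F phi.
have cN : {within `[0, pi], continuous N} by exact: (continuous_pairing d0 trF tphi).
have iw := integrable_weighted d0 fL1.
have cD : {within `[0, pi], continuous D}.
  by apply: continuous_subspaceT; exact: (continuous_integral_orbit_mean d0 mu0 tphi cphi iw).
have [b0 _] := @b_constE R d mu mu0.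
have key g M : bounded_ge0 g M -> {within `[-1, 1], continuous g} ->
    \int[leb]_th (sin_w th * g (cos th) * N th) =
    \int[leb]_th (sin_w th * g (cos th) * D th).
  move=> gM cg; apply: (mulfI (lt0r_neq0 b0)).
  rewrite (translation_average d0 mu0 fL1 trF tphi gM cg).
  apply: (average_symmetric d0 mu0 tphi gM iw) => x x1.
  by rewrite /weighted ltNge x1.
have le0 (N1 D1 : R -> R) : {within `[0, pi], continuous N1} ->
    {within `[0, pi], continuous D1} ->
    (forall g M, bounded_ge0 g M -> {within `[-1, 1], continuous g} ->
    \int[leb]_th (sin_w th * g (cos th) * N1 th) =
    \int[leb]_th (sin_w th * g (cos th) * D1 th)) ->
    forall th : R, 0 <= th <= pi -> N1 th - D1 th <= 0.
  move=> cN1 cD1 ND; apply: (@cosine_tests_separate R d mu d0 mu0 (fun th => N1 th - D1 th)).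
    by move=> th; apply: cvgB; [exact: cN1|exact: cD1].
  move=> g M gM cg.
  transitivity (\int[leb]_th (sin_w th * g (cos th) * N1 th - sin_w th * g (cos th) * D1 th)).
    by apply: eq_Rintegral => th _; rewrite mulrBr.
  rewrite RintegralB//; first by rewrite (ND g M gM cg) subrr.
    exact: integrable_cosine_test gM cN1.
  exact: integrable_cosine_test gM cD1.
move=> th thi; apply/eqP; rewrite eq_le -subr_le0 -[X in _ && X]subr_le0.
rewrite (le0 N D cN cD key th thi) (le0 D N cD cN _ th thi)// => g M gM cg.
by rewrite (key g M gM cg).
Qed.

End pairing_dual.
End duality.

(** * Test functions determine integrable functions *)

Section octants.
Context {R : realType} {n : nat}.
Implicit Types (a v : 'rV[R]_n).

(** These sets form a pi-system that generates the measurable sets, and their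
    indicators are limits of test functions. *)
Definition octant a : set 'rV[R]_n := [set v | forall i, a ord0 i < v ord0 i].

Lemma measurable_octant a : measurable (octant a).
Proof.
rewrite (_ : octant a = \bigcap_(i in [set: 'I_n])
    (rV_coord i @^-1` `]a ord0 i, +oo[%classic)).
  apply: fin_bigcap_measurable => // i _.
  by rewrite -[X in measurable X]setTI; exact: measurable_rV_coord.
apply/seteqP; split => v /= av i.
  by move=> _; rewrite /= in_itv/= andbT; exact: av.
by have := av i Logic.I; rewrite /rV_coord/= in_itv/= andbT.
Qed.

Lemma octantI : setI_closed (range octant).
Proof.
move=> _ _ [a _ <-] [b _ <-].
exists (\row_i Num.max (a ord0 i) (b ord0 i)) => //.
apply/seteqP; split => v /=.
  by move=> abv; split => i; have := abv i; rewrite mxE gt_max => /andP[].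
by move=> [av bv] i; rewrite mxE gt_max av bv.
Qed.

Lemma octant_cover v : exists k0 : nat, forall k : nat, (k0 <= k)%N ->
  forall i, - k%:R < v ord0 i.
Proof.
exists (Num.truncn (\sum_i `|v ord0 i|)).+1 => k k0 i.
rewrite ltrNl (le_lt_trans (ler_norm _))// normrN.
have vs : `|v ord0 i| <= \sum_i `|v ord0 i|.
  by rewrite (bigD1 i)//= lerDl sumr_ge0.
rewrite (le_lt_trans vs)// (lt_le_trans (truncnS_gt _))// ler_nat//.
Qed.

Lemma measurable_rV_octants : @measurable _ 'rV[R]_n = <<s range octant >>.
Proof.
apply/seteqP; split; last first.
  apply: smallest_sub; first exact: sigma_algebra_measurable.
  by move=> _ [a _ <-]; exact: measurable_octant.
apply: smallest_sub; first exact: smallest_sigma_algebra.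
move=> A; rewrite -bigcup_seq => -[i _ [B mB <-]] /=; rewrite setTI.
pose S := <<s range octant >>.
have sS : sigma_algebra setT S by exact: smallest_sigma_algebra.
suff : (@RGenOInfty.G R).-sigma.-measurable `<=` [set B : set R | S (rV_coord i @^-1` B)].
  by apply; rewrite -RGenOInfty.measurableE.
have [S0 SC SU] := sS.
apply: smallest_sub.
  split => /=.
  - by rewrite preimage_set0.
  - by move=> X SX; rewrite !setTD preimage_setC -setTD; exact: SC.
  - by move=> X SX; rewrite preimage_bigcup; exact: SU.
move=> _ [r ->] /=.
(* A half-space is an increasing union of octants. *)
pose a k : 'rV[R]_n := \row_j (if j == i then r else - k%:R).
rewrite (_ : _ @^-1` _ = \bigcup_k octant (a k)).
  by apply: SU => k; apply: sub_sigma_algebra; exists (a k).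
apply/seteqP; split => v /=; rewrite /rV_coord /= in_itv/= andbT.
  move=> rv; have [k vk] := octant_cover v.
  by exists k => // j; rewrite mxE; case: eqP => [->//|_]; exact: vk.
by move=> [k _ /(_ i)]; rewrite mxE eqxx.
Qed.

(** The positive and the negative part of h are densities of two finite measures
    that agree on octants, hence on all measurable sets. *)
Lemma octants_separate (h : 'rV[R]_n -> R) :
  (lebesgue_rV R n).-integrable setT (EFin \o h) ->
  (forall a, \int[lebesgue_rV R n]_(v in octant a) (h v)%:E = 0)%E ->
  {ae lebesgue_rV R n, forall v, h v = 0}.
Proof.
move=> ih h0; set m := lebesgue_rV R n.
have mh : measurable_fun setT h by apply/measurable_EFinP; exact: measurable_int ih.
have mp : measurable_fun setT h^\+ by apply: measurable_maxr.
have mn : measurable_fun setT h^\- by apply: measurable_maxr => //; exact: measurable_funN.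
have hp0 v : 0 <= h^\+ v by exact: funrpos_ge0.
have hn0 v : 0 <= h^\- v by exact: funrneg_ge0.
have ip : m.-integrable setT (EFin \o h^\+).
  apply: le_integrable ih => //; first exact/measurable_EFinP.
  move=> v _; rewrite /= lee_fin ger0_norm// /funrpos ge_max ler_norm.
  exact: normr_ge0.
have iN : m.-integrable setT (EFin \o h^\-).
  apply: le_integrable ih => //; first exact/measurable_EFinP.
  move=> v _; rewrite /= lee_fin ger0_norm// /funrneg ge_max -normrN ler_norm.
  exact: normr_ge0.
have hE E : measurable E -> (\int[m]_(v in E) (h v)%:E =
    density m mp hp0 E - density m mn hn0 E)%E.
  move=> mE; rewrite -integralB_EFin//.
  - apply: eq_integral => v _; rewrite -EFinB; congr EFin.
    by rewrite -[in LHS](funrposBneg h).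
  - exact: integrableS ip.
  - exact: integrableS iN.
have fin (g : 'rV[R]_n -> R) (mg : measurable_fun setT g) (g0 : forall v, 0 <= g v) E :
    m.-integrable setT (EFin \o g) -> measurable E -> density m mg g0 E \is a fin_num.
  by move=> ig mE; apply: integrable_fin_num => //; exact: integrableS ig.
have eqG A : range octant A -> density m mp hp0 A = density m mn hn0 A.
  move=> [a _ <-]; have mo := measurable_octant a.
  have := hE _ mo; rewrite h0.
  rewrite -(fineK (fin _ mp hp0 _ ip mo)) -(fineK (fin _ mn hn0 _ iN mo)) -EFinB.
  by move=> [] /esym/eqP; rewrite subr_eq0 => /eqP ->.
have eqA A : measurable A -> density m mp hp0 A = density m mn hn0 A.
  move=> mA; apply: (@measure_unique _ _ _ (range octant)
    (fun k : nat => octant (const_mx (- k%:R)))) => //.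
  - exact: measurable_rV_octants.
  - exact: octantI.
  - apply/seteqP; split => // v _; have [k vk] := octant_cover v.
    by exists k => // i; rewrite mxE; exact: vk.
  - by move=> k; rewrite ltey_eq (fin _ mp hp0 _ ip (measurable_octant _)).
have ae0 : ae_eq m setT (EFin \o h) (cst 0%E).
  apply: integral_ae_eq => // E _ mE.
  by rewrite hE// eqA// integral0 subee// fin.
by apply: filterS ae0 => v hv; have := hv Logic.I; rewrite /= => -[].
Qed.

End octants.

Section octant_tests.
Context {R : realType} {d : nat}.
Local Notation lebV := (lebesgue_rV R d).
Implicit Types (a v x u : 'rV[R]_d).

Definition ramp (t : R) : R := Num.min 1 (Num.max 0 t).

Lemma ramp01 t : 0 <= ramp t <= 1.
Proof. by rewrite /ramp le_min ler01 le_max lexx/= ge_min lexx. Qed.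

Lemma ramp_le0 t : t <= 0 -> ramp t = 0.
Proof. by move=> t0; rewrite /ramp (max_idPl t0) (min_idPr ler01). Qed.

Lemma ramp_ge1 t : 1 <= t -> ramp t = 1.
Proof.
move=> t1; rewrite /ramp; apply/min_idPl.
by rewrite le_max t1 orbT.
Qed.

Lemma continuous_ramp : continuous ramp.
Proof.
move=> t; apply: (@continuous_min R R (cst 1) (fun s => Num.max 0 s)).
  exact: cst_continuous.
by apply: (@continuous_max R R (cst 0) id); [exact: cst_continuous|exact: cvg_id].
Qed.

(** Continuous approximation of the indicator of an octant; at each point it
    stabilizes for k large. *)
Definition octant_test (k : nat) a v : R := \prod_(i < d) ramp (k%:R * (v ord0 i - a ord0 i)).

Lemma test01_octant_test k a : test01 (octant_test k a).
Proof.
split.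
  apply: measurable_prod => i _; apply: measurableT_comp.
    by apply: continuous_measurable_fun; exact: continuous_ramp.
  apply: measurable_funM => //; apply: measurable_funB => //.
  exact: (measurable_rV_coord i).
move=> v; apply/andP; split.
  by apply: prodr_ge0 => i _; have /andP[] := ramp01 (k%:R * (v ord0 i - a ord0 i)).
by apply: prodr_ile1 => i _; exact: ramp01.
Qed.

Lemma orbit_continuous_octant_test k a : orbit_continuous (octant_test k a).
Proof.
move=> x u; rewrite /octant_test; elim: (index_enum _) => [|i s IHs].
  rewrite (_ : (fun th => _) = cst 1); first exact: cst_continuous.
  by apply/funext => th; rewrite big_nil.
pose F i (th : R) : R := ramp (k%:R * (orbit_pt th x u ord0 i - a ord0 i)).
rewrite (_ : (fun th => _) = (fun th => F i th * \prod_(j <- s) F j th)); last first.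
  by apply/funext => th; rewrite big_cons.
move=> th; apply: cvgM; last exact: IHs.
rewrite (_ : F i = ramp \o (fun th : R => k%:R *
    (cos th * x ord0 i + sin th * (height x * u ord0 i) - a ord0 i))); last first.
  by apply/funext => t; rewrite /F /orbit_pt !mxE /= mulrA.
apply: continuous_comp; last exact: continuous_ramp.
apply: cvgM; first exact: cvg_cst.
apply: cvgB; last exact: cvg_cst.
by apply: cvgD; apply: cvgM; try exact: cvg_cst; [exact: continuous_cos|exact: continuous_sin].
Qed.

Lemma octant_test_cvg a v : octant_test k a v @[k --> \oo] --> (\1_(octant a) v : R).
Proof.
rewrite indicE; case: (boolP (v \in octant a)) => [|].
  rewrite inE => av; apply: cvg_near_cst.
  have : \forall k \near \oo, forall i, 1 <= k%:R * (v ord0 i - a ord0 i).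
    apply: filter_forall => i; have av0 : 0 < v ord0 i - a ord0 i by rewrite subr_gt0; exact: av.
    near=> k; rewrite -ler_pdivrMr// mul1r.
    by near: k; exact: nbhs_infty_ger.
  apply: filterS => k kv; rewrite /octant_test big1// => i _.
  exact: ramp_ge1.
rewrite notin_setE => nav; apply: cvg_near_cst; apply: nearW => k.
have [i vi] : exists i, v ord0 i <= a ord0 i.
  apply: contrapT => H; apply: nav => i; rewrite ltNge; apply/negP => vi.
  by apply: H; exists i.
rewrite /octant_test (bigD1 i)//= ramp_le0 ?mul0r//.
by rewrite mulr_ge0_le0// subr_le0.
Unshelve. all: by end_near. Qed.

(** By dominated convergence the difference of the two functions has integral 0
    over octants. *)
Lemma tests_separate (h1 h2 : 'rV[R]_d -> R) :
  lebV.-integrable setT (EFin \o h1) -> lebV.-integrable setT (EFin \o h2) ->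
  (forall phi, test01 phi -> orbit_continuous phi ->
     \int[lebV]_v (h1 v * phi v) = \int[lebV]_v (h2 v * phi v)) ->
  {ae lebV, forall v, h1 v = h2 v}.
Proof.
move=> ih1 ih2 H12; pose h v := h1 v - h2 v.
have ih : lebV.-integrable setT (EFin \o h) by exact: integrableB ih1 ih2.
have H phi : test01 phi -> orbit_continuous phi -> \int[lebV]_v (h v * phi v) = 0.
  move=> tphi cphi; have [mphi phi01] := tphi.
  transitivity (\int[lebV]_v (h1 v * phi v - h2 v * phi v)).
    by apply: eq_Rintegral => v _; rewrite mulrBl.
  rewrite (RintegralB measurableT (integrable_mul01 ih1 mphi phi01)
    (integrable_mul01 ih2 mphi phi01)).
  by rewrite H12// subrr.
suff : {ae lebV, forall v, h v = 0}.
  by apply: filterS => v /eqP; rewrite subr_eq0 => /eqP.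
apply: octants_separate => // a.
have mh : measurable_fun setT h by apply/measurable_EFinP; exact: measurable_int ih.
pose hk k v := (h v * octant_test k a v)%:E.
have hkle k v : (`|hk k v| <= `|(h v)%:E|)%E.
  have [_ o01] := test01_octant_test k a; have /andP[t0 t1] := o01 v.
  by rewrite lee_fin normrM (ger0_norm t0) ler_piMr.
have mhk k : measurable_fun setT (hk k).
  apply/measurable_EFinP; apply: measurable_funM => //.
  by have [] := test01_octant_test k a.
have cv : (\int[lebV]_v hk k v @[k --> \oo] -->
    \int[lebV]_v (h v * \1_(octant a) v)%:E)%E.
  apply: (dominated_cvg measurableT mhk _ _ (integrable_abse ih)) => //.
    move=> v _; apply: cvg_EFin; first by apply: nearW.
    by apply: cvgM; [exact: cvg_cst|exact: octant_test_cvg].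
have hk0 k : (\int[lebV]_v hk k v = 0)%E.
  have ihk : lebV.-integrable setT (hk k) by exact: le_integrable ih.
  rewrite -(fineK (integrable_fin_num measurableT ihk)).
  rewrite -[fine _]/(Rintegral _ _ (fun v => h v * octant_test k a v)).
  rewrite H//; first exact: test01_octant_test.
  exact: orbit_continuous_octant_test.
rewrite integral_mkcond; transitivity (\int[lebV]_v (h v * \1_(octant a) v)%:E)%E.
  apply: eq_integral => v _; rewrite patchE indicE.
  by case: (v \in _); rewrite ?mulr1 ?mulr0.
apply/esym/(cvg_unique _ _ cv) => //.
by rewrite (funext hk0); exact: cvg_cst.
Qed.

End octant_tests.

(** * The formula for the translation *)

Section formula.
Context {R : realType} {d : nat} (mu : R).
Hypotheses (d0 : (0 < d)%N) (mu0 : 0 < mu).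
Local Notation lebV := (lebesgue_rV R d).
Local Notation ball_w := (@ball_w R d mu).
Local Notation ell_w := (@ell_w R d mu).
Local Notation orbit_kernel := (@orbit_kernel R d mu).
Local Notation orbit_mean := (@orbit_mean R d mu).
Local Notation weighted := (@weighted R d mu).
Implicit Types (x y u : 'rV[R]_d) (phi : 'rV[R]_d -> R) (th : R).
Variables (f : 'rV[R]_d -> R) (F : R -> 'rV[R]_d -> R).
Hypotheses (fL1 : L1_ball mu f) (trF : translation_of mu f F).

(** Off the closed ball f is not known to be measurable; extended by 0 from the
    open ball it is measurable on the whole space. *)
Definition oball_cut : 'rV[R]_d -> R := f \_ [set x | dotrV x x < 1].
Local Notation f0 := oball_cut.

Lemma oball_cutE x : dotrV x x < 1 -> f0 x = f x.
Proof. by move=> x1; rewrite /f0 patchE mem_set. Qed.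

Lemma oball_cut_out x : 1 <= dotrV x x -> f0 x = 0.
Proof. by move=> x1; rewrite /f0 patchE memNset//=; apply/negP; rewrite -leNgt. Qed.

Lemma measurable_oball_cut : measurable_fun setT f0.
Proof.
apply/(measurable_restrictT _ (@measurable_oball R d)).
apply: measurable_funS (fL1.1); first exact: measurable_eball.
by move=> x /= x1; rewrite eballE ltW.
Qed.

(** [pairing_dual] at th, with the orbit mean written by means of
    [orbit_kernel]: by Fubini and symmetry the kernel acts on f, and the test
    function can be dropped.  Dividing by the weight returns to the variable u. *)
Lemma translation_interior th : 0 < th < pi ->
  {ae lebV, forall x, dotrV x x < 1 ->
    ((F th x)%:E = \int[lebV]_u (ell_w x u * f0 (orbit_pt th x u))%:E)%E}.
Proof.
move=> thi; have mf0 := measurable_oball_cut.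
have thc : 0 <= th <= pi by move: thi => /andP[? ?]; rewrite !ltW.
have FL1 : L1_ball mu (F th) by case: trF => _ /(_ th thc).
pose k y x := f0 x * orbit_kernel th y x.
have mk : measurable_fun setT (fun z : 'rV[R]_d * 'rV[R]_d => k z.1 z.2).
  apply: measurable_funM; first exact: (measurableT_comp mf0 measurable_snd).
  exact: measurable_orbit_kernel.
have ikap x : dotrV x x < 1 -> (\int[lebV]_y (orbit_kernel th x y)%:E = (ball_w x)%:E)%E.
  move=> x1; transitivity (\int[lebV]_y ((orbit_kernel th x y)%:E * 1))%E.
    by apply: eq_integral => y _; rewrite mule1.
  rewrite -(@integral_ell_w_orbit_kernel R d mu d0 mu0 th x (cst 1%E) thi x1)//.
  under eq_integral do rewrite mule1.
  by rewrite integral_ell_w// mule1.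
have bnd : (\int[lebV]_y \int[lebV]_x `|k y x|%:E < +oo)%E.
  have mke : measurable_fun setT (fun z : 'rV[R]_d * 'rV[R]_d => `|k z.1 z.2|%:E).
    by apply/measurable_EFinP; exact: measurableT_comp.
  rewrite (@fubini_tonelli _ _ _ _ _ lebV lebV (fun z => `|k z.1 z.2|%:E))//=.
  have /integrableP[_] := integrable_weighted d0 fL1.
  congr (_ < +oo)%E; apply: eq_integral => x _; apply/esym.
  have [x1|x1] := ltP (dotrV x x) 1; last first.
    rewrite integral0_eq; first by rewrite /= /weighted ltNge x1 /= normr0.
    by move=> y _; rewrite /k oball_cut_out// mul0r normr0.
  transitivity (\int[lebV]_y (`|f x|%:E * (orbit_kernel th x y)%:E))%E.
    apply: eq_integral => y _; rewrite -EFinM /k normrM oball_cutE//.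
    by rewrite (ger0_norm (orbit_kernel_ge0 d0 mu0 _ _ _)) orbit_kernelC.
  rewrite ge0_integralZl//; last 2 first.
  - apply/measurable_EFinP.
    exact: (measurableT_comp (@measurable_orbit_kernel R d mu th) (pair1_measurable x)).
  - by move=> y _; rewrite lee_fin orbit_kernel_ge0.
  by rewrite ikap// -EFinM /= /weighted x1 normrM (ger0_norm (ball_w_ge0 _ _)).
pose V y := \int[lebV]_x k y x.
have iV : lebV.-integrable setT (EFin \o V) by exact: integrable_Rintegral mk bnd.
have iw := integrable_weighted d0 FL1.
have aeV : {ae lebV, forall y, weighted (F th) y = V y}.
  apply: (tests_separate iw iV) => phi tphi cphi; have [mphi phi01] := tphi.
  have := @pairing_dual R d mu d0 mu0 f F fL1 trF phi tphi cphi th thc.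
  rewrite /pairing => ->.
  pose k2 x y := f0 x * orbit_kernel th x y * phi y.
  have mk2 : measurable_fun setT (fun z : 'rV[R]_d * 'rV[R]_d => k2 z.1 z.2).
    apply: measurable_funM; last exact: (measurableT_comp mphi measurable_snd).
    apply: measurable_funM; first exact: (measurableT_comp mf0 measurable_fst).
    exact: measurable_orbit_kernel.
  have bnd2 : (\int[lebV]_x \int[lebV]_y `|k2 x y|%:E < +oo)%E.
    have mk2e : measurable_fun setT (fun z : 'rV[R]_d * 'rV[R]_d => `|k2 z.1 z.2|%:E).
      by apply/measurable_EFinP; exact: measurableT_comp.
    have mke : measurable_fun setT (fun z : 'rV[R]_d * 'rV[R]_d => `|k z.1 z.2|%:E).
      by apply/measurable_EFinP; exact: measurableT_comp.
    rewrite (@fubini_tonelli _ _ _ _ _ lebV lebV (fun z => `|k2 z.1 z.2|%:E))//=.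
    apply: le_lt_trans bnd; apply: ge0_le_integral => //.
    - by move=> y _; apply: integral_ge0 => x _; rewrite lee_fin.
    - by apply: (measurable_fun_fubini_tonelli_G _ mk2e) => z; rewrite lee_fin.
    - by apply: (measurable_fun_fubini_tonelli_F _ mke) => z; rewrite lee_fin.
    move=> y _; apply: ge0_le_integral => //.
    - exact: (measurableT_comp mk2e (pair2_measurable y)).
    - exact: (measurableT_comp mke (pair1_measurable y)).
    move=> x _; rewrite lee_fin /k2 normrM orbit_kernelC ler_piMr//.
    by have /andP[p0 p1] := phi01 y; rewrite ger0_norm.
  have -> : \int[lebV]_x (weighted f x * orbit_mean phi th x) = \int[lebV]_x \int[lebV]_y k2 x y.
    apply: eq_Rintegral => x _; have [x1|x1] := ltP (dotrV x x) 1; last first.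
      rewrite /weighted ltNge x1 /= mul0r (_ : (fun y => k2 x y) = cst 0).
        by rewrite Rintegral_cst// mul0r.
      by apply/funext => y; rewrite /k2 oball_cut_out// !mul0r.
    have mphie : measurable_fun setT (EFin \o phi) by exact/measurable_EFinP.
    have := @integral_ell_w_orbit_kernel R d mu d0 mu0 th x (EFin \o phi) thi x1 mphie.
    have -> : (\int[lebV]_u ((ell_w x u)%:E * (EFin \o phi) (orbit_pt th x u)) =
        (orbit_mean phi th x)%:E)%E.
      by rewrite (orbit_meanE d0 mu0 th tphi x1); apply: eq_integral => u _; rewrite -EFinM.
    move=> E.
    have mky : measurable_fun setT (fun y => orbit_kernel th x y * phi y).
      apply: measurable_funM => //.
      exact: (measurableT_comp (@measurable_orbit_kernel R d mu th) (pair1_measurable x)).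
    have iky : lebV.-integrable setT (fun y => (orbit_kernel th x y * phi y)%:E).
      apply/integrableP; split; first exact/measurable_EFinP.
      apply: (@le_lt_trans _ _ (\int[lebV]_y ((orbit_kernel th x y)%:E * (EFin \o phi) y))%E).
        rewrite le_eqVlt; apply/orP; left; apply/eqP; apply: eq_integral => y _.
        have /andP[p0 _] := phi01 y.
        by rewrite gee0_abs ?EFinM// lee_fin mulr_ge0// orbit_kernel_ge0.
      by rewrite -E -EFinM ltry.
    transitivity (f x * \int[lebV]_y (orbit_kernel th x y * phi y)).
      rewrite /weighted x1 -mulrA; congr (_ * _).
      by apply: EFin_inj; rewrite EFinM E /Rintegral fineK// integrable_fin_num.
    rewrite -(RintegralZl _ measurableT iky).
    by apply: eq_Rintegral => y _; rewrite /k2 oball_cutE// mulrA.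
  rewrite (Rfubini mk2 bnd2).
  rewrite {1}/Rintegral [in RHS]/Rintegral; congr fine; apply: ae_eq_integral => //.
  - by apply/measurable_EFinP; exact: measurable_Rintegral2 mk2 bnd2.
  - by have /measurable_int := integrable_mul01 iV mphi phi01.
  have := ae_integrable_section mk bnd; apply: filterS => y iky _; congr EFin.
  rewrite /V -(RintegralZr _ measurableT iky).
  by apply: eq_Rintegral => x _; rewrite /k2 /k orbit_kernelC.
move: aeV (ae_fine_integral mk bnd); apply: filterS2 => y aeVy fin_y y1.
have w0 := ball_w_gt0 mu y1.
have mf0e : measurable_fun setT (EFin \o f0) by exact/measurable_EFinP.
have := @integral_ell_w_orbit_kernel R d mu d0 mu0 th y (EFin \o f0) thi y1 mf0e.
rewrite [X in _ = X -> _](_ : _ = (F th y * ball_w y)%:E); last first.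
  transitivity ((V y)%:E); last first.
    by rewrite -aeVy /weighted y1.
  rewrite fin_y; apply: eq_integral => x _.
  by rewrite /k EFinM muleC.
have -> : (\int[lebV]_u ((ell_w y u)%:E * (EFin \o f0) (orbit_pt th y u)) =
  \int[lebV]_u (ell_w y u * f0 (orbit_pt th y u))%:E)%E.
  by apply: eq_integral => u _; rewrite -EFinM.
move=> E; transitivity ((ball_w y)^-1%:E * ((ball_w y)%:E *
    \int[lebV]_u (ell_w y u * f0 (orbit_pt th y u))%:E))%E.
  by rewrite E -EFinM; congr EFin; field; rewrite lt0r_neq0.
by rewrite muleA -EFinM mulVf ?lt0r_neq0// mul1e.
Qed.

(** The right-hand side of [pairing_dual] evaluates phi at x or - x, and Lebesgue
    measure is invariant under x -> - x. *)
Lemma translation_axis th : 0 <= th <= pi -> sin th = 0 ->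
  {ae lebV, forall x, dotrV x x < 1 -> F th x = f (cos th *: x)}.
Proof.
move=> thc sth0; have mf0 := measurable_oball_cut.
have FL1 : L1_ball mu (F th) by case: trF => _ /(_ th thc).
pose s := cos th.
have s2 : s ^+ 2 = 1 by have := cos2Dsin2 th; rewrite sth0 expr0n addr0.
have s0 : s != 0 by rewrite -sqrf_eq0 s2 oner_neq0.
have sn : `|s| = 1.
  by apply/eqP; rewrite -(@eqrXn2 _ 2)// expr1n real_normK ?num_real// s2.
have ssV x : s *: (s *: x) = x by rewrite scalerA -expr2 s2 scale1r.
have dotrVs x : dotrV (s *: x) (s *: x) = dotrV x x.
  by rewrite dotrVZl dotrVZr mulrA -expr2 s2 mul1r.
pose V x := weighted f (s *: x).
have ms : measurable_fun setT (fun x => s *: x) by exact: measurable_rVZ.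
have reflect (h : 'rV[R]_d -> \bar R) : measurable_fun setT h ->
    (\int[lebV]_x h (s *: x)%R = \int[lebV]_x h x)%E.
  move=> mh; rewrite [RHS](integral_affine_rV 0 s0 mh) sn expr1n mul1e.
  by apply: eq_integral => x _; rewrite add0r.
have iwf := integrable_weighted d0 fL1.
have iV : lebV.-integrable setT (EFin \o V).
  have /integrableP[mwf wfoo] := iwf; apply/integrableP; split.
    exact: (measurableT_comp mwf ms).
  by rewrite (reflect (fun x => `|(weighted f x)%:E|%E))//; exact: measurableT_comp.
have iw := integrable_weighted d0 FL1.
have aeV : {ae lebV, forall y, weighted (F th) y = V y}.
  apply: (tests_separate iw iV) => phi tphi cphi; have [mphi phi01] := tphi.
  have := @pairing_dual R d mu d0 mu0 f F fL1 trF phi tphi cphi th thc.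
  rewrite /pairing => ->.
  have miV : measurable_fun setT (fun x => (V x * phi x)%:E).
    by have /measurable_int := integrable_mul01 iV mphi phi01.
  rewrite [in RHS]/Rintegral -(reflect _ miV); congr fine.
  apply: eq_integral => x _; congr EFin; rewrite /V ssV.
  have [x1|x1] := ltP (dotrV x x) 1; last by rewrite /weighted ltNge x1 !mul0r.
  by rewrite (orbit_mean_axis d0 mu0 tphi x1 sth0).
move: aeV; apply: filterS => x; rewrite /V /weighted dotrVs => + x1.
rewrite x1 /ball_w dotrVs => /mulIf; apply.
by rewrite lt0r_neq0//; exact: (ball_w_gt0 mu x1).
Qed.

Lemma translation_formula th : 0 <= th <= pi ->
  {ae lebV, forall x, dotrV x x < 1 ->
    ((F th x)%:E = \int[lebV]_u (ell_w x u * f0 (orbit_pt th x u))%:E)%E}.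
Proof.
move=> /andP[th0 thpi].
have [sth0|sthN] := eqVneq (sin th) 0.
  have := @translation_axis th; rewrite th0 thpi => /(_ isT sth0).
  apply: filterS => x + x1 => /(_ x1) ->.
  have s2 : cos th ^+ 2 = 1 by have := cos2Dsin2 th; rewrite sth0 expr0n addr0.
  have y1 : dotrV (cos th *: x) (cos th *: x) < 1.
    by rewrite dotrVZl dotrVZr mulrA -expr2 s2 mul1r.
  transitivity (\int[lebV]_u ((ell_w x u)%:E * (f (cos th *: x))%:E))%E; last first.
    apply: eq_integral => u _; rewrite -EFinM; congr (_ * _)%:E.
    by rewrite /orbit_pt sth0 mul0r scale0r addr0 oball_cutE.
  rewrite integralZr//; last exact: integrable_ell_w.
  by rewrite integral_ell_w// mul1e.
apply: translation_interior; rewrite !lt_neqAle th0 thpi !andbT.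
apply/andP; split; apply: contraNneq sthN => e; first by rewrite -e sin0.
by rewrite e sinpi.
Qed.

(** Inside the ellipsoid the orbit point lies in the open ball, where f is not
    modified; the boundary of the ellipsoid is null.  On the closed ellipsoid
    the orbit point stays in the closed ball, hence the integrand is
    measurable. *)
Lemma integral_ell_wE th x : dotrV x x < 1 ->
  (\int[lebV]_u (ell_w x u * f0 (orbit_pt th x u))%:E =
   (A_const d mu * Num.sqrt (1 - enorm x ^+ 2) ^+ (d - 1))%:E *
     \int[lebV]_(u in [set u | (Aform x u <= 1)%R])
       (f (cos th *: x + (sin th * Num.sqrt (1 - enorm x ^+ 2)) *: u)
        * (1 - Aform x u) `^ (mu - 1))%:E)%E.
Proof.
move=> x1; have mf0 := measurable_oball_cut.
have [A0 _] := A_constE d0 mu0; have s0 := height_gt0 x1.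
have c0 : 0 < A_const d mu * height x ^+ (d - 1) by rewrite mulr_gt0 ?exprn_gt0.
have mm := @measurable_orbit_pt R d th x.
have mA := @measurable_AformT R d x.
have mpos : measurable_fun setT (fun u => (pospow (mu - 1) (1 - Aform x u) * f0 (orbit_pt th x u))%:E).
  apply/measurable_EFinP; apply: measurable_funM; last exact: (measurableT_comp mf0 mm).
  by apply: measurableT_pospow; exact: measurable_funB.
transitivity ((A_const d mu * height x ^+ (d - 1))%:E *
    \int[lebV]_u (pospow (mu - 1) (1 - Aform x u) * f0 (orbit_pt th x u))%:E)%E.
  rewrite -(integralZl_gt0 _ c0 mpos); apply: eq_integral => u _.
  by rewrite -EFinM /ell_w mulrA.
congr (_ * _)%E.
pose E : set 'rV[R]_d := [set u | Aform x u <= 1].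
have mE : measurable E.
  rewrite (_ : E = Aform x @^-1` `]-oo, 1]%classic); first exact: measurable_Aform_set.
  by apply/seteqP; split => u /=; rewrite in_itv.
have orbit_pt_in u : E u -> eball (orbit_pt th x u).
  rewrite /E /= eballE => u1.
  have := discr_orbit_pt th u (ltW x1); rewrite /discr => e.
  have : 0 <= (1 - dotrV x x) * (1 - dotrV (orbit_pt th x u) (orbit_pt th x u)).
    rewrite (_ : _ * _ = (sin th * height x) ^+ 2 * (1 - Aform x u) +
      (cos th - dotrV x (orbit_pt th x u)) ^+ 2); last by rewrite -e subrK.
    by rewrite addr_ge0 ?sqr_ge0// mulr_ge0 ?sqr_ge0// subr_ge0.
  by rewrite pmulr_rge0 ?subr_gt0// subr_ge0.
rewrite [RHS]integral_mkcond; apply: ae_eq_integral => //.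
  apply/(measurable_restrictT _ mE); apply/measurable_EFinP.
  apply: measurable_funM; last first.
    apply: measurable_funTS; apply: (measurableT_comp (measurable_powR _)).
    exact: measurable_funB.
  have mfb : measurable_fun eball f by case: fL1.
  apply: (measurable_comp (@measurable_eball R d) _ mfb); last exact: measurable_funTS.
  by move=> _ [u Eu <-]; exact: orbit_pt_in.
exists [set u | Aform x u = 1]; split.
- rewrite (_ : [set u | _] = Aform x @^-1` [set 1])//.
  by apply: measurable_Aform_set.
- exact: ellipsoid_boundary_null.
move=> u /=; apply: contra_notP => /eqP un1 _.
rewrite patchE; case: ifPn => [|].
  rewrite inE /E /= => u1; have ult : Aform x u < 1 by rewrite lt_neqAle un1.
  rewrite gt0_pospow ?subr_gt0// mulrC; congr (_ * _)%:E.
  rewrite -[cos th *: x + _]/(orbit_pt th x u) oball_cutE//.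
  have [sth0|sthN] := eqVneq (sin th) 0.
    rewrite /orbit_pt sth0 mul0r scale0r addr0 dotrVZl dotrVZr mulrA -expr2.
    by have := cos2Dsin2 th; rewrite sth0 expr0n addr0 => ->; rewrite mul1r.
  have := @discr_gt0_bounds R d x (orbit_pt th x u) (cos th) x1.
  rewrite discr_orbit_pt ?(ltW x1)// mulr_gt0 ?subr_gt0//; first by move=> /(_ isT)[].
  by rewrite exprn_even_gt0//= mulf_neq0// lt0r_neq0.
rewrite notin_setE /E /= => /negP; rewrite -ltNge => u1.
by rewrite le0_pospow ?mul0r// subr_le0 ltW.
Qed.

End formula.

Theorem theorem3p6 (R : realType) (d : nat) (mu : R)
    (T : R -> ('rV[R]_d -> R) -> 'rV[R]_d -> R) :
  (1 <= d)%N -> 0 < mu -> generalized_translation mu T ->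
  forall f : 'rV[R]_d -> R, L1_ball mu f ->
  forall theta : R, 0 <= theta <= pi ->
  {ae lebesgue_rV R d, forall x : 'rV[R]_d, enorm x < 1 ->
    ((T theta f x)%:E =
     (A_const d mu * Num.sqrt (1 - enorm x ^+ 2) ^+ (d - 1))%:E *
     \int[lebesgue_rV R d]_(u in [set u | (Aform x u <= 1)%R])
       (f (cos theta *: x + (sin theta * Num.sqrt (1 - enorm x ^+ 2)) *: u)
        * (1 - Aform x u) `^ (mu - 1))%:E)%E}.
Proof.
move=> d0 mu0 TT f fL1 th thi.
apply: filterS (translation_formula d0 mu0 fL1 (TT f fL1) thi) => x.
by rewrite -enorm_lt1 => H x1; rewrite H// (integral_ell_wE d0 mu0 fL1)// -enorm_lt1.
Qed.
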